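(* Let $K\in\mathbb R$ and let $(X,\mathsf d,\mathfrak m)$ be an $\mathsf{RCD}(K,\infty)$ metric measure space with $\mathfrak m(X)=\infty$. Suppose that $\lambda_0:=\inf\sigma_d(-\Delta)<\Sigma$ (this is always the case if the spectrum is discrete) and that the $\lambda_0$-eigenfunction of $-\Delta$ belongs to $L^\infty(X,\mathfrak m)$. Then equality in Cheeger's inequality is never attained, i.e. $$\lambda_0>\frac14\,h(X)^2 ,$$ where $h(X)$ is the Cheeger constant of $X$.
   Context: A metric measure space $(X,\mathsf d,\mathfrak m)$ is a complete separable metric space with a $\sigma$-finite non-negative Borel measure $\mathfrak m$ such that $\operatorname{supp}\mathfrak m=X$ and, for some $x_0\in X$, $M>0$, $c\ge 0$, $\mathfrak m(B_r(x_0))\le M e^{cr^2}$ for all $r\ge 0$. Slope: $\mathrm{lip}(f)(x)=\limsup_{y\to x}|f(y)-f(x)|/\mathsf d(x,y)$ ($=0$ at isolated points). $\mathsf{Lip}_{bs}(X)$: real Lipschitz functions with bounded support; $\mathsf{Lip}_{loc}(X)$: functions that are Lipschitz on bounded sets. $\mathcal P_2(X)$ is the space of probability measures with finite second moment, with Kantorovich–Wasserstein distance $W_2$. $\mathsf{Ent}_{\mathfrak m}(\mu)=\int\rho\log\rho\,d\mathfrak m$ if $\mu=\rho\mathfrak m$ with $(\rho\log\rho)^-\in L^1(X,\mathfrak m)$, and $+\infty$ otherwise; $D(\mathsf{Ent}_{\mathfrak m})=\{\mu\in\mathcal P_2(X):\mathsf{Ent}_{\mathfrak m}(\mu)\in\mathbb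 R\}$. The space is $\mathsf{CD}(K,\infty)$ if for all $\mu_0,\mu_1\in D(\mathsf{Ent}_{\mathfrak m})$ there is a $W_2$-geodesic $(\mu_t)_{t\in[0,1]}$ joining them with $\mathsf{Ent}_{\mathfrak m}(\mu_t)\le(1-t)\mathsf{Ent}_{\mathfrak m}(\mu_0)+t\,\mathsf{Ent}_{\mathfrak m}(\mu_1)-\frac K2 t(1-t)W_2^2(\mu_0,\mu_1)$ for all $t$. The Cheeger energy is $\mathsf{Ch}_{\mathfrak m,2}(f)=\inf\{\liminf_n\frac12\int_X\mathrm{lip}(f_n)^2d\mathfrak m: f_n\in\mathsf{Lip}_{bs}(X),\ f_n\to f\text{ in }L^2(X,\mathfrak m)\}$. The space is $\mathsf{RCD}(K,\infty)$ if it is $\mathsf{CD}(K,\infty)$ and $\mathsf{Ch}_{\mathfrak m,2}$ is a quadratic form. Laplacian: $D(\Delta)$ is the set of $f\in L^2(X,\mathfrak m)$ whose $L^2$-subdifferential $\partial\mathsf{Ch}_{\mathfrak m,2}(f)$ is nonempty, and $-\Delta f$ is its element of minimal $L^2$-norm; $-\Delta$ is a densely defined nonnegative self-adjoint operator on $L^2(X,\mathfrak m)$ with spectrum $\sigma(-\Delta)\subset[0,\infty)$. An eigenvalue $\lambda$ with eigenfunction $f$ means $0\ne f\in D(\Delta)$, $-\Delta f=\lambda f$; the point spectrum is the set of eigenvalues. The discrete spectrum $\sigma_d(-\Delta)$ is the set of eigenvalues that are isolated in the point spectrum and have finite-dimensional eigenspace; $\sigma_{ess}(-\Delta)=\sigma(-\Delta)\setminus\sigma_d(-\Delta)$;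 $\Sigma=\inf\sigma_{ess}(-\Delta)$, with $\Sigma=+\infty$ if $\sigma_{ess}(-\Delta)=\emptyset$. Under the hypotheses, $\lambda_0$ equals $\inf\{\int_X\mathrm{lip}(f)^2d\mathfrak m/\int_X f^2d\mathfrak m: 0\not\equiv f\in\mathsf{Lip}_{bs}(X)\}$. $\mathrm{Per}(A)=\inf\{\liminf_n\int_X\mathrm{lip}(f_n)\,d\mathfrak m: f_n\in\mathsf{Lip}_{loc}(X),\ f_n\to\chi_A\text{ in }L^1(X,\mathfrak m)\}$ for Borel $A$. For $\mathfrak m(X)=\infty$ the Cheeger constant is $h(X)=\inf\{\mathrm{Per}(A)/\mathfrak m(A): A\subset X\text{ Borel},\ 0<\mathfrak m(A)<\infty\}$. *)

(* Defs.v *)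
From HB Require Import structures.
From mathcomp Require Import all_boot all_order all_algebra.
From mathcomp Require Import all_classical all_reals all_analysis.
From mathcomp Require Import giry.

Set Implicit Arguments.
Unset Strict Implicit.
Unset Printing Implicit Defensive.

Import Order.TTheory GRing.Theory Num.Theory.
Import numFieldNormedType.Exports.

Local Open Scope classical_set_scope.
Local Open Scope ring_scope.

#[short(type="completeMetricMeasurableType")]
HB.structure Definition CompleteMetricMeasurable d (R : realType) :=
  {T of Measurable d T & Metric R T & Complete T}.

(* Square-integrable functions; equality in the space L^2(m) is equality
   m-almost everywhere of these representatives. *)
Notation L2 m := (LfunType m (lee1n 2)).

(* The form takes the value +oo outside its domain. *)
Definition is_quadratic_form (R : realType) (V : lmodType R)
    (Q : V -> \bar R) : Prop :=
  let D := [set v | (Q v < +oo)%E] in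
  [/\ D 0, forall a u v, D u -> D v -> D (a *: u + v) &
  exists B : V -> V -> R,
    [/\ forall u v, D u -> D v -> B u v = B v u,
        forall a u v w, D u -> D v -> D w ->
          B (a *: u + v) w = a * B u w + B v w &
        forall u, D u -> Q u = (B u u)%:E]].

Section metric.
Context {d : measure_display} {R : realType}.
Context {X : completeMetricMeasurableType d R}.
Implicit Types (f : X -> R) (A : set X).

Definition metric_bounded A : Prop := exists x (r : R), A `<=` ball x r.

Definition lipschitz_in A f : Prop :=
  exists L : R, forall x y, A x -> A y -> `|f x - f y| <= L * mdist x y.

Definition Lip_bs : set (X -> R) := [set f |
  lipschitz_in setT f /\ metric_bounded (closure [set x | f x != 0])].

Definition Lip_loc : set (X -> R) := [set f |
  forall A, metric_bounded A -> lipschitz_in A f].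

(* At an isolated point x^' is the trivial filter and limf_esup gives -oo,
   whence the case distinction. *)
Definition slope f (x : X) : \bar R :=
  if `[< isolated [set: X] x >] then 0%E
  else limf_esup (fun y : X => (`|f y - f x| / mdist x y)%:E) x^'.

End metric.

Section metric_measure.
Context {d : measure_display} {R : realType}.
Context {X : completeMetricMeasurableType d R}.
Variable m : {measure set X -> \bar R}.
Local Open Scope ereal_scope.

Definition msupport : set X :=
  [set x | forall U : set X, open U -> U x -> 0 < m U].

Record is_metric_measure_space : Prop := {
  mms_borel : @measurable d X = <<s [set U : set X | open U] >> ;
  mms_separable : exists2 S : set X, countable S & dense S ;
  mms_support : msupport = [set: X] ;
  mms_growth : exists x0 (M c : R), [/\ (0 < M)%R, (0 <= c)%R &
    forall r : R, (0 <= r)%R -> m (ball x0 r) <= (M * expR (c * r ^+ 2))%:E]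
}.

Definition P2 : set (probability X R) := [set mu |
  exists x0 : X, \int[mu]_x ((mdist x0 x) ^+ 2)%:E < +oo].

Definition coupling (mu nu : probability X R) :
    set (probability (X * X)%type R) := [set p |
  forall A, measurable A -> p (A `*` setT) = mu A /\ p (setT `*` A) = nu A].

Definition W2 (mu nu : probability X R) : \bar R :=
  (ereal_inf [set \int[p]_z ((mdist z.1 z.2) ^+ 2)%:E | p in coupling mu nu])
    `^ (2^-1)%R.

Definition W2_geodesic (mu : R -> probability X R) : Prop :=
  (forall t : R, (0 <= t <= 1)%R -> P2 (mu t)) /\
  (forall s t : R, (0 <= s <= 1)%R -> (0 <= t <= 1)%R ->
    W2 (mu s) (mu t) = `|t - s|%:E * W2 (mu 0%R) (mu 1%R)).

(* Densities are unique up to m-null sets, so the infimum below is taken over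
   a set with at most one element; the infimum of the empty set is +oo. *)
Definition entropy (mu : probability X R) : \bar R :=
  ereal_inf [set \int[m]_x (rho x * ln (rho x))%:E | rho in
    [set rho : X -> R | [/\ measurable_fun setT rho,
      forall x, (0 <= rho x)%R,
      forall A, measurable A -> mu A = \int[m]_(x in A) (rho x)%:E &
      m.-integrable setT (fun x => (rho x * ln (rho x))%:E)^\-]]].

Definition entropy_domain : set (probability X R) :=
  [set mu | P2 mu /\ entropy mu \is a fin_num].

(* [measure_eq] is used because equality of measures is only meaningful on
   measurable sets. *)
Definition CD (K : R) : Prop :=
  forall mu0 mu1, entropy_domain mu0 -> entropy_domain mu1 ->
  exists mu : R -> probability X R,
    [/\ measure_eq (mu 0%R) mu0, measure_eq (mu 1%R) mu1, W2_geodesic mu &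
    forall t : R, (0 <= t <= 1)%R ->
      entropy (mu t) <= (1 - t)%:E * entropy mu0 + t%:E * entropy mu1
        - (K / 2 * t * (1 - t))%:E * W2 mu0 mu1 ^+ 2].

Definition cheeger_energy (f : L2 m) : \bar R :=
  ereal_inf [set e | exists u : nat -> X -> R,
    [/\ forall n, Lip_bs (u n),
        'N[m]_2[EFin \o (u n \- f)%R] @[n --> \oo] --> 0 &
        e = limn_einf (fun n => (2^-1)%:E * \int[m]_x (slope (u n) x) ^+ 2)]].

Definition RCD (K : R) : Prop := CD K /\ is_quadratic_form cheeger_energy.

Definition subdifferential (f : L2 m) : set (L2 m) := [set g |
  cheeger_energy f < +oo /\
  forall h : L2 m,
    cheeger_energy f + \int[m]_x (g x * (h x - f x))%:E <= cheeger_energy h].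

(* As an operator on L^2(m) the Laplacian is recorded by its graph:
   [neg_laplacian f g] means that f is in the domain and - Delta f = g. *)
Definition neg_laplacian (f g : L2 m) : Prop :=
  subdifferential f g /\
  forall g' : L2 m, subdifferential f g' ->
    'N[m]_2[EFin \o g] <= 'N[m]_2[EFin \o g'].

Definition eigenfunction (l : R) (f : L2 m) : Prop :=
  ~ ((f : X -> R) = cst 0%R %[ae m]) /\ neg_laplacian f (l *: f)%R.

Definition point_spectrum : set R :=
  [set l | exists f, eigenfunction l f].

Definition finite_dim_eigenspace (l : R) : Prop :=
  exists n (e : 'I_n -> L2 m), forall f, neg_laplacian f (l *: f)%R ->
    exists c : 'I_n -> R,
      (f : X -> R) = ((\sum_i c i *: e i)%R : L2 m) %[ae m].

(* - Delta - l is a bijection onto L^2(m) with bounded inverse; the second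
   condition contains injectivity. *)
Definition resolvent_set : set R := [set l |
  (forall k : L2 m, exists f g : L2 m,
    neg_laplacian f g /\ ((g - l *: f)%R : L2 m) = k %[ae m]) /\
  (exists C : R, forall f g : L2 m, neg_laplacian f g ->
    'N[m]_2[EFin \o f] <= C%:E * 'N[m]_2[EFin \o (g - l *: f)%R])].

Definition spectrum : set R := ~` resolvent_set.

Definition discrete_spectrum : set R := [set l |
  isolated point_spectrum l /\ finite_dim_eigenspace l].

Definition essential_spectrum : set R := spectrum `\` discrete_spectrum.

(* Both infima are +oo when the set is empty. The inequality
   inf_discrete_spectrum < inf_essential_spectrum forces the former to be
   finite, since eigenvalues are nonnegative. *)
Definition inf_discrete_spectrum : \bar R :=
  ereal_inf (EFin @` discrete_spectrum).

Definition inf_essential_spectrum : \bar R :=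
  ereal_inf (EFin @` essential_spectrum).

Definition perimeter (A : set X) : \bar R :=
  ereal_inf [set e | exists u : nat -> X -> R,
    [/\ forall n, Lip_loc (u n),
        'N[m]_1[EFin \o (u n \- \1_A)%R] @[n --> \oo] --> 0 &
        e = limn_einf (fun n => \int[m]_x slope (u n) x)]].

(* The form of the constant for spaces of infinite measure. *)
Definition cheeger_constant : \bar R :=
  ereal_inf [set perimeter A / m A | A in
    [set A : set X | measurable A /\ 0 < m A < +oo]].

End metric_measure.

(* Main.v *)
Require Import Defs.
From HB Require Import structures.
From mathcomp Require Import all_boot all_order all_algebra.
From mathcomp Require Import all_classical all_reals all_analysis.
From mathcomp Require Import ring lra.
From mathcomp Require Import measurable_realfun giry.

Set Implicit Arguments.
Unset Strict Implicit.
Unset Printing Implicit Defensive.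

Import Order.TTheory GRing.Theory Num.Theory.
Import numFieldNormedType.Exports.

Local Open Scope classical_set_scope.
Local Open Scope ring_scope.

(** The proof is by contradiction.  Let [l] be the infimum of the discrete
spectrum and [f] the bounded eigenfunction, and suppose that [l <= h ^ 2 / 4],
where [h] is the Cheeger constant.

The coarea argument bounds [h] times the integral of a nonnegative Lipschitz
function of bounded support by the integral of its slope ([cheeger_Lip_bs]).
Cheeger's inequality results from this bound for [u ^ 2] and the Cauchy-Schwarz
inequality.  Under the assumption on [l] there is no room for loss when [u]
approximates [f] in energy, so the slope of [u] is close to [sqrt l * |u|] in
the square mean ([cheeger_equality_deficit]).  A substitute for the equation
[|grad f| = sqrt l * |f|] is thus available, and with it the energy of [psi f]
is at most [l / 2] times the integral of [(psi' f * f) ^ 2].  For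
[psi s = s - th * s ^ 3], which contracts distances on the range of [f] when
[th] is small, this energy is below that of [f] by [3 * th * l] times the
integral of [f ^ 4], up to terms of second order in [th].  But [l *: f] is a
subgradient at [f], so that the energy drops by at most [th * l] times this
integral.  Hence [l = 0] ([cheeger_equality_eigenvalue0]), and [f] has zero
energy by Euler's identity ([eigenfunction_energy]).

It remains to see that no nonzero square integrable function has zero energy
([energy_neq0]); here the curvature condition enters.  Some truncation
[g = max 0 (|f| - t)] is positive on a bounded set [C] of positive measure and,
the measure of the space being infinite, zero on another such set [B].  Take
Lipschitz functions that converge to [g] with energies tending to zero, add
small multiples of a Gaussian, square and normalise: this gives probabilities
[mu] whose Fisher information is arbitrarily small, with mass bounded below on
[C] and tending to zero on [B].  Convexity of the entropy along a geodesic from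
[mu] to any [nu] gives, on differentiating at [mu], a bound on the entropy lost
between [mu] and [nu] by the squared distance and the Fisher information
([hwi]).  Let [nu] arise from [mu] by spreading a small fraction [dlt] of the
mass on [C] uniformly over [B].  The squared distance is of order [dlt]
([displacement_coupling]), while the entropy decreases by an amount of order
[dlt * ln (1 / dlt)] ([displaced_entropy_le]).  For small [dlt] and vanishing
Fisher information this is contradictory ([zero_energy_contradiction]). *)

(** * Pointwise calculus of the slope *)

Section slope_calculus.
Context {d : measure_display} {R : realType}
  {X : completeMetricMeasurableType d R}.
Implicit Types (u v : X -> R) (x y : X) (a b e r : R).

Lemma isolated_ball x :
  isolated [set: X] x <-> exists2 r, 0 < r & forall y, mdist x y < r -> y = x.
Proof.
split=> [[_ [V /nbhs_ballP[r /= r0 rV]]]|[r r0 rx]].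
  rewrite setIT => Vx; exists r => // y xy.
  by have : V y; [apply: rV; rewrite ballEmdist|rewrite Vx].
split; first by rewrite in_setT.
exists (ball x r); first exact: nbhsx_ballx.
rewrite setIT ballEmdist; apply/seteqP; split => [y /= /rx//|y /= ->].
by rewrite mdistxx.
Qed.

Lemma slope_ge0 u x : (0 <= slope u x)%E.
Proof.
rewrite /slope; case: asboolP => // nx.
apply: limf_esup_ge0 => [|y]; last first.
  by rewrite lee_fin divr_ge0 ?mdist_ge0.
move=> /nbhs_ballP[r /= r0 rx]; apply/nx/isolated_ball.
exists r => // y xy; apply: contrapT => /eqP yx.
by apply: (rx y) => //; rewrite ballEmdist.
Qed.

(** The upper limit in epsilon-delta form, which is also correct at isolated
points, where the punctured filter is trivial. *)
Lemma slope_leP u x a : 0 <= a ->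
  (slope u x <= a%:E)%E <->
  (forall e, 0 < e -> exists2 r, 0 < r & forall y, mdist x y < r ->
    `|u y - u x| <= (a + e) * mdist x y).
Proof.
move=> a0; split => [ua e e0|H].
  move: ua; rewrite /slope; case: asboolP => [/isolated_ball[r r0 rx] _|nx ua].
    by exists r => // y /rx ->; rewrite subrr normr0 mdistxx mulr0.
  have /ereal_inf_lt[_ [V /nbhs_ballP[r /= r0 rV] <-] Vae] :
      (limf_esup (fun y : X => (`|u y - u x| / mdist x y)%:E) x^' <
       (a + e)%:E)%E.
    by rewrite (le_lt_trans ua)// lte_fin ltrDl.
  exists r => // y xy; have [->|yx] := eqVneq y x.
    by rewrite subrr normr0 mdistxx mulr0.
  have d0 : 0 < mdist x y by rewrite mdist_gt0 eq_sym.
  rewrite -ler_pdivrMr// -lee_fin; apply: le_trans (ltW Vae).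
  by apply: ereal_sup_ubound; exists y => //; apply: rV => //; rewrite ballEmdist.
rewrite /slope; case: asboolP => [_|nx]; first by rewrite lee_fin.
apply/lee_addgt0Pr => e e0; have [r r0 rx] := H _ e0.
rewrite limf_esupE.
apply: (@le_trans _ _ (ereal_sup ((fun y : X => (`|u y - u x| / mdist x y)%:E) @`
   [set y | mdist x y < r /\ y != x]))).
  apply: ereal_inf_lbound; exists [set y | mdist x y < r /\ y != x] => //.
  apply/nbhs_ballP; exists r => //= y; rewrite ballEmdist /= => xy yx.
  by split.
apply: ge_ereal_sup => _ [y /= [xy yx] <-].
have d0 : 0 < mdist x y by rewrite mdist_gt0 eq_sym.
by rewrite lee_fin ler_pdivrMr// rx.
Qed.

Lemma slope_real u x a : (slope u x <= a%:E)%E ->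
  slope u x = (fine (slope u x))%:E.
Proof.
move=> ua; rewrite fineK// ge0_fin_numE ?slope_ge0//.
exact: le_lt_trans ua (ltry _).
Qed.

Lemma slope_continuous_at u x a : (slope u x <= a%:E)%E ->
  forall e, 0 < e -> exists2 r, 0 < r & forall y, mdist x y < r -> `|u y - u x| < e.
Proof.
move=> ua e e0; have a0 : 0 <= a by rewrite -lee_fin (le_trans (slope_ge0 u x)).
have [r r0 rx] := (slope_leP u x a0).1 ua _ ltr01.
have a10 : 0 < a + 1 by rewrite ltr_wpDl.
exists (Num.min r (e / (a + 1))); first by rewrite lt_min r0/= divr_gt0.
move=> y; rewrite lt_min => /andP[/rx xy]; rewrite ltr_pdivlMr// mulrC.
exact: le_lt_trans xy.
Qed.

(** The one-sided chain rule: nearby values of the inner function are seen only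
through the growth of the outer one at the value taken. *)
Lemma slope_comp_le (phi : R -> R) u x k c : 0 <= k -> 0 <= c ->
  (slope u x <= k%:E)%E ->
  (forall e, 0 < e -> exists2 r, 0 < r & forall b, `|b - u x| < r ->
     `|phi b - phi (u x)| <= (c + e) * `|b - u x|) ->
  (slope (phi \o u) x <= (c * k)%:E)%E.
Proof.
move=> k0 c0 uk Hphi; apply/slope_leP; first exact: mulr_ge0.
move=> e e0.
pose e1 := Num.min 1 (e / (c + k + 1)).
have D0 : 0 < c + k + 1 by rewrite ltr_wpDl// addr_ge0.
have e10 : 0 < e1 by rewrite /e1 lt_min ltr01 divr_gt0.
have [r1 r10 H1] := Hphi _ e10.
have [r2 r20 H2] := slope_continuous_at uk r10.
have [r3 r30 H3] := (slope_leP u x k0).1 uk _ e10.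
exists (Num.min r2 r3); first by rewrite lt_min r20.
move=> y; rewrite lt_min => /andP[/H2 /H1 h1 /H3 h3].
apply: (le_trans h1); apply: (@le_trans _ _ ((c + e1) * ((k + e1) * mdist x y))).
  by rewrite ler_wpM2l// addr_ge0// ltW.
rewrite mulrA ler_wpM2r ?mdist_ge0//.
have : e1 * (c + k + 1) <= e by rewrite -ler_pdivlMr// /e1 ge_min lexx orbT.
have : e1 <= 1 by rewrite /e1 ge_min lexx.
nra.
Qed.

Lemma is_derive_growth (phi : R -> R) a D : is_derive a 1 phi D ->
  forall e, 0 < e -> exists2 r, 0 < r & forall b, `|b - a| < r ->
     `|phi b - phi a| <= (`|D| + e) * `|b - a|.
Proof.
move=> [dphi <-] e e0.
have := dphi; rewrite /derivable => /cvg_ex[l Hl].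
have lE : l = 'D_1 phi a by apply/esym/cvg_lim.
move/cvgrPdist_le: Hl => /(_ _ e0) /nbhs_ballP[r /= r0 rH].
exists r => // b ba; have [->|bNa] := eqVneq b a.
  by rewrite !subrr normr0 mulr0.
have ba0 : b - a != 0 by rewrite subr_eq0.
have := rH (b - a); rewrite /= /ball /= sub0r normrN => /(_ ba ba0).
rewrite /GRing.scale /= mulr1 subrK lE => h.
rewrite -ler_pdivrMr ?normr_gt0// -normrV ?unitfE// -normrM mulrC.
rewrite -[X in `|X|](subrK ('D_1 phi a)) (le_trans (ler_normD _ _))//.
by rewrite addrC lerD2l distrC.
Qed.

Lemma slope_comp_derive (phi : R -> R) u x k D : 0 <= k ->
  (slope u x <= k%:E)%E -> is_derive (u x) 1 phi D ->
  (slope (phi \o u) x <= (`|D| * k)%:E)%E.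
Proof.
by move=> k0 uk dphi; apply: slope_comp_le => //; exact: is_derive_growth.
Qed.

Lemma slope_contraction (phi : R -> R) u x k : 0 <= k ->
  (forall a b, `|phi a - phi b| <= `|a - b|) ->
  (slope u x <= k%:E)%E -> (slope (phi \o u) x <= k%:E)%E.
Proof.
move=> k0 Hphi uk; rewrite -[k]mul1r; apply: slope_comp_le => // e e0.
exists 1 => // b _; apply: (le_trans (Hphi _ _)).
by rewrite ler_peMl ?normr_ge0// lerDl ltW.
Qed.

Lemma slope_add_le u v x a b : 0 <= a -> 0 <= b ->
  (slope u x <= a%:E)%E -> (slope v x <= b%:E)%E ->
  (slope (fun y => u y + v y)%R x <= (a + b)%:E)%E.
Proof.
move=> a0 b0 ua vb; apply/slope_leP; first exact: addr_ge0.
move=> e e0; have e20 : 0 < e / 2 by rewrite divr_gt0.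
have [r1 r10 H1] := (slope_leP u x a0).1 ua _ e20.
have [r2 r20 H2] := (slope_leP v x b0).1 vb _ e20.
exists (Num.min r1 r2); first by rewrite lt_min r10.
move=> y; rewrite lt_min => /andP[/H1 h1 /H2 h2].
have -> : u y + v y - (u x + v x) = (u y - u x) + (v y - v x) by ring.
by apply: (le_trans (ler_normD _ _)); lra.
Qed.

Lemma lipschitz_slope u (L : R) : 0 <= L ->
  (forall x y, `|u x - u y| <= L * mdist x y) ->
  forall x, (slope u x <= L%:E)%E.
Proof.
move=> L0 H x; apply/slope_leP => // e e0; exists 1 => // y _.
rewrite distrC (le_trans (H _ _))// ler_wpM2r ?mdist_ge0//.
by rewrite lerDl ltW.
Qed.

Lemma slope_bounded_continuous u :
  (forall x, exists a, (slope u x <= a%:E)%E) -> continuous u.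
Proof.
move=> H x; have [a ua] := H x; apply/cvgrPdist_lt => e e0.
have [r r0 rx] := slope_continuous_at ua e0.
apply/nbhs_ballP; exists r => //= y; rewrite ballEmdist /= => /rx.
by rewrite distrC.
Qed.

(** The slope is the decreasing limit of these difference quotients; they are
lower semicontinuous, which is where its measurability comes from. *)
Definition quotient_sup u r x : \bar R := ereal_sup (0%E |`
  [set (`|u y - u x| / mdist x y)%:E | y in [set y | 0 < mdist x y < r]]).

Lemma quotient_sup_ge0 u r x : (0 <= quotient_sup u r x)%E.
Proof. by apply: ereal_sup_ubound; left. Qed.

Lemma quotient_supP u r x y : mdist x y < r ->
  ((`|u y - u x|)%:E <= quotient_sup u r x * (mdist x y)%:E)%E.
Proof.
move=> xy; have [d0|] := ltP 0 (mdist x y); last first.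
  rewrite le_eqVlt ltNge mdist_ge0 orbF => /eqP /mdist_positivity ->.
  by rewrite subrr normr0 mule_ge0 ?quotient_sup_ge0// lee_fin mdist_ge0.
rewrite -[X in (X%:E <= _)%E](divfK (lt0r_neq0 d0)) EFinM.
apply: lee_wpmul2r; first by rewrite lee_fin mdist_ge0.
by apply: ereal_sup_ubound; right; exists y => //=; rewrite d0.
Qed.

Lemma quotient_sup_le u r x a : 0 <= a ->
  (forall y, mdist x y < r -> `|u y - u x| <= a * mdist x y) ->
  (quotient_sup u r x <= a%:E)%E.
Proof.
move=> a0 H; apply: ge_ereal_sup => _ [->|[y /= /andP[d0 dr] <-]].
  by rewrite lee_fin.
by rewrite lee_fin ler_pdivrMr// H.
Qed.

Lemma quotient_sup_nondecreasing u x r1 r2 : r1 <= r2 ->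
  (quotient_sup u r1 x <= quotient_sup u r2 x)%E.
Proof.
move=> r12; apply: ereal_sup_le => z [->|[y /= /andP[d0 dr] <-]]; first by left.
by right; exists y => //=; rewrite d0 (lt_le_trans dr).
Qed.

Lemma slope_le_quotient_sup u x r : 0 < r -> (slope u x <= quotient_sup u r x)%E.
Proof.
move=> r0; move: (quotient_supP u (r := r) (x := x)) (quotient_sup_ge0 u r x).
case: (quotient_sup u r x) => [s|_ _|//]; last by rewrite leey.
move=> H; rewrite lee_fin => s0; apply/slope_leP => // e e0; exists r => // y.
move=> /H; rewrite lee_fin => /le_trans; apply.
by rewrite ler_wpM2r ?mdist_ge0// lerDl ltW.
Qed.

Lemma slopeE u x :
  slope u x = ereal_inf (range (fun n => quotient_sup u n.+1%:R^-1 x)).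
Proof.
apply/eqP; rewrite eq_le; apply/andP; split.
  by apply: le_ereal_inf_tmp => _ [n _ <-]; apply: slope_le_quotient_sup.
have [->|] := eqVneq (slope u x) +oo%E; first by rewrite leey.
rewrite -ltey => ufin; have sE : slope u x = (fine (slope u x))%:E.
  by rewrite fineK// ge0_fin_numE ?slope_ge0.
have s0 : 0 <= fine (slope u x) by apply: fine_ge0; exact: slope_ge0.
apply/lee_addgt0Pr => e e0; rewrite sE.
have [r r0 H] : exists2 r, 0 < r & forall y, mdist x y < r ->
    `|u y - u x| <= (fine (slope u x) + e) * mdist x y.
  by apply: (slope_leP u x s0).1 => //; rewrite -sE.
have [n nr] : exists n, n.+1%:R^-1 < r.
  have [n _ /(_ n (leqnn n)) nr] := near_infty_natSinv_lt (PosNum r0).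
  by exists n.
apply: (@le_trans _ _ (quotient_sup u n.+1%:R^-1 x)).
  by apply: ereal_inf_lbound; exists n.
apply: quotient_sup_le => [|y yn]; first exact: addr_ge0 s0 (ltW e0).
by apply: H; exact: lt_trans nr.
Qed.

Lemma cvg_quotient_sup u x :
  quotient_sup u n.+1%:R^-1 x @[n --> \oo] --> slope u x.
Proof.
rewrite slopeE; apply: ereal_nonincreasing_cvgn => m n mn.
by apply: quotient_sup_nondecreasing; rewrite lef_pV2 ?posrE// ler_nat.
Qed.

End slope_calculus.

(** * Measurability on a metric measure space *)

Section metric_measurability.
Context {d : measure_display} {R : realType}
  {X : completeMetricMeasurableType d R}.
Implicit Types (u : X -> R) (x y : X).

Lemma mdist_lipschitz y x x' : `|mdist x y - mdist x' y| <= mdist x x'.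
Proof.
have := metric_triangle x' x y; have := metric_triangle x x' y.
by rewrite (metric_sym x' x) => h1 h2; rewrite ler_norml; apply/andP; split; lra.
Qed.

Lemma slope_mdist_le y x : (slope (fun z => mdist z y) x <= 1%:E)%E.
Proof.
by apply: lipschitz_slope => // a b; rewrite mul1r; exact: mdist_lipschitz.
Qed.

Lemma mdist_continuous y : continuous (fun z : X => mdist z y).
Proof.
by apply: slope_bounded_continuous => x; exists 1; exact: slope_mdist_le.
Qed.

Context (borelX : @measurable d X = <<s [set U : set X | open U] >>).
Context (separableX : exists2 S : set X, countable S & dense S).

Lemma open_set_measurable (U : set X) : open U -> measurable U.
Proof. by rewrite borelX => oU; exact: sub_sigma_algebra. Qed.

Lemma open_gt0_preimage u : continuous u -> open [set x | 0 < u x].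
Proof.
move=> cu; have -> : [set x | 0 < u x] = u @^-1` [set t | 0 < t] by [].
by apply: open_comp => [x _|]; [exact: cu|exact: open_gt].
Qed.

Lemma continuous_measurable u : continuous u -> measurable_fun setT u.
Proof.
move=> cu; apply: (measurability _ (RGenOpens.measurableE R)).
move=> _ [_ [a [b ->] <-]]; rewrite setTI; apply: open_set_measurable.
by apply: open_comp => [x _|]; [exact: cu|exact: interval_open].
Qed.

(** A strict lower bound on the supremum is witnessed by a single point, which
keeps witnessing it in a neighbourhood: superlevel sets are open. *)
Lemma quotient_sup_measurable u r : continuous u ->
  measurable_fun [set: X] (fun x => quotient_sup u r x : \bar R).
Proof.
move=> cu; apply: (measurability _ (ErealGenOInfty.measurableE R)).
move=> /= _ [_ [a ->]] <-; rewrite setTI preimage_itvoy.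
apply: open_set_measurable; have [a0|a0] := ltP a 0.
  have -> : [set x | (a%:E < quotient_sup u r x)%E] = setT; last exact: openT.
  apply/seteqP; split => // x _ /=.
  by rewrite (lt_le_trans _ (quotient_sup_ge0 _ _ _))// lte_fin.
have -> : [set x | (a%:E < quotient_sup u r x)%E] = \bigcup_y
   ([set x | 0 < mdist x y] `&` [set x | 0 < r - mdist x y] `&`
    [set x | 0 < `|u y - u x| - a * mdist x y]).
  apply/seteqP; split => [x /=|x [y _ [[/= d0 dr] h]]].
    move=> /ereal_sup_gt[_ [->|[y /= /andP[d0 dr] <-]]].
      by rewrite lte_fin ltNge a0.
    rewrite lte_fin ltr_pdivlMr// => h; exists y => //=.
    by rewrite d0 !subr_gt0 dr h.
  apply: lt_le_trans (ereal_sup_ubound _); last first.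
    by right; exists y; [rewrite /= d0 -subr_gt0|reflexivity].
  by rewrite lte_fin ltr_pdivlMr// -subr_gt0.
apply: bigcup_open => y _; apply: openI; [apply: openI|].
- by apply: open_gt0_preimage; exact: mdist_continuous.
- apply: open_gt0_preimage => x; apply: cvgB; first exact: cvg_cst.
  exact: mdist_continuous.
- apply: open_gt0_preimage => x; apply: cvgB.
    by apply: cvg_norm; apply: cvgB; [exact: cvg_cst|exact: cu].
  by apply: cvgM; [exact: cvg_cst|exact: mdist_continuous].
Qed.

Lemma slope_measurable u : continuous u -> measurable_fun [set: X] (fun x => slope u x : \bar R).
Proof.
move=> cu; apply: (emeasurable_fun_cvg
  (fun n : nat => quotient_sup u n.+1%:R^-1)).
  by move=> n; exact: quotient_sup_measurable.
by move=> x _; exact: cvg_quotient_sup.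
Qed.

(** Separability is what makes the distance measurable for the product
sigma-algebra, which may be smaller than the Borel one in general. *)
Lemma mdist_measurable :
  measurable_fun [set: X * X] (fun z : X * X => mdist z.1 z.2).
Proof.
have [S cS dS] := separableX.
have [[x0]|/forallNP nX] := pselect (exists x : X, True); last first.
  apply: (measurability _ (RGenInftyO.measurableE R)) => _ [_ [a ->] <-].
  suff -> : [set: X * X] `&` (fun z : X * X => mdist z.1 z.2) @^-1` `]-oo, a[
    = set0 by [].
  by apply/seteqP; split => // -[x y]; have := nX x.
have dense_close x e : 0 < e -> exists2 s, S s & mdist x s < e.
  move=> e0; have [] := dS (ball x e).
  - by exists x; exact: ballxx.
  - rewrite ballEmdist (_ : [set y | _] = [set y | 0 < e - mdist y x]).
      apply: open_gt0_preimage => y; apply: cvgB; first exact: cvg_cst.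
      exact: mdist_continuous.
    by apply/seteqP; split => y /=; rewrite subr_gt0 metric_sym.
  - by move=> s; rewrite ballEmdist => -[/= xs Ss]; exists s.
have [s0 Ss0 _] := dense_close x0 1 ltr01.
have /pfcard_geP[S0|[h]] := cS.
  by move: Ss0; rewrite S0.
have hsurj s : S s -> exists n, h n = s.
  by move=> /(@surj _ _ setT S h)[n _ <-]; exists n.
pose g n (z : X * X) := (mdist z.1 (h n) + mdist (h n) z.2)%:E.
have -> : (fun z : X * X => mdist z.1 z.2) =
    (fun z : X * X => fine (einfs (g^~ z) 0%N)).
  apply/funext => -[x y] /=.
  suff -> : einfs (g^~ (x, y)) 0%N = (mdist x y)%:E by [].
  apply/eqP; rewrite eq_le; apply/andP; split.
    apply/lee_addgt0Pr => e e0.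
    have e20 : 0 < e / 2 by rewrite divr_gt0.
    have [s Ss xs] := dense_close x _ e20.
    have [n hn] := hsurj s Ss.
    apply: (@le_trans _ _ (g n (x, y))); first by apply: ereal_inf_lbound; exists n.
    rewrite /g /= -EFinD lee_fin hn.
    have := metric_triangle x s y; have := metric_triangle s x y.
    rewrite (metric_sym s x); lra.
  apply: le_ereal_inf_tmp => _ [n _ <-]; rewrite /g lee_fin /=.
  exact: metric_triangle.
suff me : measurable_fun [set: X * X] (fun z : X * X => einfs (g^~ z) 0%N).
  have := @fine_measurable R setT measurableT.
  move=> /measurableT_comp /(_ me).
  exact.
apply: measurable_fun_einfs => n; apply/measurable_EFinP.
have mh : measurable_fun setT (fun z : X => mdist z (h n)).
  by apply: continuous_measurable; exact: mdist_continuous.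
apply: measurable_funD.
  exact: (measurableT_comp mh measurable_fst).
under eq_fun do rewrite metric_sym.
exact: (measurableT_comp mh measurable_snd).
Qed.

End metric_measurability.

(** * Lower limits and integrals of nonnegative real functions *)

Section lower_limits.
Context {R : realType}.
Local Open Scope ereal_scope.
Implicit Types (f g : (\bar R)^nat) (c : \bar R).

Lemma limn_einfE f : limn_einf f = ereal_sup (range (einfs f)).
Proof. by rewrite limn_einf_lim; apply/cvg_lim => //; exact: cvg_einfs_sup. Qed.

Lemma limn_einf_ge f c : (forall n, c <= f n) -> c <= limn_einf f.
Proof.
move=> cf; rewrite limn_einfE; apply: le_trans (ereal_sup_ubound _); last first.
  by exists 0%N.
by apply: le_ereal_inf_tmp => _ [n _ <-].
Qed.

Lemma limn_einf_le f c : (forall n, f n <= c) -> limn_einf f <= c.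
Proof.
move=> fc; rewrite limn_einfE; apply: ge_ereal_sup => _ [n _ <-].
by apply: le_trans (fc n); apply: ereal_inf_lbound; exists n => /=.
Qed.

Lemma le_limn_einf f g : (forall n, f n <= g n) -> limn_einf f <= limn_einf g.
Proof.
move=> fg; rewrite !limn_einfE; apply: ge_ereal_sup => _ [n _ <-].
apply: (@le_trans _ _ (einfs g n)); last by apply: ereal_sup_ubound; exists n.
apply: le_ereal_inf_tmp => _ [k /= nk <-].
by apply: le_trans (fg k); apply: ereal_inf_lbound; exists k.
Qed.

Lemma limn_einf_lt f c : limn_einf f < c ->
  forall N, exists2 n, (N <= n)%N & f n < c.
Proof.
move=> fc N; have : einfs f N < c.
  apply: le_lt_trans fc; rewrite limn_einfE.
  by apply: ereal_sup_ubound; exists N.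
by move=> /ereal_inf_lt[_ [n /= Nn <-] h]; exists n.
Qed.

End lower_limits.

Section real_integrals.
Context {d : measure_display} {T : measurableType d} {R : realType}
  (m : {measure set T -> \bar R}).
Local Open Scope ereal_scope.
Implicit Types f g : T -> R.

Lemma integralD_ge0 f g : (forall x, 0 <= f x)%R -> (forall x, 0 <= g x)%R ->
  measurable_fun setT f -> measurable_fun setT g ->
  \int[m]_x (f x + g x)%:E = \int[m]_x (f x)%:E + \int[m]_x (g x)%:E.
Proof.
move=> f0 g0 mf mg; under eq_integral do rewrite EFinD.
by apply: ge0_integralD => //;
  [move=> x _; rewrite lee_fin|apply/measurable_EFinP|
   move=> x _; rewrite lee_fin|apply/measurable_EFinP].
Qed.

Lemma integralZ_ge0 (k : R) f : (0 <= k)%R -> (forall x, 0 <= f x)%R ->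
  measurable_fun setT f ->
  \int[m]_x (k * f x)%:E = k%:E * \int[m]_x (f x)%:E.
Proof.
move=> k0 f0 mf; under eq_integral do rewrite EFinM.
by apply: ge0_integralZl_EFin => //; [move=> x _; rewrite lee_fin|
  apply/measurable_EFinP].
Qed.

Lemma integral_le_ge0 f g : (forall x, 0 <= f x)%R -> (forall x, f x <= g x)%R ->
  measurable_fun setT f -> measurable_fun setT g ->
  \int[m]_x (f x)%:E <= \int[m]_x (g x)%:E.
Proof.
move=> f0 fg mf mg; apply: ge0_le_integral => //.
- by move=> x _; rewrite lee_fin.
- exact/measurable_EFinP.
- exact/measurable_EFinP.
- by move=> x _; rewrite lee_fin.
Qed.

Lemma integral_le_ge0_ae f g : (forall x, 0 <= f x)%R -> (forall x, 0 <= g x)%R ->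
  (\forall x \ae m, (f x <= g x)%R) ->
  measurable_fun setT f -> measurable_fun setT g ->
  \int[m]_x (f x)%:E <= \int[m]_x (g x)%:E.
Proof.
move=> f0 g0 fg mf mg; apply: ae_ge0_le_integral => //.
- by move=> x _; rewrite lee_fin.
- exact/measurable_EFinP.
- by move=> x _; rewrite lee_fin.
- exact/measurable_EFinP.
- by apply: filterS fg => x; rewrite lee_fin.
Qed.

Lemma integral_real_ge0 f : (forall x, 0 <= f x)%R -> 0 <= \int[m]_x (f x)%:E.
Proof. by move=> f0; apply: integral_ge0 => x _; rewrite lee_fin. Qed.

Lemma integral_eq_fine f (a : \bar R) : (forall x, 0 <= f x)%R ->
  \int[m]_x (f x)%:E <= a -> a < +oo ->
  \int[m]_x (f x)%:E = (fine (\int[m]_x (f x)%:E))%:E.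
Proof.
move=> f0 fa a1; rewrite fineK// ge0_fin_numE ?integral_real_ge0//.
exact: le_lt_trans a1.
Qed.

End real_integrals.

(** * The coarea form of Cheeger's inequality *)

Section cheeger_L1.
Context {d : measure_display} {R : realType}
  {X : completeMetricMeasurableType d R}
  (m : {sigma_finite_measure set X -> \bar R})
  (mmX : is_metric_measure_space m).
Local Open Scope ereal_scope.
Implicit Types u : X -> R.

Let borelX := mms_borel mmX.

Lemma bounded_measure_lty (A : set X) : measurable A -> metric_bounded A ->
  m A < +oo.
Proof.
move=> mA [x [r Ar]]; have [x0 [M [c [_ _ H]]]] := mms_growth mmX.
pose s := (`|r| + mdist x0 x)%R.
have s0 : (0 <= s)%R by rewrite addr_ge0 ?mdist_ge0.
have As : A `<=` ball x0 s.
  move=> y /Ar; rewrite !ballEmdist /= => xy.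
  rewrite (le_lt_trans (metric_triangle _ x _))// addrC ltrD2r.
  exact: lt_le_trans (ler_norm _).
have mb : measurable (ball x0 s).
  apply: (open_set_measurable borelX).
  rewrite ballEmdist (_ : [set y | _] = [set y | (0 < s - mdist y x0)%R]).
    apply: open_gt0_preimage => y; apply: cvgB; first exact: cvg_cst.
    exact: mdist_continuous.
  by apply/seteqP; split => y /=; rewrite subr_gt0 metric_sym.
apply: (@le_lt_trans _ _ (m (ball x0 s))); first by apply: le_measure; rewrite ?inE.
exact: le_lt_trans (H _ s0) (ltry _).
Qed.

Lemma lipschitz_inP u : lipschitz_in setT u -> exists2 L : R, (0 <= L)%R &
  forall x y, (`|u x - u y| <= L * mdist x y)%R.
Proof.
move=> [L H]; exists (Num.max 0 L)%R; first by rewrite le_max lexx.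
move=> x y; apply: (le_trans (H x y I I)).
by rewrite ler_wpM2r ?mdist_ge0// le_max lexx orbT.
Qed.

Lemma lipschitz_slope_fine u x : lipschitz_in setT u ->
  slope u x = (fine (slope u x))%:E.
Proof.
by move=> /lipschitz_inP[L L0 H]; exact: slope_real (lipschitz_slope L0 H x).
Qed.

Lemma lipschitz_in_continuous u : lipschitz_in setT u -> continuous u.
Proof.
move=> /lipschitz_inP[L L0 H]; apply: slope_bounded_continuous => x; exists L.
exact: lipschitz_slope.
Qed.

Lemma lipschitz_in_measurable u : lipschitz_in setT u -> measurable_fun setT u.
Proof. by move=> /lipschitz_in_continuous; exact: (continuous_measurable borelX). Qed.

Lemma fine_slope_ge0 u x : (0 <= fine (slope u x))%R.
Proof. by apply: fine_ge0; exact: slope_ge0. Qed.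

Lemma fine_slope_measurable u : lipschitz_in setT u ->
  measurable_fun [set: X] (fun x => fine (slope u x)).
Proof.
move=> /lipschitz_in_continuous /(slope_measurable borelX).
exact: measurableT_comp (fine_measurable measurableT).
Qed.

Lemma superlevel_measurable u (t : R) : continuous u ->
  measurable [set x | (t < u x)%R].
Proof.
move=> cu; apply: (open_set_measurable borelX).
rewrite (_ : [set x | _] = [set x | (0 < u x - t)%R]).
  by apply: open_gt0_preimage => x; apply: cvgB; [exact: cu|exact: cvg_cst].
by apply/seteqP; split => x /=; rewrite subr_gt0.
Qed.

End cheeger_L1.

Lemma eq_indic {T U : Type} {R : realType} (A : set T) (B : set U) x y :
  (A x <-> B y) -> \1_A x = \1_B y :> R.
Proof.
move=> AB; rewrite !indicE; suff -> : (x \in A) = (y \in B) by [].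
by apply/idP/idP => /set_mem h; apply/mem_set/AB.
Qed.

Section ramp.
Context {R : realType}.

Lemma maxr_contraction (c a b : R) :
  `|Num.max c a - Num.max c b| <= `|a - b|.
Proof.
have h1 := ler_norm (a - b); have h2 := ler_norm (b - a); rewrite distrC in h2.
case: (leP c a) => ca; case: (leP c b) => cb; rewrite ?subrr ?normr0//.
- by rewrite ger0_norm ?subr_ge0//; apply: le_trans h1; rewrite lerD2l lerN2 ltW.
- rewrite distrC ger0_norm ?subr_ge0//; apply: le_trans h2.
  by rewrite lerD2l lerN2 ltW.
Qed.

Lemma minr_contraction (c a b : R) :
  `|Num.min c a - Num.min c b| <= `|a - b|.
Proof.
have minE x : Num.min c x = - Num.max (- c) (- x) by rewrite oppr_max !opprK.
rewrite !minE -opprD normrN (le_trans (maxr_contraction _ _ _))//.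
by rewrite -opprD normrN.
Qed.

Implicit Types (t k s a b : R).

Definition ramp t k s : R := Num.min 1 (Num.max 0 (k * (s - t))).

Lemma ramp_ge0 t k s : 0 <= ramp t k s.
Proof. by rewrite /ramp le_min ler01 le_max lexx. Qed.

Lemma ramp_le1 t k s : ramp t k s <= 1.
Proof. by rewrite /ramp ge_min lexx. Qed.

Lemma ramp_eq0 t k s : 0 <= k -> s <= t -> ramp t k s = 0.
Proof.
move=> k0 st; rewrite /ramp max_l; first by rewrite min_r.
by rewrite mulr_ge0_le0// subr_le0.
Qed.

Lemma ramp_eq1 t k s : 0 < k -> t + k^-1 <= s -> ramp t k s = 1.
Proof.
move=> k0 st; rewrite /ramp min_l// le_max; apply/orP; right.
by rewrite -(mulfV (lt0r_neq0 k0)) ler_pM2l// lerBrDl.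
Qed.

Lemma ramp_lipschitz t k a b : 0 <= k ->
  `|ramp t k a - ramp t k b| <= k * `|a - b|.
Proof.
move=> k0; rewrite /ramp.
have -> : k * `|a - b| = `|k * (a - t) - k * (b - t)|.
  by rewrite -mulrBr normrM ger0_norm//; congr (_ * `|_|); ring.
exact: le_trans (minr_contraction _ _ _) (maxr_contraction _ _ _).
Qed.

End ramp.

Section coarea.
Context {d : measure_display} {R : realType}
  {X : completeMetricMeasurableType d R}
  (m : {sigma_finite_measure set X -> \bar R})
  (mmX : is_metric_measure_space m).
Implicit Types u : X -> R.

Let borelX := mms_borel mmX.

(** Off the closed level window the ramp is locally constant along the
function, so only the window contributes. *)
Lemma slope_ramp_le u t k x : 0 < k -> lipschitz_in setT u ->
  (slope (ramp t k \o u) x <=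
   (k * \1_[set x | (t <= u x <= t + k^-1)%R] x * fine (slope u x))%:E)%E.
Proof.
move=> k0 lu; have us := lipschitz_slope_fine x lu.
have us' : (slope u x <= (fine (slope u x))%:E)%E by rewrite {1}us.
have zero r : 0 < r -> (forall b, `|b - u x| < r -> ramp t k b = ramp t k (u x)) ->
    (slope (ramp t k \o u) x <= (0 * fine (slope u x))%:E)%E.
  move=> r0 H; apply: slope_comp_le => //; first exact: fine_slope_ge0.
  move=> e e0; exists r => // b /H ->; rewrite subrr normr0.
  by rewrite mulr_ge0// addr_ge0// ltW.
rewrite indicE; case: (boolP (x \in _)) => xA.
  rewrite mulr1; apply: slope_comp_le => //; [exact: fine_slope_ge0|exact: ltW|].
  move=> e e0; exists 1 => // b _.
  apply: (le_trans (ramp_lipschitz _ _ _ (ltW k0))).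
  by rewrite ler_wpM2r// lerDl ltW.
rewrite mulr0; have [ut|tu] := ltP (u x) t.
  apply: (zero (t - u x)); first by rewrite subr_gt0.
  move=> b; rewrite ltr_distl => /andP[_ bt].
  have bt' : b <= t by lra.
  by rewrite (ramp_eq0 (ltW k0) bt') (ramp_eq0 (ltW k0) (ltW ut)).
have ut : t + k^-1 < u x.
  by rewrite ltNge; apply: contraNN xA => h; rewrite inE /= tu.
apply: (zero (u x - (t + k^-1))); first by rewrite subr_gt0.
move=> b; rewrite ltr_distl => /andP[bt _].
have bt' : t + k^-1 <= b by lra.
by rewrite (ramp_eq1 k0 bt') (ramp_eq1 k0 (ltW ut)).
Qed.

Lemma Lip_bs_support_bounded u : Lip_bs u -> metric_bounded [set x | u x != 0].
Proof.
move=> [_ [x [r H]]]; exists x, r; apply: subset_trans H.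
exact: subset_closure.
Qed.

Local Open Scope ereal_scope.

(** Ramps of increasing steepness are competitors for the perimeter: they differ
from the indicator on level windows that shrink to the empty set inside a
bounded set, hence one of finite measure. *)
Lemma perimeter_superlevel_le u (t : R) : Lip_bs u -> (0 < t)%R ->
  perimeter m [set x | (t < u x)%R] <= limn_einf (fun n => \int[m]_x
    (n.+1%:R * \1_[set x | (t <= u x <= t + n.+1%:R^-1)%R] x *
     fine (slope u x))%:E).
Proof.
move=> ubs t0; have lu := ubs.1.
have [L L0 uL] := lipschitz_inP lu.
have cu := lipschitz_in_continuous lu.
have mu := lipschitz_in_measurable mmX lu.
pose v n x := ramp t n.+1%:R (u x).
have lv n : lipschitz_in setT (v n).
  exists (n.+1%:R * L)%R => x y _ _; apply: (le_trans (ramp_lipschitz _ _ _ _)) => //.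
  by rewrite -mulrA ler_wpM2l.
apply: (@le_trans _ _ (limn_einf (fun n => \int[m]_x slope (v n) x))); last first.
  apply: le_limn_einf => n; apply: ge0_le_integral => //.
  - by move=> x _; exact: slope_ge0.
  - exact: (slope_measurable borelX (lipschitz_in_continuous (lv n))).
  - apply/measurable_EFinP; apply: measurable_funM; last exact: (fine_slope_measurable mmX).
    apply: measurable_funM => //; apply: measurable_indic.
    rewrite (_ : [set x | _] = u @^-1` `[t, (t + n.+1%:R^-1)%R]).
      by rewrite -[X in measurable X]setTI; apply: mu => //; exact: measurable_itv.
    by apply/seteqP; split => x; rewrite /= in_itv.
  - by move=> x _; apply: slope_ramp_le.
apply: ereal_inf_lbound; exists v; split => //.
  by move=> n A _; have [K HK] := lv n; exists K => x y _ _; exact: HK.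
pose D n := [set x | (t < u x)%R] `&` [set x | (u x < t + n.+1%:R^-1)%R].
have mlt c : measurable [set x | (u x < c)%R].
  rewrite (_ : [set x | _] = u @^-1` `]-oo, c[); last first.
    by apply/seteqP; split => x; rewrite /= in_itv.
  by rewrite -[X in measurable X]setTI; apply: mu => //; exact: measurable_itv.
have mgt : measurable [set x | (t < u x)%R] by exact: (superlevel_measurable mmX).
have mD n : measurable (D n) by exact: measurableI.
have D0 : \bigcap_n D n = set0.
  apply/seteqP; split => // x Dx; have [/= tu _] := Dx 0%N I.
  have ut0 : (0 < u x - t)%R by rewrite subr_gt0.
  have [n _ /(_ n (leqnn n)) h] := near_infty_natSinv_lt (PosNum ut0).
  by have [_ /=] := Dx n I; rewrite -ltrBlDl ltNge (ltW h).
have supp : metric_bounded (D 0%N).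
  have [x [r H]] := Lip_bs_support_bounded ubs; exists x, r => y [/= ty _].
  by apply: H => /=; rewrite gt_eqF// (lt_trans t0).
have cD : m (D n) @[n --> \oo] --> 0.
  rewrite -(measure0 m) -D0; apply: nonincreasing_cvg_mu => //.
  - exact: (bounded_measure_lty mmX).
  - by rewrite D0; exact: measurable0.
  - move=> i j ij; apply/subsetPset => x [/= h1 h2]; split => //=.
    by apply: lt_le_trans h2 _; rewrite lerD2l lef_pV2 ?posrE// ler_nat.
apply: squeeze_cvge (cvg_cst _) cD; apply: nearW => n; rewrite Lnorm_ge0 Lnorm1 /=.
rewrite -(setIT (D n)) -integral_indic//; apply: ge0_le_integral => //.
- apply/measurable_EFinP; apply: measurableT_comp => //; apply: measurable_funB.
    exact: (lipschitz_in_measurable mmX).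
  exact: measurable_indic.
- by apply/measurable_EFinP; exact: measurable_indic.
- move=> x _; rewrite lee_fin !indicE.
  have [ut|tu] := leP (u x) t.
    rewrite /v ramp_eq0// [X in (_ - X)%R](_ : _ = 0%R) ?subr0 ?normr0//.
    by rewrite memNset//=; apply/negP; rewrite -leNgt.
  rewrite [X in (_ - X)%R](_ : _ = 1%R); last by rewrite mem_set.
  have [ut|tu'] := ltP (u x) (t + n.+1%:R^-1)%R.
    rewrite mem_set//= ler_norml /v; have := ramp_ge0 t n.+1%:R (u x).
    by have := ramp_le1 t n.+1%:R (u x) => h1 h2; apply/andP; split; lra.
  by rewrite /v ramp_eq1// subrr normr0.
Qed.

(** Integrating the perimeter bound over all levels: Fatou on the left,
Tonelli on the right, where the level window at a point has length at most the
reciprocal of its slope factor. *)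
Lemma cheeger_Lip_bs u (k : R) : (0 <= k)%R -> k%:E <= cheeger_constant m ->
  Lip_bs u -> (forall x, 0 <= u x)%R ->
  k%:E * \int[m]_x (u x)%:E <= \int[m]_x (fine (slope u x))%:E.
Proof.
move=> k0 kh ubs u0; have lu := ubs.1.
have cu := lipschitz_in_continuous lu.
have mu := lipschitz_in_measurable mmX lu.
have msl := fine_slope_measurable mmX lu.
(* the integrand of the perimeter bound, jointly in the point and the level *)
pose G n (z : X * R) : R := (n.+1%:R * \1_[set z : X * R | 0 < z.2 /\
  z.2 <= u z.1 <= z.2 + n.+1%:R^-1] z * fine (slope u z.1))%R.
have G0 n z : (0 <= G n z)%R by rewrite !mulr_ge0 ?fine_slope_ge0.
have mu1 : measurable_fun [set: X * measurableTypeR R] (fun z : X * measurableTypeR R => u z.1).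
  exact: measurableT_comp mu measurable_fst.
have m2 : measurable_fun [set: X * measurableTypeR R] (fun z : X * measurableTypeR R => z.2 : R).
  exact: measurable_snd.
have mgt0 (a b : X * measurableTypeR R -> R) : measurable_fun setT a -> measurable_fun setT b ->
    measurable [set z | (a z < b z)%R].
  move=> ma mb; have mab := measurable_fun_ltr ma mb.
  have -> : [set z | (a z < b z)%R] = setT `&` (fun z => (a z < b z)%R) @^-1` [set true].
    by rewrite setTI; apply/seteqP; split.
  exact: mab.
have mG n : measurable_fun [set: X * measurableTypeR R] (fun z : X * measurableTypeR R => G n z).
  apply: measurable_funM; last exact: measurableT_comp msl measurable_fst.
  apply: measurable_funM => //; apply: measurable_indic.
  rewrite (_ : [set z | _] = [set z | 0 < z.2]%R `&` ~` [set z | u z.1 < z.2]%R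
     `&` ~` [set z | z.2 + n.+1%:R^-1 < u z.1]%R); last first.
    apply/seteqP; split => z /=.
      by move=> [z0 /andP[h1 h2]]; split; [split => //|]; apply/negP; rewrite -leNgt.
    by move=> [[z0 /negP]]; rewrite -leNgt => h1 /negP; rewrite -leNgt => h2;
      rewrite h1 h2.
  apply: measurableI; [apply: measurableI|]; try apply: measurableC; apply: mgt0 => //.
  exact: measurable_funD.
pose leb : {measure set (measurableTypeR R) -> \bar R} := lebesgue_measure.
have lebE (i : interval R) : leb [set` i] =
    if (i.1 < i.2)%E then ((i.2 : \bar R) - i.1)%E else 0.
  exact: lebesgue_measure_itv.
have fub (F : X * measurableTypeR R -> R) : (forall z, 0 <= F z)%R ->
    measurable_fun setT F ->
    \int[leb]_t \int[m]_x (F (x, t))%:E = \int[m]_x \int[leb]_t (F (x, t))%:E.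
  move=> F0 mF; apply/esym; apply: (fubini_tonelli (m2 := leb) (EFin \o F)).
    exact/measurable_EFinP.
  by move=> z; rewrite lee_fin.
have fubG (F : X * measurableTypeR R -> R) : (forall z, 0 <= F z)%R ->
    measurable_fun setT F ->
    measurable_fun [set: measurableTypeR R] (fun t => \int[m]_x (F (x, t))%:E).
  move=> F0 mF; apply: (@measurable_fun_fubini_tonelli_G _ _ _ _ _ m (EFin \o F)).
    exact/measurable_EFinP.
  by move=> z; rewrite lee_fin.
pose H (z : X * measurableTypeR R) : R := \1_[set z : X * measurableTypeR R | 0 < z.2 < u z.1]%R z.
have mHs : measurable [set z : X * measurableTypeR R | 0 < z.2 < u z.1]%R.
  rewrite (_ : [set z | _] = [set z | 0 < z.2]%R `&` [set z | z.2 < u z.1]%R).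
    by apply: measurableI; exact: mgt0.
  by apply/seteqP; split => z /= => [/andP[]|[-> ->]].
have mH : measurable_fun setT H by exact: measurable_indic.
have H0 z : (0 <= H z)%R by rewrite /H.
have HE t : m [set x | (0 < t < u x)%R] = \int[m]_x (H (x, t))%:E.
  have HE' x : H (x, t) = \1_[set x | (0 < t < u x)%R] x by exact: eq_indic.
  under eq_integral do rewrite HE'.
  rewrite integral_indic ?setIT//.
  have -> : [set x | (0 < t < u x)%R] = ysection
      [set z : X * measurableTypeR R | 0 < z.2 < u z.1]%R t.
    by apply/seteqP; split => x; rewrite /ysection /= ?inE.
  exact: measurable_ysection.
have lhs : k%:E * \int[m]_x (u x)%:E =
    \int[leb]_t (k%:E * m [set x | (0 < t < u x)%R]).
  under [RHS]eq_integral do rewrite HE.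
  rewrite ge0_integralZl_EFin//; last 2 first.
  - by move=> t _; exact: integral_real_ge0.
  - exact: fubG.
  congr (_ * _); rewrite fub//; apply: eq_integral => x _.
  have HE' t : H (x, t) = \1_(`]0%R, u x[%classic : set (measurableTypeR R)) t.
    by apply: eq_indic; rewrite /= in_itv.
  under eq_integral do rewrite HE'.
  rewrite integral_indic ?setIT//.
  rewrite lebE /= lte_fin.
  by case: ltgtP (u0 x) => // [_ _|<- _]; rewrite ?sube0.
have rhs n : \int[leb]_t \int[m]_x (G n (x, t))%:E <= \int[m]_x (fine (slope u x))%:E.
  rewrite fub//.
  apply: ge0_le_integral => //.
  - by move=> x _; exact: integral_real_ge0.
  - apply: (@measurable_fun_fubini_tonelli_F _ _ _ _ _ leb (EFin \o G n)).
      exact/measurable_EFinP.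
    by move=> z; rewrite lee_fin.
  - exact/measurable_EFinP.
  move=> x _; pose c : R := (n.+1%:R * fine (slope u x))%R.
  have c0 : (0 <= c)%R by rewrite mulr_ge0 ?fine_slope_ge0.
  pose A := `[(u x - n.+1%:R^-1)%R, u x]%classic : set (measurableTypeR R).
  have mA : measurable A by exact: measurable_itv.
  apply: (@le_trans _ _ (\int[leb]_t (c * \1_A t)%:E)).
    apply: integral_le_ge0 => //.
    - move=> t; rewrite /G /c mulrAC ler_wpM2l// !indicE ler_nat.
      case: (boolP (_ \in A)) => tA; first by case: (_ \in _).
      rewrite memNset// => -[/= _ /andP[h1 h2]]; move/negP: tA; apply.
      by rewrite inE /A /= in_itv /= h1 andbT lerBlDr.
    - exact: (measurableT_comp (mG n) (measurable_pair1 x)).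
    - by apply: measurable_funM => //; exact: measurable_indic.
  rewrite integralZ_ge0//.
  rewrite integral_indic// setIT /A lebE /= lte_fin.
  rewrite ltrBlDr ltrDl invr_gt0 ltr0n /= -EFinB -EFinM lee_fin /c.
  have -> : (u x - (u x - n.+1%:R^-1) = n.+1%:R^-1)%R by ring.
  by rewrite mulrAC divff ?mul1r// pnatr_eq0.
have level t : k%:E * m [set x | (0 < t < u x)%R] <=
    limn_einf (fun n => \int[m]_x (G n (x, t))%:E).
  have [t0|t0] := leP t 0%R.
    rewrite (_ : [set x | _] = set0) ?measure0 ?mule0; last first.
      by apply/seteqP; split.
    by apply: limn_einf_ge => n; exact: integral_real_ge0.
  rewrite [X in m X](_ : _ = [set x | (t < u x)%R])//=.
  have mE : measurable [set x | (t < u x)%R] by exact: (superlevel_measurable mmX).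
  have fE : m [set x | (t < u x)%R] < +oo.
    apply: (bounded_measure_lty mmX) => //.
    have [x [r h]] := Lip_bs_support_bounded ubs; exists x, r => y /= ty.
    by apply: h => /=; rewrite gt_eqF// (lt_trans t0).
  apply: (@le_trans _ _ (perimeter m [set x | (t < u x)%R])); last first.
    apply: (le_trans (perimeter_superlevel_le ubs t0)).
    apply: le_limn_einf => n; apply: integral_le_ge0.
    - by move=> x; rewrite !mulr_ge0 ?fine_slope_ge0.
    - move=> x; rewrite /G ler_wpM2r ?fine_slope_ge0// ler_wpM2l//.
      rewrite !indicE ler_nat; case: (boolP (x \in _)) => // /set_mem /= h.
      by rewrite mem_set.
    - apply: measurable_funM => //; apply: measurable_funM => //.
      apply: measurable_indic.
      rewrite (_ : [set x | _] = u @^-1` `[t, (t + n.+1%:R^-1)%R]).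
        by rewrite -[X in measurable X]setTI; apply: mu => //; exact: measurable_itv.
      by apply/seteqP; split => x; rewrite /= in_itv.
    - exact: (measurableT_comp (mG n) (measurable_pair2 t)).
  have [E0|E0] := eqVneq (m [set x | (t < u x)%R]) 0.
    rewrite E0 mule0; apply: le_ereal_inf_tmp => _ [v [_ _ ->]].
    by apply: limn_einf_ge => n; apply: integral_ge0 => x _; exact: slope_ge0.
  have E0' : 0 < m [set x | (t < u x)%R] by rewrite lt_neqAle eq_sym E0 measure_ge0.
  have : k%:E <= perimeter m [set x | (t < u x)%R] / m [set x | (t < u x)%R].
    apply: (le_trans kh); apply: ereal_inf_lbound.
    by exists [set x | (t < u x)%R] => //; split => //; rewrite E0' fE.
  move: E0' fE; case: (m _) => [r| |]//; rewrite lte_fin => r0 _.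
  by rewrite inver (gt_eqF r0) lee_pdivlMr.
rewrite lhs; apply: le_trans (limn_einf_le rhs).
apply: le_trans (fatou _ _ _ _) => //; last 2 first.
- by move=> n; exact: fubG.
- by move=> n t _; exact: integral_real_ge0.
apply: ge0_le_integral => //.
- by move=> t _; rewrite mule_ge0.
- apply: emeasurable_funM => //.
  by under eq_fun do rewrite HE; exact: fubG.
- apply: (emeasurable_fun_cvg
    (fun n t => einfs (fun n => \int[m]_x (G n (x, t))%:E) n)).
    by move=> n; apply: measurable_fun_einfs => i; exact: fubG.
  by move=> t _; rewrite limn_einfE; exact: cvg_einfs_sup.
Qed.

End coarea.

(** * Approximation of the Cheeger energy by bounded Lipschitz functions *)

Section square_integrals.
Context {d : measure_display} {T : measurableType d} {R : realType}
  (m : {measure set T -> \bar R}).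
Local Open Scope ereal_scope.
Implicit Types f g h : T -> R.

Lemma integral_le_lin (a b A B : R) h f g : (0 <= a)%R -> (0 <= b)%R ->
  (forall x, 0 <= h x)%R -> (forall x, 0 <= f x)%R -> (forall x, 0 <= g x)%R ->
  measurable_fun setT h -> measurable_fun setT f -> measurable_fun setT g ->
  (\forall x \ae m, (h x <= a * f x + b * g x)%R) ->
  \int[m]_x (f x)%:E <= A%:E -> \int[m]_x (g x)%:E <= B%:E ->
  \int[m]_x (h x)%:E <= (a * A + b * B)%:E.
Proof.
move=> a0 b0 h0 f0 g0 mh mf mg hfg fA gB.
have maf : measurable_fun setT (fun x => a * f x)%R by exact: measurable_funM.
have mbg : measurable_fun setT (fun x => b * g x)%R by exact: measurable_funM.
apply: (@le_trans _ _ (\int[m]_x (a * f x + b * g x)%:E)).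
  apply: integral_le_ge0_ae => //; last exact: measurable_funD.
  by move=> x; rewrite addr_ge0// mulr_ge0.
rewrite integralD_ge0//; last 2 first.
- by move=> x; rewrite mulr_ge0.
- by move=> x; rewrite mulr_ge0.
by rewrite !integralZ_ge0// EFinD !EFinM leeD// lee_wpmul2l.
Qed.

Lemma ge0_integrable (q : T -> R) : measurable_fun setT q ->
  (forall x, 0 <= q x)%R -> \int[m]_x (q x)%:E < +oo ->
  m.-integrable setT (EFin \o q).
Proof.
move=> mq q0 qoo; apply/integrableP; split; first exact/measurable_EFinP.
by under eq_integral do rewrite /= ger0_norm//.
Qed.

Lemma integral_real (h : T -> R) (A : R) : (forall x, 0 <= h x)%R ->
  \int[m]_x (h x)%:E <= A%:E ->
  exists r : R, [/\ \int[m]_x (h x)%:E = r%:E, (0 <= r)%R & (r <= A)%R].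
Proof.
move=> h0 hA; exists (fine (\int[m]_x (h x)%:E)).
have E := integral_eq_fine h0 hA (ltry _).
split => //; first by rewrite -lee_fin -E integral_real_ge0.
by rewrite -lee_fin -E.
Qed.

Lemma Lnorm2E h : 'N[m]_2[EFin \o h] = (\int[m]_x (h x ^+ 2)%:E) `^ 2^-1.
Proof.
rewrite unlock; congr (_ `^ _); apply: eq_integral => x _ /=.
by rewrite powR_mulrn// -normrX ger0_norm// sqr_ge0.
Qed.

Lemma Lnorm2_le h (e : R) : (0 <= e)%R ->
  ('N[m]_2[EFin \o h] <= e%:E) = (\int[m]_x (h x ^+ 2)%:E <= (e ^+ 2)%:E).
Proof.
move=> e0; rewrite Lnorm2E.
have : 0 <= \int[m]_x (h x ^+ 2)%:E by apply: integral_real_ge0 => x; exact: sqr_ge0.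
case: (\int[m]_x _) => [r| |]//; last first.
  by rewrite poweRyr// !leye_eq.
rewrite lee_fin => r0; rewrite poweR_EFin !lee_fin powR12_sqrt//.
by rewrite -[LHS](@ler_pXn2r _ 2%N) ?nnegrE ?sqrtr_ge0// sqr_sqrtr.
Qed.

Lemma finite_norm2P h : finite_norm m 2%:E h <-> \int[m]_x (h x ^+ 2)%:E < +oo.
Proof.
rewrite /finite_norm Lnorm2E; split => [|h1]; last exact: poweR_lty.
by apply: lty_poweRy; rewrite // invr_eq0 pnatr_eq0.
Qed.

Lemma L2_ex h : measurable_fun setT h -> \int[m]_x (h x ^+ 2)%:E < +oo ->
  exists g : L2 m, (g : T -> R) = h.
Proof.
move=> mh hoo; have hL : h \in @Lfun _ T R m 2%:E.
  by rewrite !inE; apply/andP; split; rewrite inE//; apply/finite_norm2P.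
by exists (Lfun_Sub (lee1n 2) hL).
Qed.

Lemma L2_measurable (f : L2 m) : measurable_fun setT (f : T -> R).
Proof. exact: measurable_funPT. Qed.

Lemma L2_lty (f : L2 m) : \int[m]_x (f x ^+ 2)%:E < +oo.
Proof. by apply/finite_norm2P; exact: Lfunction_finite. Qed.

End square_integrals.

Section energy.
Context {d : measure_display} {R : realType}
  {X : completeMetricMeasurableType d R}
  (m : {sigma_finite_measure set X -> \bar R})
  (mmX : is_metric_measure_space m).
Implicit Types u : X -> R.
Local Open Scope ereal_scope.

Lemma cheeger_energy_ge0 (f : L2 m) : 0 <= cheeger_energy f.
Proof.
apply: le_ereal_inf_tmp => _ [u [_ _ ->]]; apply: limn_einf_ge => n.
by rewrite mule_ge0// integral_ge0// => x _; rewrite sqre_ge0.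
Qed.

Lemma slope_sqrE u x : lipschitz_in setT u ->
  slope u x ^+ 2 = (fine (slope u x) ^+ 2)%:E.
Proof. by move=> lu; rewrite {1}lipschitz_slope_fine. Qed.

(** A lower limit below the bound is below it along infinitely many indices, so
one term of a competing sequence meets both requirements. *)
Lemma cheeger_energy_approx (f : L2 m) (E : R) : cheeger_energy f < E%:E ->
  forall e : R, (0 < e)%R -> exists u, [/\ Lip_bs u,
    \int[m]_x ((u x - f x) ^+ 2)%:E <= e%:E &
    \int[m]_x (fine (slope u x) ^+ 2)%:E <= (2 * E)%:E].
Proof.
move=> /ereal_inf_lt[_ [u [uL uf ->]] uE] e e0.
have se0 : (0 < Num.sqrt e)%R by rewrite sqrtr_gt0.
have [N _ HN] : \forall n \near \oo,
    'N[m]_2[EFin \o (u n \- f)%R] < (Num.sqrt e)%:E.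
  by apply: (uf [set y | y < (Num.sqrt e)%:E]); apply: open_nbhs_nbhs; split;
    [exact: open_ereal_lt_ereal|rewrite /= lte_fin].
have [n Nn nE] := limn_einf_lt uE N.
exists (u n); split => //.
  by rewrite -(sqr_sqrtr (ltW e0)) -Lnorm2_le ?sqrtr_ge0// ltW//; exact: HN.
move: nE; under eq_integral do rewrite (slope_sqrE _ (uL n).1).
have : 0 <= \int[m]_x (fine (slope (u n) x) ^+ 2)%:E.
  by apply: integral_real_ge0 => x; exact: sqr_ge0.
move: (\int[m]_x _) => [r _| _|//].
- by rewrite -EFinM lte_fin lee_fin ltr_pdivrMl// => /ltW.
- by rewrite gt0_muley// lte_fin invr_gt0.
Qed.

Lemma cheeger_energy_le (f : L2 m) (E : R) :
  (forall e : R, (0 < e)%R -> exists u, [/\ Lip_bs u,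
    \int[m]_x ((u x - f x) ^+ 2)%:E <= e%:E &
    \int[m]_x (fine (slope u x) ^+ 2)%:E <= (2 * E + e)%:E]) ->
  cheeger_energy f <= E%:E.
Proof.
move=> H; apply/lee_addgt0Pr => e e0.
have en0 (n : nat) : (0 < Num.min e (n.+1%:R^-1 ^+ 2))%R.
  by rewrite lt_min e0 exprn_gt0.
have /choice[u Hu] := fun n => H _ (en0 n).
apply: (@le_trans _ _
    (limn_einf (fun n => (2^-1)%:E * \int[m]_x (slope (u n) x) ^+ 2))).
  apply: ereal_inf_lbound; exists u; split => //; first by move=> n; have [] := Hu n.
  have cN : n.+1%:R^-1%:E @[n --> \oo] --> (0 : \bar R).
    exact: cvge_harmonic.
  apply: squeeze_cvge (cvg_cst _) cN; apply: nearW => n; rewrite Lnorm_ge0/=.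
  have [_ + _] := Hu n => /le_trans h.
  rewrite Lnorm2_le ?invr_ge0//; apply: h; rewrite lee_fin ge_min lexx orbT//.
apply: limn_einf_le => n; have [lu _ h] := Hu n.
under eq_integral do rewrite (slope_sqrE _ lu.1).
apply: (@le_trans _ _ ((2^-1)%:E * (2 * E + e)%:E)).
  apply: lee_wpmul2l => //; apply: (le_trans h).
  by rewrite lee_fin lerD2l ge_min lexx.
by rewrite -EFinM -EFinD lee_fin; lra.
Qed.

Lemma Lip_bs_comp u (phi : R -> R) (M K : R) : Lip_bs u ->
  (forall x, `|u x| <= M)%R -> (0 <= K)%R -> phi 0%R = 0%R ->
  (forall a b, `|a| <= M -> `|b| <= M -> `|phi a - phi b| <= K * `|a - b|)%R ->
  Lip_bs (phi \o u).
Proof.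
move=> [lu [x0 [r ur]]] uM K0 phi0 Hphi; split.
  have [L L0 uL] := lipschitz_inP lu; exists (K * L)%R => x y _ _.
  apply: (le_trans (Hphi _ _ (uM x) (uM y))).
  by rewrite -mulrA ler_wpM2l.
exists x0, r; apply: subset_trans ur; apply: closureS => x /=.
by apply: contra_neq => ->.
Qed.

Lemma Lip_bs_bounded u : Lip_bs u -> exists2 M : R, (0 <= M)%R &
  forall x, (`|u x| <= M)%R.
Proof.
move=> ub; have [L L0 uL] := lipschitz_inP ub.1.
have [x0 [r ur]] := Lip_bs_support_bounded ub.
exists (`|u x0| + L * `|r|)%R; first by rewrite addr_ge0 ?mulr_ge0.
move=> x; have [->|ux] := eqVneq (u x) 0%R.
  by rewrite normr0 addr_ge0 ?mulr_ge0.
have := ur _ ux; rewrite ballEmdist /= => xr.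
rewrite -[X in `|X|%R](subrK (u x0)) addrC (le_trans (ler_normD _ _))// lerD2l.
apply: (le_trans (uL _ _)); rewrite ler_wpM2l// metric_sym.
exact: le_trans (ltW xr) (ler_norm _).
Qed.

Definition clamp (M s : R) : R := Num.max (- M)%R (Num.min M s).

Lemma clamp_bound (M s : R) : (0 <= M)%R -> (`|clamp M s| <= M)%R.
Proof.
move=> M0; rewrite ler_norml /clamp le_max lexx/= ge_max ge_min lexx/= andbT.
by rewrite lerNl (le_trans _ M0)// oppr_le0.
Qed.

Lemma clamp_id (M s : R) : (`|s| <= M)%R -> clamp M s = s.
Proof.
by rewrite ler_norml => /andP[h1 h2]; rewrite /clamp min_r// max_r.
Qed.

Lemma clamp_contraction (M a b : R) : (`|clamp M a - clamp M b| <= `|a - b|)%R.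
Proof.
exact: le_trans (maxr_contraction _ _ _) (minr_contraction _ _ _).
Qed.

(** Truncation contracts distances, hence slopes, and it moves an approximant
closer to a function with that bound. *)
Lemma cheeger_energy_approx_bounded (f : L2 m) (E M : R) : (0 <= M)%R ->
  (\forall x \ae m, `|f x| <= M)%R -> cheeger_energy f < E%:E ->
  forall e : R, (0 < e)%R -> exists u, [/\ Lip_bs u, forall x, (`|u x| <= M)%R,
    \int[m]_x ((u x - f x) ^+ 2)%:E <= e%:E &
    \int[m]_x (fine (slope u x) ^+ 2)%:E <= (2 * E)%:E].
Proof.
move=> M0 fM fE e e0; have [u [ub uf uE]] := cheeger_energy_approx fE e0.
have [K _ uK] := Lip_bs_bounded ub.
have mf := L2_measurable f; have mu := lipschitz_in_measurable mmX ub.1.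
have cb : Lip_bs (clamp M \o u).
  apply: (Lip_bs_comp ub uK ler01).
    by rewrite clamp_id// normr0.
  by move=> a b _ _; rewrite mul1r; exact: clamp_contraction.
have mc := lipschitz_in_measurable mmX cb.1.
exists (clamp M \o u); split; [exact: cb|by move=> x; exact: clamp_bound| |].
- apply: le_trans uf; apply: integral_le_ge0_ae.
  + by move=> x; exact: sqr_ge0.
  + by move=> x; exact: sqr_ge0.
  + apply: filterS fM => x fx; rewrite -[X in (_ - X)%R](clamp_id fx).
    rewrite -[X in (X <= _)%R]real_normK ?num_real//.
    rewrite -[X in (_ <= X)%R]real_normK ?num_real//.
    by rewrite ler_pXn2r ?nnegrE//; exact: clamp_contraction.
  + by apply: measurable_funX; exact: measurable_funB.
  + by apply: measurable_funX; exact: measurable_funB.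
- apply: le_trans uE; apply: integral_le_ge0.
  + by move=> x; exact: sqr_ge0.
  + move=> x; rewrite ler_pXn2r ?nnegrE ?fine_slope_ge0//.
    rewrite -lee_fin -(lipschitz_slope_fine x cb.1).
    apply: slope_contraction; first exact: fine_slope_ge0.
      exact: clamp_contraction.
    by rewrite {1}(lipschitz_slope_fine x ub.1).
  + exact: (measurable_funX 2 (fine_slope_measurable mmX cb.1)).
  + exact: (measurable_funX 2 (fine_slope_measurable mmX ub.1)).
Qed.

End energy.

(** * Energy identities for eigenfunctions *)

Section eigenfunctions.
Context {d : measure_display} {R : realType}
  {X : completeMetricMeasurableType d R}
  (m : {sigma_finite_measure set X -> \bar R})
  (mmX : is_metric_measure_space m).
Implicit Types (u : X -> R) (f h : L2 m) (l c : R).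
Local Open Scope ereal_scope.

Lemma L2_gt0 f : ~ ((f : X -> R) = cst 0%R %[ae m]) ->
  exists2 N : R, (0 < N)%R & \int[m]_x (f x ^+ 2)%:E = N%:E.
Proof.
move=> f0; have N0 : 0 <= \int[m]_x (f x ^+ 2)%:E.
  by apply: integral_real_ge0 => x; exact: sqr_ge0.
have Nfin := L2_lty f; exists (fine (\int[m]_x (f x ^+ 2)%:E)); last first.
  by rewrite fineK// ge0_fin_numE.
rewrite fine_gt0// Nfin andbT lt_neqAle N0 andbT; apply/negP => /eqP E0.
apply: f0; have /Lnorm_eq0_eq0 : 'N[m]_2[EFin \o f] = 0.
  by rewrite Lnorm2E -E0 poweR0r// invr_neq0.
move=> /(_ _ _)/wrap[]//.
  by apply/measurable_EFinP; exact: L2_measurable.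
by apply: filterS => x /= h _; have /= := h I => -[].
Qed.

Lemma cheeger_energy_scale f h (k E : R) : (forall x, h x = k * f x)%R ->
  cheeger_energy f < E%:E -> cheeger_energy h <= (k ^+ 2 * E)%:E.
Proof.
move=> hk fE; have mf := L2_measurable f.
apply: cheeger_energy_le => e e0.
have D0 : (0 < k ^+ 2 + 1)%R by rewrite ltr_wpDl// sqr_ge0.
have e1 : (0 < e / (k ^+ 2 + 1))%R by rewrite divr_gt0.
have [u [ub uf uE]] := cheeger_energy_approx fE e1.
have [M _ uM] := Lip_bs_bounded ub.
have mu := lipschitz_in_measurable mmX ub.1.
pose phi s : R := (k * s)%R.
have phiL a b : (`|phi a - phi b| <= `|k| * `|a - b|)%R.
  by rewrite /phi -mulrBr normrM.
have vb : Lip_bs (phi \o u).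
  by apply: (Lip_bs_comp ub uM (normr_ge0 k)) => //; rewrite /phi mulr0.
exists (phi \o u); split; first exact: vb.
- under eq_integral => x _ do rewrite hk /= /phi -mulrBr exprMn.
  rewrite integralZ_ge0 ?sqr_ge0//; last 2 first.
  + by move=> x; exact: sqr_ge0.
  + by apply: measurable_funX; exact: measurable_funB.
  apply: (@le_trans _ _ ((k ^+ 2)%:E * (e / (k ^+ 2 + 1))%:E)).
    by apply: lee_wpmul2l => //; rewrite lee_fin sqr_ge0.
  rewrite -EFinM lee_fin mulrCA ler_piMr ?(ltW e0)// ler_pdivrMr// mul1r lerDl//.
- apply: (@le_trans _ _ (\int[m]_x (k ^+ 2 * fine (slope u x) ^+ 2)%:E)).
    apply: integral_le_ge0.
    + by move=> x; exact: sqr_ge0.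
    + move=> x; rewrite -(real_normK (num_real k)) -exprMn.
      rewrite ler_pXn2r ?nnegrE ?mulr_ge0 ?fine_slope_ge0//.
      rewrite -lee_fin -(lipschitz_slope_fine x vb.1).
      apply: slope_comp_le => //; first exact: fine_slope_ge0.
        by rewrite {1}(lipschitz_slope_fine x ub.1).
      move=> e' e'0; exists 1%R => // b _; apply: (le_trans (phiL _ _)).
      by rewrite ler_wpM2r// lerDl ltW.
    + exact: (measurable_funX 2 (fine_slope_measurable mmX vb.1)).
    + apply: measurable_funM => //.
      exact: (measurable_funX 2 (fine_slope_measurable mmX ub.1)).
  rewrite integralZ_ge0 ?sqr_ge0//; last 2 first.
  + by move=> x; exact: sqr_ge0.
  + exact: (measurable_funX 2 (fine_slope_measurable mmX ub.1)).
  apply: (@le_trans _ _ ((k ^+ 2)%:E * (2 * E)%:E)).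
    by apply: lee_wpmul2l => //; rewrite lee_fin sqr_ge0.
  by rewrite -EFinM lee_fin mulrCA lerDl ltW.
Qed.

(** The subdifferential inequality at an eigenfunction, for competitors whose
pairing with it has a sign that does not depend on the point. *)
Lemma eigenfunction_test l f h (q : X -> R) (s Q c E : R) :
  neg_laplacian f (l *: f)%R -> cheeger_energy f = c%:E ->
  cheeger_energy h <= E%:E ->
  (forall x, f x * (h x - f x) = s * q x)%R ->
  (forall x, 0 <= q x)%R -> measurable_fun setT q ->
  \int[m]_x (q x)%:E = Q%:E ->
  (c + l * s * Q <= E)%R.
Proof.
move=> [[_ sub] _] fc hE hq q0 mq qQ.
have := le_trans (sub h) hE.
rewrite (_ : \int[m]_x _ = \int[m]_x ((l * s)%:E * (q x)%:E)); last first.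
  apply: eq_integral => x _; rewrite -EFinM; congr (_%:E).
  by rewrite -[RHS]mulrA -hq mulrA.
rewrite integralZl//; last by apply: ge0_integrable; rewrite // qQ ltry.
by rewrite qQ fc -EFinM -EFinD lee_fin.
Qed.

(** Testing minimality along the ray through the eigenfunction gives Euler's
identity for the 2-homogeneous energy. *)
Lemma eigenfunction_energy l f : eigenfunction l f -> exists N c : R,
  [/\ (0 < N)%R, \int[m]_x (f x ^+ 2)%:E = N%:E, cheeger_energy f = c%:E,
      (2 * c = l * N)%R & (0 <= l)%R].
Proof.
move=> [f0 lf]; have [N N0 fN] := L2_gt0 f0.
have foo : cheeger_energy f < +oo by have [[]] := lf.
have [c fc] : exists c : R, cheeger_energy f = c%:E.
  exists (fine (cheeger_energy f)).
  by rewrite fineK// ge0_fin_numE ?cheeger_energy_ge0.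
have c0 : (0 <= c)%R by rewrite -lee_fin -fc cheeger_energy_ge0.
have ray (s E : R) : (c < E)%R -> (c + l * s * N <= (1 + s) ^+ 2 * E)%R.
  move=> cE; apply: (@eigenfunction_test l f ((1 + s) *: f)%R (fun x => f x ^+ 2)%R s N c _ lf fc).
  - by apply: (cheeger_energy_scale (f := f)) => //; rewrite fc lte_fin.
  - move=> x; rewrite (_ : ((1 + s) *: f : L2 m)%R x = (1 + s) * f x)%R//.
    by ring.
  - by move=> x; exact: sqr_ge0.
  - by apply: measurable_funX; exact: L2_measurable.
  - exact: fN.
have ray' (s : R) : (c + l * s * N <= (1 + s) ^+ 2 * c)%R.
  apply/ler_addgt0Pr => e e0; have D0 : (0 < (1 + s) ^+ 2 + 1)%R.
    by rewrite ltr_wpDl// sqr_ge0.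
  have := ray s (c + e / ((1 + s) ^+ 2 + 1))%R; rewrite ltrDl divr_gt0// => /(_ isT).
  move=> /le_trans; apply; rewrite mulrDr lerD2l mulrCA ler_piMr ?(ltW e0)//.
  by rewrite ler_pdivrMr// mul1r lerDl.
have cN : (2 * c = l * N)%R.
  apply/eqP; rewrite eq_le; apply/andP; split; apply/ler_addgt0Pr => e e0.
    have t0 : (0 < e / (c + 1))%R by rewrite divr_gt0// ltr_wpDl.
    have te : (e / (c + 1) * c <= e)%R.
      by rewrite mulrAC ler_pdivrMr ?ltr_wpDl// mulrDr mulr1 lerDl ltW.
    by have := ray' (- (e / (c + 1)))%R; nra.
  have t0 : (0 < e / (c + 1))%R by rewrite divr_gt0// ltr_wpDl.
  have te : (e / (c + 1) * c <= e)%R.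
    by rewrite mulrAC ler_pdivrMr ?ltr_wpDl// mulrDr mulr1 lerDl ltW.
  by have := ray' (e / (c + 1))%R; nra.
exists N, c; split => //.
by rewrite -(pmulr_lge0 _ N0) -cN mulr_ge0.
Qed.

End eigenfunctions.

(** * Equality in Cheeger's inequality forces a zero eigenvalue *)

Section equality_case.
Context {d : measure_display} {R : realType}
  {X : completeMetricMeasurableType d R}
  (m : {sigma_finite_measure set X -> \bar R})
  (mmX : is_metric_measure_space m).
Implicit Types (u : X -> R).
Local Open Scope ereal_scope.

(** The arithmetic of the equality case.  Here [s] is the square root of [l] and,
for an approximant [u], [D] is the squared deficit, [S] the Dirichlet integral,
[U] the square integral and [V] the pairing of [|u|] with the slope, which
Cheeger's inequality for [u ^ 2] bounds from below. *)
Lemma deficit_arith (l N c S U V D s e ei eta dlt : R) :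
  (0 <= s -> 0 <= l -> s * s = l -> 2 * c = l * N ->
   D + 2 * s * V = S + l * U -> S <= 2 * (c + e / 2) ->
   N <= (1 + eta) * U + (1 + ei) * e -> s * U <= V ->
   e * (1 + l * (1 + ei)) <= dlt / 2 -> l * eta * U <= dlt / 2 -> D <= dlt)%R.
Proof.
move=> s0 l0 ssl clN key SN NU cU eK etaK.
have h1 : (s * (s * U) <= s * V)%R by rewrite ler_wpM2l.
have h2 : (l * N <= l * ((1 + eta) * U + (1 + ei) * e))%R by rewrite ler_wpM2l.
rewrite mulrA ssl in h1.
have h3 : (D <= l * N + e - l * U)%R by lra.
by apply: (le_trans h3); lra.
Qed.

Lemma young_sqr (e a b : R) : (0 < e)%R ->
  ((a + b) ^+ 2 <= (1 + e) * a ^+ 2 + (1 + e^-1) * b ^+ 2)%R.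
Proof.
move=> e0; have : (0 <= (e * a - b) ^+ 2 / e)%R by rewrite divr_ge0 ?sqr_ge0 ?ltW.
have -> : ((e * a - b) ^+ 2 / e = e * a ^+ 2 - 2 * a * b + e^-1 * b ^+ 2)%R.
  by field; rewrite gt_eqF.
by rewrite -subr_ge0 => h; nra.
Qed.

Lemma slope_sqr_le u x : lipschitz_in setT u ->
  slope (fun y => u y ^+ 2)%R x <= (2 * (`|u x| * fine (slope u x)))%:E.
Proof.
move=> lu; have := @slope_comp_derive _ _ _ (fun t : R => t ^+ 2)%R u x
  (fine (slope u x)) (2 * u x)%R (fine_slope_ge0 u x).
rewrite normrM ger0_norm// -mulrA; apply.
- by rewrite {1}(lipschitz_slope_fine x lu).
- by apply: is_derive_eq; rewrite /GRing.scale /= mulr1 -mulr2n mulr_natl.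
Qed.

Context (l M N c : R) (f : L2 m).
Context (l0 : (0 <= l)%R) (M0 : (0 <= M)%R) (N0 : (0 < N)%R)
  (fM : (\forall x \ae m, `|f x| <= M)%R)
  (fN : \int[m]_x (f x ^+ 2)%:E = N%:E) (fc : cheeger_energy f = c%:E)
  (clN : (2 * c = l * N)%R).

(** Equality in Cheeger's inequality is equality in a Cauchy-Schwarz
inequality, so almost minimising functions almost satisfy the pointwise
identity between slope and modulus. *)
Lemma cheeger_equality_deficit :
  (2 * Num.sqrt l)%:E <= cheeger_constant m ->
  forall dlt : R, (0 < dlt)%R -> exists u, [/\ Lip_bs u, forall x, (`|u x| <= M)%R,
    \int[m]_x ((u x - f x) ^+ 2)%:E <= dlt%:E &
    \int[m]_x ((fine (slope u x) - Num.sqrt l * `|u x|) ^+ 2)%:E <= dlt%:E].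
Proof.
move=> hch dlt dlt0; set s := Num.sqrt l.
have s0 : (0 <= s)%R by exact: sqrtr_ge0.
have ssl : (s * s = l)%R by rewrite -expr2 sqr_sqrtr.
have mf := L2_measurable f.
pose K := (l * (2 * N + 2) + 1)%R.
have K0 : (0 < K)%R by rewrite ltr_wpDl// mulr_ge0// addr_ge0// mulr_ge0// ltW.
pose eta := (dlt / (2 * K))%R.
have eta0 : (0 < eta)%R by rewrite divr_gt0// mulr_gt0.
have etaK : (l * eta * (2 * N + 2) <= dlt / 2)%R.
  have -> : (l * eta * (2 * N + 2) = dlt / 2 * ((K - 1) / K))%R.
    by rewrite /eta /K; field; rewrite -/K gt_eqF.
  by rewrite ler_piMr ?divr_ge0 ?(ltW dlt0)// ler_pdivrMr// mul1r gerBl.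
pose K' := (1 + l * (1 + eta^-1))%R.
have K'1 : (1 <= K')%R.
  by rewrite lerDl mulr_ge0// addr_ge0// invr_ge0 ltW.
have K'0 : (0 < K')%R by apply: lt_le_trans K'1.
pose e := Num.min 1%R (dlt / (2 * K'))%R.
have e0 : (0 < e)%R by rewrite lt_min ltr01 divr_gt0// mulr_gt0.
have e1 : (e <= 1)%R by rewrite ge_min lexx.
have eK : (e * K' <= dlt / 2)%R.
  have : (e <= dlt / (2 * K'))%R by rewrite /e ge_min lexx orbT.
  by rewrite ler_pdivlMr ?mulr_gt0// => h; lra.
have ed : (e <= dlt)%R.
  by apply: (@le_trans _ _ (e * K')%R); [rewrite ler_peMr// ltW|lra].
have fE : cheeger_energy f < (c + e / 2)%:E by rewrite fc lte_fin ltrDl divr_gt0.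
have [u [ub uM uf uS]] := cheeger_energy_approx_bounded mmX M0 fM fE e0.
have mu := lipschitz_in_measurable mmX ub.1.
have ms := fine_slope_measurable mmX ub.1.
pose sl x := fine (slope u x); have sl0 x : (0 <= sl x)%R by exact: fine_slope_ge0.
have mabs : measurable_fun setT (fun x => `|u x|)%R by exact: measurableT_comp.
have mu2 : measurable_fun setT (fun x => u x ^+ 2)%R by exact: measurable_funX.
have ms2 : measurable_fun setT (fun x => sl x ^+ 2)%R by exact: measurable_funX.
have muf : measurable_fun setT (fun x => (u x - f x) ^+ 2)%R.
  by apply: measurable_funX; exact: measurable_funB.
have mf2 : measurable_fun setT (fun x => f x ^+ 2)%R by exact: measurable_funX.
have musl : measurable_fun setT (fun x => `|u x| * sl x)%R by exact: measurable_funM.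
have uf0 x : (0 <= (u x - f x) ^+ 2)%R by exact: sqr_ge0.
have sq0 (g : X -> R) x : (0 <= g x ^+ 2)%R by exact: sqr_ge0.
have [U [UE U0 UN]] : exists r : R, [/\ \int[m]_x (u x ^+ 2)%:E = r%:E, (0 <= r)%R &
    (r <= 2 * N + 2 * e)%R].
  apply: integral_real => //; apply: (integral_le_lin (m := m) (f := (fun x => f x ^+ 2)%R)
    (g := (fun x => (u x - f x) ^+ 2)%R)) => //; last by rewrite fN.
  by apply: nearW => x; have := sqr_ge0 (u x - 2 * f x)%R; nra.
have [S [SE S0 SN]] := integral_real (fun x => sq0 sl x) uS.
have [V [VE V0 _]] : exists r : R, [/\ \int[m]_x (`|u x| * sl x)%:E = r%:E, (0 <= r)%R &
    (r <= 1 * U + 1 * S)%R].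
  apply: integral_real; first by move=> x; rewrite mulr_ge0.
  apply: (integral_le_lin (m := m) (f := (fun x => u x ^+ 2)%R) (g := (fun x => sl x ^+ 2)%R)) => //.
  - by move=> x; rewrite mulr_ge0.
  - apply: nearW => x; rewrite -(real_normK (num_real (u x))).
    by have := sqr_ge0 (`|u x| - sl x)%R; have := normr_ge0 (u x); have := sl0 x; nra.
  - by rewrite UE.
  - by rewrite SE.
have cheegerU : (s * U <= V)%R.
  pose u2 := (fun t : R => t ^+ 2)%R \o u.
  have u2b : Lip_bs u2.
    apply: (Lip_bs_comp ub uM (mulr_ge0 (ler0n _ 2) M0)); first by rewrite expr0n.
    move=> a b aM bM; rewrite subr_sqr mulrC normrM ler_wpM2r//.
    by apply: (le_trans (ler_normD _ _)); lra.
  have := cheeger_Lip_bs mmX (mulr_ge0 (ler0n _ 2) s0) hch u2b (sq0 u).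
  rewrite UE -EFinM => /le_trans => /(_ (2 * V)%:E).
  rewrite lee_fin => h; suff : (2 * s * U <= 2 * V)%R by lra.
  apply: h; rewrite EFinM -VE -integralZ_ge0//; last by move=> x; rewrite mulr_ge0.
  apply: integral_le_ge0.
  - by move=> x; exact: fine_slope_ge0.
  - move=> x; rewrite -lee_fin -(lipschitz_slope_fine x u2b.1).
    exact: slope_sqr_le ub.1.
  - exact: (fine_slope_measurable mmX u2b.1).
  - exact: measurable_funM.
have NU : (N <= (1 + eta) * U + (1 + eta^-1) * e)%R.
  rewrite -lee_fin -fN; apply: (integral_le_lin (m := m) (f := (fun x => u x ^+ 2)%R)
    (g := (fun x => (u x - f x) ^+ 2)%R)) => //.
  - by rewrite addr_ge0// ltW.
  - by rewrite addr_ge0// invr_ge0 ltW.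
  - apply: nearW => x; have := @young_sqr eta (u x) (f x - u x)%R eta0.
    by rewrite addrC subrK -[X in (_ <= _ + _ * X)%R]sqrrN opprB.
  - by rewrite UE.
exists u; split => //; first by apply: (le_trans uf); rewrite lee_fin.
have mD : measurable_fun setT (fun x => (sl x - s * `|u x|) ^+ 2)%R.
  by apply: measurable_funX; apply: measurable_funB => //; exact: measurable_funM.
have Dsq0 x : (0 <= (sl x - s * `|u x|) ^+ 2)%R by exact: sqr_ge0.
have [D [DE _ _]] : exists r : R, [/\ \int[m]_x ((sl x - s * `|u x|) ^+ 2)%:E = r%:E,
    (0 <= r)%R & (r <= 2 * S + 2 * l * U)%R].
  apply: integral_real => //.
  apply: (integral_le_lin (m := m) (f := (fun x => sl x ^+ 2)%R) (g := (fun x => u x ^+ 2)%R)) => //.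
  - by rewrite mulr_ge0.
  - apply: nearW => x; rewrite -(real_normK (num_real (u x))) -ssl.
    by have := sqr_ge0 (sl x + s * `|u x|)%R; nra.
  - by rewrite SE.
  - by rewrite UE.
have key : (D + 2 * s * V = S + l * U)%R.
  apply: EFin_inj; rewrite !EFinD !EFinM -DE -VE -SE -UE.
  rewrite -EFinM -!integralZ_ge0// ?mulr_ge0//; last by move=> x; rewrite mulr_ge0.
  rewrite -!integralD_ge0//.
  - apply: eq_integral => x _; congr (_%:E).
    by rewrite -(real_normK (num_real (u x))) -ssl; ring.
  - by move=> x; rewrite mulr_ge0.
  - exact: measurable_funM.
  - by move=> x; rewrite !mulr_ge0.
  - exact: measurable_funM.
rewrite -/(sl) DE lee_fin; rewrite /K' in eK.
have {}etaK : (l * eta * U <= dlt / 2)%R.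
  apply: le_trans etaK; apply: ler_wpM2l.
    by apply: mulr_ge0 => //; exact: ltW.
  by apply: (le_trans UN); rewrite lerD2l ler_piMr.
exact: (deficit_arith s0 l0 ssl clN key SN NU cheegerU eK etaK).
Qed.

(** The normalisation of [th] keeps the derivative [1 - 3 * k * th * s ^ 2]
between 0 and 1 on the range of values considered.  The case [k = 1] is the
perturbation itself; [k = 3] gives its derivative times [s], which describes the
slope of the perturbed function. *)
Lemma cubic_contraction (k th a b : R) : (0 <= k -> k <= 3 -> 0 <= th ->
  9 * th * M ^+ 2 = 1 -> `|a| <= M -> `|b| <= M ->
  `|(a - k * th * a ^+ 3) - (b - k * th * b ^+ 3)| <= `|a - b|)%R.
Proof.
move=> k0 k3 th0 thM aM bM.
have -> : ((a - k * th * a ^+ 3) - (b - k * th * b ^+ 3) =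
  (1 - k * (th * (a ^+ 2 + a * b + b ^+ 2))) * (a - b))%R by ring.
rewrite normrM ler_piMl//; set q := (a ^+ 2 + a * b + b ^+ 2)%R.
have a2 : (a ^+ 2 <= M ^+ 2)%R by rewrite -(real_normK (num_real a)) ler_pXn2r ?nnegrE.
have b2 : (b ^+ 2 <= M ^+ 2)%R by rewrite -(real_normK (num_real b)) ler_pXn2r ?nnegrE.
have q0 : (0 <= q)%R by rewrite /q; nra.
have qM : (q <= 3 * M ^+ 2)%R by have := sqr_ge0 (a - b)%R; rewrite /q; nra.
have tq0 : (0 <= th * q)%R by rewrite mulr_ge0.
have tq : (th * q <= 3^-1)%R.
  by apply: (le_trans (ler_wpM2l th0 qM)); lra.
have ktq0 : (0 <= k * (th * q))%R by rewrite mulr_ge0.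
have ktq : (k * (th * q) <= 3 * 3^-1)%R by rewrite ler_pM.
by rewrite ler_norml; apply/andP; split; lra.
Qed.

(** On functions with small deficit the slope may be replaced by [sqrt l] times
the modulus, so the chain rule turns the energy of the cubic perturbation into
an integral without derivatives. *)
Lemma cheeger_energy_cubic (th P : R) (h : L2 m) : (0 < M)%R -> (0 <= th)%R ->
  (9 * th * M ^+ 2 = 1)%R -> (2 * Num.sqrt l)%:E <= cheeger_constant m ->
  (forall x, h x = f x - th * f x ^+ 3)%R ->
  \int[m]_x ((f x - 3 * th * f x ^+ 3) ^+ 2)%:E = P%:E ->
  cheeger_energy h <= (l * P / 2)%:E.
Proof.
move=> M_gt0 th0 thM hch hE PE.
have P0 : (0 <= P)%R.
  by rewrite -lee_fin -PE integral_real_ge0// => x; exact: sqr_ge0.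
have lP : (0 <= l * P)%R by rewrite mulr_ge0.
set s := Num.sqrt l; have s0 : (0 <= s)%R by exact: sqrtr_ge0.
have ssl : (s ^+ 2 = l)%R by rewrite sqr_sqrtr.
apply: cheeger_energy_le => e e0.
pose eta := Num.min 1%R (e / (2 * (3 * (l * P) + 1)))%R.
have D0 : (0 < 3 * (l * P) + 1)%R by rewrite ltr_wpDl// mulr_ge0.
have eta0 : (0 < eta)%R by rewrite lt_min ltr01 divr_gt0// mulr_gt0.
have eta1 : (eta <= 1)%R by rewrite ge_min lexx.
have etaP : (3 * eta * (l * P) <= e / 2)%R.
  have : (eta <= e / (2 * (3 * (l * P) + 1)))%R by rewrite /eta ge_min lexx orbT.
  by rewrite ler_pdivlMr ?mulr_gt0//; clearbody eta => h1; nra.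
have ei0 : (0 <= eta^-1)%R by rewrite invr_ge0 ltW.
pose K := ((1 + eta) * l * (1 + eta^-1) + (1 + eta^-1) + 1)%R.
have K1 : (1 <= K)%R.
  by rewrite lerDr addr_ge0 ?mulr_ge0 ?addr_ge0// ltW.
have K0 : (0 < K)%R by apply: lt_le_trans K1.
pose dlt := (e / (2 * K))%R.
have dlt0 : (0 < dlt)%R by rewrite divr_gt0// mulr_gt0.
have dK : (dlt * K = e / 2)%R by rewrite /dlt; field; rewrite gt_eqF.
have de : (dlt <= e)%R.
  apply: (@le_trans _ _ (dlt * K)%R); first by rewrite ler_peMr// ltW.
  by rewrite dK ler_pdivrMr// ler_peMr ?(ltW e0)// ler1n.
have [u [ub uM uf uD]] := cheeger_equality_deficit hch dlt0.
have mf := L2_measurable f; have mh := L2_measurable h.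
have mu := lipschitz_in_measurable mmX ub.1.
have ms := fine_slope_measurable mmX ub.1.
pose sl x := fine (slope u x); have sl0 x : (0 <= sl x)%R by exact: fine_slope_ge0.
pose psi (t : R) := (t - th * t ^+ 3)%R.
have psiE t : (psi t = t - 1 * th * t ^+ 3)%R by rewrite mul1r.
have psiC a b : (`|a| <= M -> `|b| <= M -> `|psi a - psi b| <= `|a - b|)%R.
  by move=> aM bM; rewrite !psiE; apply: cubic_contraction => //; rewrite ler1n.
have vb : Lip_bs (psi \o u).
  apply: (Lip_bs_comp ub uM ler01); first by rewrite /psi expr0n mulr0 subr0.
  by move=> a b aM bM; rewrite mul1r; exact: psiC.
have mv := lipschitz_in_measurable mmX vb.1.
have msv := fine_slope_measurable mmX vb.1.
have mcub (g : X -> R) k : measurable_fun setT g ->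
    measurable_fun setT (fun x => g x - k * g x ^+ 3)%R.
  move=> mg; apply: measurable_funB => //; apply: measurable_funM => //.
  exact: measurable_funX.
have mabs : measurable_fun setT (fun x => `|u x|)%R by exact: measurableT_comp.
exists (psi \o u); split; first exact: vb.
  apply: (@le_trans _ _ dlt%:E); last by rewrite lee_fin.
  apply: le_trans uf; apply: integral_le_ge0_ae.
  - by move=> x; exact: sqr_ge0.
  - by move=> x; exact: sqr_ge0.
  - apply: filterS fM => x fx; rewrite hE -/(psi (f x)).
    rewrite -[X in (X <= _)%R]real_normK ?num_real//.
    rewrite -[X in (_ <= X)%R]real_normK ?num_real//.
    by rewrite ler_pXn2r ?nnegrE//; exact: psiC.
  - by apply: measurable_funX; exact: measurable_funB.
  - by apply: measurable_funX; exact: measurable_funB.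
pose Psi (t : R) := (t - 3 * th * t ^+ 3)%R.
have [PU [PUE PU0 PUP]] : exists r : R, [/\ \int[m]_x (Psi (u x) ^+ 2)%:E = r%:E,
    (0 <= r)%R & (r <= (1 + eta) * P + (1 + eta^-1) * dlt)%R].
  apply: integral_real; first by move=> x; exact: sqr_ge0.
  apply: (integral_le_lin (m := m) (f := (fun x => Psi (f x) ^+ 2)%R)
    (g := (fun x => (u x - f x) ^+ 2)%R)).
  - by rewrite addr_ge0// ltW.
  - by rewrite addr_ge0.
  - by move=> x; exact: sqr_ge0.
  - by move=> x; exact: sqr_ge0.
  - by move=> x; exact: sqr_ge0.
  - by apply: measurable_funX; exact: mcub.
  - by apply: measurable_funX; exact: mcub.
  - by apply: measurable_funX; exact: measurable_funB.
  - apply: filterS fM => x fx.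
    have := @young_sqr eta (Psi (f x)) (Psi (u x) - Psi (f x)) eta0.
    rewrite addrC subrK => /le_trans; apply; rewrite lerD2l ler_wpM2l ?addr_ge0//.
    rewrite -[X in (X <= _)%R]real_normK ?num_real//.
    rewrite -[X in (_ <= X)%R]real_normK ?num_real//.
    by rewrite ler_pXn2r ?nnegrE//; apply: cubic_contraction.
  - by rewrite PE.
  - exact: uf.
apply: (@le_trans _ _ ((1 + eta) * l * PU + (1 + eta^-1) * dlt)%:E).
  apply: (integral_le_lin (m := m) (f := (fun x => Psi (u x) ^+ 2)%R)
    (g := (fun x => (sl x - s * `|u x|) ^+ 2)%R)).
  - by rewrite mulr_ge0// addr_ge0// ltW.
  - by rewrite addr_ge0.
  - by move=> x; exact: sqr_ge0.
  - by move=> x; exact: sqr_ge0.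
  - by move=> x; exact: sqr_ge0.
  - exact: (measurable_funX 2 msv).
  - by apply: measurable_funX; exact: mcub.
  - by apply: measurable_funX; apply: measurable_funB => //; exact: measurable_funM.
  - apply: nearW => x.
    have w0 : (0 <= 1 - 3 * th * u x ^+ 2)%R /\ (1 - 3 * th * u x ^+ 2 <= 1)%R.
      have u2 : (u x ^+ 2 <= M ^+ 2)%R.
        by rewrite -(real_normK (num_real (u x))) ler_pXn2r ?nnegrE.
      have : (th * u x ^+ 2 <= th * M ^+ 2)%R by rewrite ler_wpM2l.
      have : (0 <= th * u x ^+ 2)%R by rewrite mulr_ge0// sqr_ge0.
      by move=> h1 h2; split; lra.
    have [{}w0 w1] := w0; set w := (1 - 3 * th * u x ^+ 2)%R in w0 w1 *.
    have slv : (fine (slope (psi \o u) x) <= w * sl x)%R.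
      rewrite -lee_fin -(lipschitz_slope_fine x vb.1).
      have := @slope_comp_derive _ _ _ psi u x (sl x) w (sl0 x).
      rewrite (ger0_norm w0); apply.
        by rewrite {1}(lipschitz_slope_fine x ub.1).
      by rewrite /psi; apply: is_derive_eq; rewrite /GRing.scale /= /w; ring.
    have PsiE : (Psi (u x) ^+ 2 = (w * `|u x|) ^+ 2)%R.
      by rewrite [RHS]exprMn real_normK ?num_real// /Psi /w; ring.
    apply: (@le_trans _ _ ((w * sl x) ^+ 2)%R).
      by rewrite ler_pXn2r ?nnegrE ?fine_slope_ge0// mulr_ge0.
    have := @young_sqr eta (w * (s * `|u x|)) (w * (sl x - s * `|u x|)) eta0.
    have -> : (w * (s * `|u x|) + w * (sl x - s * `|u x|) = w * sl x)%R by ring.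
    move=> /le_trans; apply; apply: lerD.
      by rewrite PsiE -mulrA -ssl -exprMn; have -> : (w * (s * `|u x|) = s * (w * `|u x|))%R by ring.
    rewrite ler_wpM2l ?addr_ge0// exprMn ler_piMl ?sqr_ge0//.
    by rewrite exprn_ile1.
  - by rewrite PUE.
  - exact: uD.
have -> : (2 * (l * P / 2) = l * P)%R by field.
rewrite lee_fin; clearbody eta; clear - PUP dK etaP eta1 l0 eta0 lP dlt0.
have h1 : ((1 + eta) * l * PU <= (1 + eta) * l * ((1 + eta) * P + (1 + eta^-1) * dlt))%R.
  by rewrite ler_wpM2l// mulr_ge0// addr_ge0// ltW.
have h2 : (eta * eta * (l * P) <= eta * (l * P))%R.
  by rewrite ler_wpM2r// ler_piMr// ltW.
by rewrite /K in dK; clearbody dlt; lra.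
Qed.

End equality_case.

Section perturbation.
Context {d : measure_display} {R : realType}
  {X : completeMetricMeasurableType d R}
  (m : {sigma_finite_measure set X -> \bar R})
  (mmX : is_metric_measure_space m).
Implicit Types (u : X -> R).
Local Open Scope ereal_scope.

Context (l M N c : R) (f : L2 m).
Context (l0 : (0 <= l)%R) (M0 : (0 <= M)%R) (N0 : (0 < N)%R)
  (fM : (\forall x \ae m, `|f x| <= M)%R)
  (fN : \int[m]_x (f x ^+ 2)%:E = N%:E) (fc : cheeger_energy f = c%:E)
  (clN : (2 * c = l * N)%R).

(** Perturbing the eigenfunction by its cube moves the energy three times
faster than the linear term of the subdifferential inequality allows; here
boundedness of the eigenfunction makes the cube admissible. *)
Lemma cheeger_equality_eigenvalue0 : (0 < M)%R ->
  (2 * Num.sqrt l)%:E <= cheeger_constant m ->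
  neg_laplacian f (l *: f)%R -> l = 0%R.
Proof.
move=> M_gt0 hch lf; pose th := (9 * M ^+ 2)^-1%R.
have M2 : (0 < M ^+ 2)%R by rewrite exprn_gt0.
have th_gt0 : (0 < th)%R by rewrite invr_gt0 mulr_gt0.
have th0 : (0 <= th)%R by exact: ltW.
have thM : (9 * th * M ^+ 2 = 1)%R by rewrite /th; field; rewrite gt_eqF.
clearbody th.
have mf := L2_measurable f.
have mcub k : measurable_fun setT (fun x => f x - k * f x ^+ 3)%R.
  apply: measurable_funB => //; apply: measurable_funM => //.
  exact: measurable_funX.
have bound (a : R) : (`|a| <= M -> 0 <= a ^+ 2 /\ a ^+ 2 * th <= 9^-1)%R.
  move=> aM; split; first exact: sqr_ge0.
  have : (a ^+ 2 <= M ^+ 2)%R by rewrite -(real_normK (num_real a)) ler_pXn2r ?nnegrE.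
  by move=> /(ler_wpM2r th0) h; apply: (le_trans h); lra.
have [h hE] : exists h : L2 m, (h : X -> R) = (fun x => f x - th * f x ^+ 3)%R.
  apply: L2_ex => //; apply: (@le_lt_trans _ _ (1 * N + 0 * N)%:E); last exact: ltry.
  apply: (integral_le_lin (m := m) (f := (fun x => f x ^+ 2)%R)
    (g := (fun x => f x ^+ 2)%R)) => //; rewrite ?fN//.
  - by move=> x; exact: sqr_ge0.
  - by move=> x; exact: sqr_ge0.
  - by move=> x; exact: sqr_ge0.
  - by apply: measurable_funX; exact: mcub.
  - exact: measurable_funX.
  - exact: measurable_funX.
  - apply: filterS fM => x /bound[h1 h2].
    have -> : (f x - th * f x ^+ 3 = f x * (1 - f x ^+ 2 * th))%R by ring.
    rewrite exprMn mul0r addr0 mul1r ler_piMr// expr_le1//; try lra.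
    have : (0 <= f x ^+ 2 * th)%R by rewrite mulr_ge0.
    by move=> h3; lra.
have [Q [QE Q0 _]] : exists r : R, [/\ \int[m]_x (f x ^+ 4)%:E = r%:E, (0 <= r)%R &
    (r <= M ^+ 2 * N + 0 * N)%R].
  apply: integral_real; first by move=> x; rewrite -[4%N]/(2 * 2)%N exprM sqr_ge0.
  apply: (integral_le_lin (m := m) (f := (fun x => f x ^+ 2)%R)
    (g := (fun x => f x ^+ 2)%R)) => //; rewrite ?fN//.
  - exact: ltW.
  - by move=> x; rewrite -[4%N]/(2 * 2)%N exprM sqr_ge0.
  - by move=> x; exact: sqr_ge0.
  - by move=> x; exact: sqr_ge0.
  - exact: measurable_funX.
  - exact: measurable_funX.
  - exact: measurable_funX.
  - apply: filterS fM => x fx; rewrite mul0r addr0.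
    have -> : (f x ^+ 4 = f x ^+ 2 * f x ^+ 2)%R by ring.
    apply: ler_wpM2r; first exact: sqr_ge0.
    by rewrite -(real_normK (num_real (f x))) ler_pXn2r ?nnegrE.
have q40 x : (0 <= f x ^+ 4)%R by rewrite -[4%N]/(2 * 2)%N exprM sqr_ge0.
have Psi0 x : (0 <= (f x - 3 * th * f x ^+ 3) ^+ 2)%R by exact: sqr_ge0.
have mPsi : measurable_fun setT (fun x => (f x - 3 * th * f x ^+ 3) ^+ 2)%R.
  by apply: measurable_funX; exact: mcub.
have mq4 : measurable_fun setT (fun x => f x ^+ 4)%R by exact: measurable_funX.
have sumle : \int[m]_x ((f x - 3 * th * f x ^+ 3) ^+ 2 + 5 * th * f x ^+ 4)%:E <= N%:E.
  rewrite -fN; apply: integral_le_ge0_ae.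
  - by move=> x; rewrite addr_ge0// mulr_ge0// mulr_ge0.
  - by move=> x; exact: sqr_ge0.
  - apply: filterS fM => x /bound[h1 h2].
    have : (f x ^+ 2 * th * (f x ^+ 2 * (f x ^+ 2 * th)) <= f x ^+ 2 * th * (f x ^+ 2 * 9^-1))%R.
      apply: ler_wpM2l; first by rewrite mulr_ge0.
      exact: ler_wpM2l.
    by nra.
  - by apply: measurable_funD => //; exact: measurable_funM.
  - exact: measurable_funX.
rewrite integralD_ge0// in sumle; last 2 first.
- by move=> x; rewrite mulr_ge0// mulr_ge0.
- exact: measurable_funM.
rewrite integralZ_ge0// ?mulr_ge0// QE in sumle.
have [P [PE P0 _]] : exists r : R, [/\
    \int[m]_x ((f x - 3 * th * f x ^+ 3) ^+ 2)%:E = r%:E, (0 <= r)%R & (r <= N)%R].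
  apply: integral_real => //; apply: le_trans sumle.
  by rewrite leeDl// -EFinM lee_fin !mulr_ge0.
rewrite PE -EFinM -EFinD lee_fin in sumle.
have hx x : (h x = f x - th * f x ^+ 3)%R by rewrite hE.
have Ch := cheeger_energy_cubic mmX l0 M0 N0 fM fN fc clN M_gt0 th0 thM hch hx PE.
have := @eigenfunction_test _ _ _ m l f h (fun x => f x ^+ 4)%R (- th)%R Q c _ lf fc Ch.
move=> /(_ _ _ _ QE) test.
have {}test : (c + l * - th * Q <= l * P / 2)%R.
  apply: test => //; move=> x; rewrite hx; ring.
apply/eqP; rewrite eq_le l0 andbT leNgt; apply/negP => l_gt0.
have Q_gt0 : (0 < Q)%R.
  rewrite lt_neqAle Q0 andbT eq_sym; apply/eqP => Q00.
  have f20 : 'N[m]_2[EFin \o (fun x => f x ^+ 2)%R] = 0.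
    rewrite Lnorm2E; under eq_integral do rewrite -exprM.
    by rewrite QE Q00 poweR0r// invr_neq0.
  move: N0; suff -> : N = 0%R by rewrite ltxx.
  apply: EFin_inj; rewrite -fN.
  have : ae_eq m setT (fun x => (f x ^+ 2)%:E) (cst 0).
    apply: Lnorm_eq0_eq0 f20 => //.
    by apply/measurable_EFinP; exact: measurable_funX.
  move=> /ae_eq_integral -> //; first by rewrite integral0.
  by apply/measurable_EFinP; exact: measurable_funX.
have lth : (0 < l * (th * Q))%R by rewrite !mulr_gt0.
have : (l * P <= l * (N - 5 * th * Q))%R by rewrite ler_wpM2l//; lra.
move=> hP; have cl := clN; have : (l * (th * Q) <= 0)%R by lra.
by rewrite leNgt lth.
Qed.

End perturbation.

(** * Measures given by densities *)

Section density_measure.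
Context {d : measure_display} {T : measurableType d} {R : realType}
  (m : {measure set T -> \bar R}) (rho : T -> R).
Local Open Scope ereal_scope.

Definition density_measure (A : set T) : \bar R := \int[m]_(x in A) (rho x)%:E.

Context (mrho : measurable_fun setT rho) (rho0 : forall x, (0 <= rho x)%R).

Let density0 : density_measure set0 = 0.
Proof. exact: integral_set0. Qed.

Let density_ge0 A : 0 <= density_measure A.
Proof. by apply: integral_ge0 => x _; rewrite lee_fin. Qed.

Let density_sigma_additive : semi_sigma_additive density_measure.
Proof.
move=> /= F mF tF mUF; rewrite /density_measure; apply: cvg_toP.
  apply: ereal_nondecreasing_is_cvgn => i j ij.
  apply: lee_sum_nneg_natr => // k _ _.
  by apply: integral_ge0 => x _; rewrite lee_fin.
rewrite ge0_integral_bigcup//=.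
- by apply/measurable_EFinP; exact: measurable_funTS.
- by move=> x _; rewrite lee_fin.
Qed.

HB.instance Definition _ := isMeasure.Build _ _ _ density_measure
  density0 density_ge0 density_sigma_additive.

Lemma density_ex_measure : exists mu : {measure set T -> \bar R},
  forall A, mu A = \int[m]_(x in A) (rho x)%:E.
Proof. by exists density_measure. Qed.

Context (rho1 : \int[m]_x (rho x)%:E = 1).

Let density_setT : density_measure [set: T] = 1%:E.
Proof. exact: rho1. Qed.

HB.instance Definition _ := @Measure_isProbability.Build _ _ R
  density_measure density_setT.

Lemma density_probability : exists mu : probability T R,
  forall A, mu A = \int[m]_(x in A) (rho x)%:E.
Proof. by exists density_measure. Qed.

End density_measure.

Section change_of_density.
Local Open Scope ereal_scope.
Context {d : measure_display} {T : measurableType d} {R : realType}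
  (m mu : {measure set T -> \bar R}) (rho : T -> R)
  (mrho : measurable_fun setT rho) (rho0 : forall x, (0 <= rho x)%R)
  (muE : forall A, measurable A -> mu A = \int[m]_(x in A) (rho x)%:E).
Import HBNNSimple.

Lemma integral_indicM (A : set T) (f : T -> R) :
  \int[m]_(x in A) (f x)%:E = \int[m]_x (f x * \1_A x)%:E.
Proof.
rewrite integral_mkcond; apply: eq_integral => x _.
by rewrite patchE indicE; case: ifP => _; rewrite ?mulr1 ?mulr0.
Qed.

Let nnsfun_density (f : {nnsfun T >-> R}) :
  \int[mu]_x (f x)%:E = \int[m]_x (f x * rho x)%:E.
Proof.
rewrite integralT_nnsfun sintegralE.
under [RHS]eq_integral => x _ do rewrite fimfunE mulrC mulr_fsumr// -fsumEFin//.
rewrite ge0_integral_fsum//; last 2 first.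
- move=> r; apply/measurable_EFinP; apply: measurable_funM => //.
  by apply: measurable_funM => //; exact: measurable_indic.
- move=> r x _; rewrite lee_fin mulr_ge0//.
  by have := nnfun_muleindic_ge0 f r x; rewrite -EFinM lee_fin.
apply: eq_fsbigr => r /set_mem[x _ fx].
rewrite muE; last exact: measurable_sfunP.
rewrite integral_indicM -integralZ_ge0//.
- by apply: eq_integral => y _; congr (_%:E); rewrite mulrCA.
- by rewrite -fx.
- by move=> y; rewrite mulr_ge0.
- by apply: measurable_funM => //; apply: measurable_indic.
Qed.

Lemma integral_density (g : T -> R) : measurable_fun setT g ->
  (forall x, 0 <= g x)%R ->
  \int[mu]_x (g x)%:E = \int[m]_x (g x * rho x)%:E.
Proof.
move=> mg g0; have mEg : measurable_fun setT (EFin \o g) by exact/measurable_EFinP.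
pose f_ := nnsfun_approx measurableT mEg.
have cf x : (f_ n x)%:E @[n --> \oo] --> (g x)%:E.
  by apply: (cvg_nnsfun_approx measurableT mEg) => //= y _; rewrite lee_fin.
have nd x : {homo (fun n => f_ n x) : i j / (i <= j)%N >-> (i <= j)%R}.
  by move=> i j ij; exact/lefP/nd_nnsfun_approx.
transitivity (limn (fun n => \int[mu]_x (f_ n x)%:E)).
  rewrite -monotone_convergence//=.
  - by apply: eq_integral => x _; apply/esym/cvg_lim => //; exact: cf.
  - by move=> n; exact/measurable_EFinP.
  - by move=> n x _; rewrite lee_fin.
  - by move=> x _ i j ij; rewrite lee_fin nd.
under eq_fun do rewrite nnsfun_density.
rewrite -monotone_convergence//=.
- apply: eq_integral => x _; apply/cvg_lim => //.
  under eq_fun do rewrite EFinM; rewrite EFinM.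
  by apply: cvgeZr => //; exact: cf.
- by move=> n; apply/measurable_EFinP; exact: measurable_funM.
- by move=> n x _; rewrite lee_fin mulr_ge0.
- by move=> x _ i j ij; rewrite lee_fin ler_wpM2r// nd.
Qed.

End change_of_density.

Section transfer.
Local Open Scope ereal_scope.

Lemma real_integralE d (T : measurableType d) (R : realType)
    (m : {measure set T -> \bar R}) (g : T -> R) :
  \int[m]_x (g x)%:E =
  \int[m]_x (Num.max (g x) 0)%:E - \int[m]_x (Num.max (- g x) 0)%:E.
Proof.
rewrite integralE; congr (_ - _); apply: eq_integral => x _.
  by rewrite funeposE EFin_max.
by rewrite funenegE -EFinN EFin_max.
Qed.

Lemma integral_mono d (T : measurableType d) (R : realType)
    (m : {measure set T -> \bar R}) (f g : T -> R) :
  measurable_fun setT f -> measurable_fun setT g -> (forall x, f x <= g x)%R ->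
  \int[m]_x (f x)%:E <= \int[m]_x (g x)%:E.
Proof.
move=> mf mg fg; rewrite [leLHS]real_integralE [leRHS]real_integralE.
apply: leeB; apply: integral_le_ge0.
- by move=> x; rewrite le_max lexx orbT.
- by move=> x; rewrite ge_max !le_max fg lexx orbT.
- exact: measurable_maxr.
- exact: measurable_maxr.
- by move=> x; rewrite le_max lexx orbT.
- by move=> x; rewrite ge_max !le_max lerN2 fg lexx orbT.
- by apply: measurable_maxr => //; exact: measurable_funN.
- by apply: measurable_maxr => //; exact: measurable_funN.
Qed.

(** The integral of a real function is the difference of those of its positive
and negative parts, and each of the two transfers. *)
Lemma integral_density_real d (T : measurableType d) (R : realType)
    (m mu : {measure set T -> \bar R}) (rho : T -> R) :
  measurable_fun setT rho -> (forall x, 0 <= rho x)%R ->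
  (forall A, measurable A -> mu A = \int[m]_(x in A) (rho x)%:E) ->
  forall g : T -> R, measurable_fun setT g ->
  \int[mu]_x (g x)%:E = \int[m]_x (g x * rho x)%:E.
Proof.
move=> mrho rho0 muE g mg; rewrite [LHS]real_integralE [RHS]real_integralE.
have pos (h : T -> R) x : (Num.max (h x) 0 * rho x = Num.max (h x * rho x) 0)%R.
  by rewrite maxr_pMl// mul0r.
have posE (h : T -> R) : measurable_fun setT h ->
    \int[mu]_x (Num.max (h x) 0)%:E = \int[m]_x (Num.max (h x * rho x) 0)%:E.
  move=> mh; rewrite (integral_density (rho := rho) mrho rho0 muE).
  - by apply: eq_integral => x _; rewrite pos.
  - exact: measurable_maxr.
  - by move=> x; rewrite le_max lexx orbT.
congr (_ - _); first exact: posE.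
rewrite (posE (fun x => - g x)%R); last exact: measurable_funN.
by apply: eq_integral => x _; rewrite mulNr.
Qed.

Lemma integral_transfer d1 d2 (S : measurableType d1) (T : measurableType d2)
    (R : realType) (p : {measure set S -> \bar R}) (mu : {measure set T -> \bar R})
    (h : S -> T) : measurable_fun setT h ->
  (forall A, measurable A -> p (h @^-1` A) = mu A) ->
  forall g : T -> R, measurable_fun setT g ->
  \int[p]_z (g (h z))%:E = \int[mu]_x (g x)%:E.
Proof.
move=> mh pmu g mg; rewrite [LHS]real_integralE [RHS]real_integralE.
have posE (k : T -> R) : measurable_fun setT k ->
    \int[p]_z (Num.max (k (h z)) 0)%:E = \int[mu]_x (Num.max (k x) 0)%:E.
  move=> mk; have mk0 : measurable_fun setT (fun x => Num.max (k x) 0)%R.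
    exact: measurable_maxr.
  transitivity (\int[pushforward p h]_x (Num.max (k x) 0)%:E).
    rewrite ge0_integral_pushforward//; first exact/measurable_EFinP.
    by move=> x _; rewrite lee_fin le_max lexx orbT.
  by apply: eq_measure_integral => A mA _; exact: pmu.
congr (_ - _); first exact: posE.
by apply: (posE (fun x => - g x)%R); exact: measurable_funN.
Qed.

Lemma integrable_transfer d1 d2 (S : measurableType d1) (T : measurableType d2)
    (R : realType) (p : {measure set S -> \bar R}) (mu : {measure set T -> \bar R})
    (h : S -> T) : measurable_fun setT h ->
  (forall A, measurable A -> p (h @^-1` A) = mu A) ->
  forall g : T -> R, measurable_fun setT g ->
  mu.-integrable setT (EFin \o g) -> p.-integrable setT (fun z => (g (h z))%:E).
Proof.
move=> mh pmu g mg /integrableP[_ gi]; apply/integrableP; split.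
  by apply/measurable_EFinP; exact: measurableT_comp.
have mabs : measurable_fun setT (fun x => `|g x|)%R by exact: measurableT_comp.
by rewrite (integral_transfer mh pmu mabs).
Qed.

End transfer.

(** * Entropy as a supremum of affine functionals *)

Section gibbs.
Context {d : measure_display} {R : realType}
  {X : completeMetricMeasurableType d R}
  (m : {sigma_finite_measure set X -> \bar R})
  (mmX : is_metric_measure_space m).
Local Open Scope ereal_scope.

(** The graph of [r ln r] lies above its tangent at [s]. *)
Lemma mulr_ln_tangent (r s : R) : (0 <= r)%R -> (0 < s)%R ->
  (r * ln s + (r - s) <= r * ln r)%R.
Proof.
rewrite le_eqVlt => /predU1P[<-|r0] s0; first by rewrite !mul0r; lra.
have E : (s / r = 1 + (s / r - 1))%R by ring.
have := @le_ln1Dx R (s / r - 1)%R; rewrite -E ltrBrDr addrC subrr divr_gt0//.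
move=> /(_ isT); rewrite ln_div ?posrE// => h.
have : (r * (ln s - ln r) <= r * (s / r - 1))%R by rewrite ler_wpM2l// ltW.
have -> : (r * (s / r - 1) = s - r)%R by field; rewrite gt_eqF.
by rewrite mulrBr; lra.
Qed.

Lemma mdist_measurable1 (x0 : X) : measurable_fun setT (fun x : X => mdist x0 x).
Proof.
under eq_fun do rewrite metric_sym.
apply: (continuous_measurable (mms_borel mmX)).
exact: mdist_continuous.
Qed.

Lemma probability_integral1 (sigma : probability X R) :
  \int[sigma]_x (1 : R)%:E = 1.
Proof. by rewrite integral_cst// mul1e; exact: probability_setT. Qed.

Lemma P2_integrable (sigma : probability X R) (x0 : X) : P2 sigma ->
  \int[sigma]_x (mdist x0 x ^+ 2)%:E < +oo.
Proof.
move=> [x1 h1].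
have e1 := integral_eq_fine (fun x => sqr_ge0 (mdist x1 x)) (lexx _) h1.
apply: le_lt_trans (ltry (2 * fine (\int[sigma]_x (mdist x1 x ^+ 2)%:E) +
   2 * mdist x0 x1 ^+ 2 * 1)%R).
apply: (integral_le_lin (f := fun x => (mdist x1 x ^+ 2)%R) (g := cst 1%R)) => //.
- by rewrite mulr_ge0// sqr_ge0.
- by move=> x; exact: sqr_ge0.
- by move=> x; exact: sqr_ge0.
- by apply: measurable_funX; exact: mdist_measurable1.
- by apply: measurable_funX; exact: mdist_measurable1.
- apply: nearW => x; rewrite mulr1.
  have h := metric_triangle x0 x1 x; have h' := mdist_ge0 x0 x.
  have : (mdist x0 x ^+ 2 <= (mdist x0 x1 + mdist x1 x) ^+ 2)%R.
    by rewrite ler_pXn2r ?nnegrE// addr_ge0 ?mdist_ge0.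
  by have := sqr_ge0 (mdist x0 x1 - mdist x1 x)%R; nra.
- by rewrite -e1.
- by rewrite -[leLHS]/(\int[sigma]_x (1 : R)%:E) probability_integral1.
Qed.

Context (rho : X -> R) (x0 : X) (C : R).
Context (mrho : measurable_fun setT rho) (rho0 : forall x, (0 < rho x)%R)
  (rho1 : \int[m]_x (rho x)%:E = 1)
  (rhoC : forall x, (`|ln (rho x)| <= C * (1 + mdist x0 x ^+ 2))%R).

Lemma ln_density_measurable : measurable_fun setT (fun x => ln (rho x)).
Proof. exact: measurableT_comp (@measurable_ln R) mrho. Qed.

Lemma ln_density_integrable (sigma : probability X R) : P2 sigma ->
  sigma.-integrable setT (fun x => (ln (rho x))%:E).
Proof.
move=> s2; apply/integrableP; split.
  by apply/measurable_EFinP; exact: ln_density_measurable.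
have e1 := integral_eq_fine (fun x => sqr_ge0 (mdist x0 x)) (lexx _) (P2_integrable x0 s2).
have C0 : (0 <= C)%R.
  have := le_trans (normr_ge0 _) (rhoC x0).
  by rewrite mdistxx expr0n addr0 mulr1.
apply: le_lt_trans (ltry (C * fine (\int[sigma]_x (mdist x0 x ^+ 2)%:E) + C * 1)%R).
apply: (integral_le_lin (h := fun x => `|ln (rho x)|%R)
  (f := fun x => (mdist x0 x ^+ 2)%R) (g := cst 1%R)) => //.
- by move=> x; exact: sqr_ge0.
- by apply: measurableT_comp => //; exact: ln_density_measurable.
- by apply: measurable_funX; exact: mdist_measurable1.
- by apply: nearW => x /=; apply: (le_trans (rhoC x)); lra.
- by rewrite -e1.
- by rewrite -[leLHS]/(\int[sigma]_x (1 : R)%:E) probability_integral1.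
Qed.

(** Convexity of the entropy integrand, in the form of Gibbs' inequality: the
tangent at the fixed positive density bounds every entropy from below. *)
Lemma gibbs (sigma : probability X R) : P2 sigma ->
  \int[sigma]_x (ln (rho x))%:E <= entropy m sigma.
Proof.
move=> s2; apply: le_ereal_inf_tmp => _ [r [mr r0 sr _] <-].
have mphi := ln_density_measurable.
have sr1 : \int[m]_x (r x)%:E = 1 by rewrite -sr//; exact: probability_setT.
have ir : m.-integrable setT (EFin \o r) by apply: ge0_integrable; rewrite // sr1 ltry.
have irho : m.-integrable setT (EFin \o rho).
  by apply: ge0_integrable => //; [move=> x; exact: ltW|rewrite rho1 ltry].
have [_ iphi] := integrableP _ _ _ (ln_density_integrable s2).
have irphi : m.-integrable setT (EFin \o (fun x => ln (rho x) * r x)%R).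
  apply/integrableP; split; first by apply/measurable_EFinP; exact: measurable_funM.
  move: iphi; under eq_integral do rewrite abse_EFin.
  rewrite (integral_density (rho := r) mr r0 sr); last 2 first.
  - exact: measurableT_comp.
  - by move=> x; exact: normr_ge0.
  apply: le_lt_trans; rewrite le_eqVlt; apply/orP; left; apply/eqP.
  by apply: eq_integral => x _ /=; rewrite normrM (ger0_norm (r0 x)).
rewrite (integral_density_real mr r0 sr mphi).
have -> : \int[m]_x (ln (rho x) * r x)%:E =
    \int[m]_x (ln (rho x) * r x + (r x - rho x))%:E.
  under [RHS]eq_integral do rewrite EFinD.
  have idiff : m.-integrable setT (fun x => (r x - rho x)%:E).
    by under eq_fun do rewrite EFinB; exact: integrableB.
  rewrite integralD//.
  under [X in _ = _ + X]eq_integral do rewrite EFinB.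
  by rewrite integralB// sr1 rho1 subee// adde0.
apply: integral_mono.
- apply: measurable_funD; first exact: measurable_funM.
  exact: measurable_funB.
- by apply: measurable_funM => //; exact: measurableT_comp (@measurable_ln R) mr.
- by move=> x; rewrite [X in (X + _)%R]mulrC; exact: mulr_ln_tangent.
Qed.

Context (mu : probability X R)
  (muE : forall A, measurable A -> mu A = \int[m]_(x in A) (rho x)%:E)
  (mu2 : P2 mu).

(** Equality in Gibbs' inequality for the probability with the given density. *)
Lemma entropy_density : entropy m mu = \int[mu]_x (ln (rho x))%:E.
Proof.
have rho0' x : (0 <= rho x)%R by exact: ltW.
apply/eqP; rewrite eq_le; apply/andP; split; last exact: gibbs.
rewrite (integral_density_real mrho rho0' muE ln_density_measurable).
apply: ereal_inf_lbound; exists rho; last first.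
  by apply: eq_integral => x _; rewrite mulrC.
split => //.
have [_ iphi] := integrableP _ _ _ (ln_density_integrable mu2).
apply: integrable_funeneg => //; apply/integrableP; split.
  by apply/measurable_EFinP; apply: measurable_funM => //; exact: ln_density_measurable.
move: iphi; under eq_integral do rewrite abse_EFin.
rewrite (integral_density mrho rho0' muE); last 2 first.
- by apply: measurableT_comp => //; exact: ln_density_measurable.
- by move=> x; exact: normr_ge0.
apply: le_lt_trans; rewrite le_eqVlt; apply/orP; left; apply/eqP.
by apply: eq_integral => x _ /=; rewrite normrM mulrC (ger0_norm (rho0' x)).
Qed.

End gibbs.

(** * The transport inequality between entropy, distance and slope *)

Section wasserstein.
Context {d : measure_display} {R : realType}
  {X : completeMetricMeasurableType d R}.
Local Open Scope ereal_scope.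
Implicit Types mu nu : probability X R.

Lemma W2_eq_measures mu mu' nu nu' : measure_eq mu mu' -> measure_eq nu nu' ->
  W2 mu nu = W2 mu' nu'.
Proof.
move=> hm hn; rewrite /W2; suff -> : coupling mu nu = coupling mu' nu' by [].
apply/seteqP; split => p cp A mA; have [h1 h2] := cp A mA.
  by rewrite h1 h2; split; [exact: hm|exact: hn].
by rewrite h1 h2; split; apply/esym; [exact: hm|exact: hn].
Qed.

Lemma W2_inf mu nu (w : R) : W2 mu nu = w%:E ->
  ereal_inf [set \int[p]_z ((mdist z.1 z.2) ^+ 2)%:E | p in coupling mu nu]
    = (w ^+ 2)%:E.
Proof.
rewrite /W2; have : 0 <= ereal_inf
    [set \int[p]_z ((mdist z.1 z.2) ^+ 2)%:E | p in coupling mu nu].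
  by apply: le_ereal_inf_tmp => _ [p _ <-]; apply: integral_real_ge0 => z; exact: sqr_ge0.
case: (ereal_inf _) => [r| |]//; last by rewrite poweRyr.
rewrite lee_fin => r0; rewrite poweR_EFin powR12_sqrt// => -[<-].
by rewrite sqr_sqrtr.
Qed.

Lemma W2_coupling mu nu (w e : R) : (0 < e)%R -> W2 mu nu = w%:E ->
  exists2 p, coupling mu nu p &
    \int[p]_z ((mdist z.1 z.2) ^+ 2)%:E <= (w ^+ 2 + e)%:E.
Proof.
move=> e0 /W2_inf h; have /ereal_inf_lt[_ [p cp <-] pe] :
    ereal_inf [set \int[p]_z ((mdist z.1 z.2) ^+ 2)%:E | p in coupling mu nu]
      < (w ^+ 2 + e)%:E by rewrite h lte_fin ltrDl.
by exists p => //; exact: ltW.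
Qed.

End wasserstein.

Lemma le0_small_slope (R : realType) (Z B : R) :
  (forall t : R, 0 < t -> t <= 1 -> Z <= t * B) -> Z <= 0.
Proof.
move=> H; rewrite leNgt; apply/negP => Z0.
have B0 : 0 < `|B| + 1 by rewrite ltr_wpDl.
pose t := Num.min 1 (Z / (2 * (`|B| + 1))).
have t0 : 0 < t by rewrite lt_min ltr01 divr_gt0// mulr_gt0.
have t1 : t <= 1 by rewrite ge_min lexx.
have tB : t * (2 * (`|B| + 1)) <= Z.
  by rewrite -ler_pdivlMr ?mulr_gt0// /t ge_min lexx orbT.
have := H t t0 t1; apply/negP; rewrite -ltNge; clearbody t.
have : t * B <= t * (`|B| + 1).
  by rewrite ler_wpM2l ?(ltW t0)// (le_trans (ler_norm B))// lerDl.
by move=> h; apply: (le_lt_trans h); lra.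
Qed.

Section hwi.
Context {d : measure_display} {R : realType}
  {X : completeMetricMeasurableType d R}
  (m : {sigma_finite_measure set X -> \bar R})
  (mmX : is_metric_measure_space m).
Local Open Scope ereal_scope.
Context (rho : X -> R) (x0 : X) (L : R).
Context (mrho : measurable_fun setT rho) (rho0 : forall x, (0 < rho x)%R)
  (rho1 : \int[m]_x (rho x)%:E = 1)
  (rhoL : forall x y, (`|ln (rho x) - ln (rho y)| <=
     L * (1 + mdist x0 x) * mdist x y + L * mdist x y ^+ 2)%R) (L0 : (0 <= L)%R).

Lemma ln_density_growth x :
  (`|ln (rho x)| <= (`|ln (rho x0)| + 2 * L) * (1 + mdist x0 x ^+ 2))%R.
Proof.
have h := rhoL x0 x; rewrite mdistxx addr0 mulr1 in h.
have h' := ler_normB (ln (rho x0)) (ln (rho x0) - ln (rho x))%R.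
rewrite opprB addrC subrK in h'; apply: (le_trans h'); rewrite mulrDl; apply: lerD.
  by rewrite ler_peMr// lerDl sqr_ge0.
apply: (le_trans h); have := sqr_ge0 (1 - mdist x0 x)%R.
move: (mdist x0 x) (mdist_ge0 x0 x) => t t0 ht; have L0' := L0.
have : (0 <= L * (2 + 2 * t ^+ 2 - t - t ^+ 2))%R by rewrite mulr_ge0//; nra.
by move=> hh; lra.
Qed.

Lemma slope_ln_density_le x :
  slope (fun y => ln (rho y)) x <= (L * (2 + mdist x0 x))%:E.
Proof.
have d0 := mdist_ge0 x0 x.
apply/slope_leP => [|e e0]; first by rewrite mulr_ge0// addr_ge0.
exists 1%R => // y xy; rewrite distrC (le_trans (rhoL x y))//.
rewrite (_ : (L * (1 + mdist x0 x) * mdist x y + L * mdist x y ^+ 2 =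
  (L * (1 + mdist x0 x) + L * mdist x y) * mdist x y)%R); last by ring.
rewrite ler_wpM2r ?mdist_ge0//.
have : (L * mdist x y <= L * 1)%R by rewrite ler_wpM2l// ltW.
by move=> h; lra.
Qed.

Let sl x := fine (slope (fun y => ln (rho y)) x).

Lemma ln_density_continuous : continuous (fun y => ln (rho y)).
Proof.
apply: slope_bounded_continuous => x; exists (L * (2 + mdist x0 x))%R.
exact: slope_ln_density_le.
Qed.

(** Nearby increments are controlled by the difference quotients at small
scale; far increments are quadratic in the distance, except where the base
point is far out, where the growth of the density takes over. *)
Definition scale_slope (n : nat) (x : X) : R :=
  (fine (quotient_sup (fun y => ln (rho y)) n.+1%:R^-1 x) +
   L * (1 + mdist x0 x) * \1_[set x | (n%:R < mdist x0 x)%R] x)%R.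

Lemma quotient_sup_density_le n x :
  quotient_sup (fun y => ln (rho y)) n.+1%:R^-1 x <= (L * (2 + mdist x0 x))%:E.
Proof.
apply: quotient_sup_le => [|y yn]; first by rewrite mulr_ge0// addr_ge0 ?mdist_ge0.
rewrite distrC (le_trans (rhoL x y))//.
rewrite (_ : (L * (1 + mdist x0 x) * mdist x y + L * mdist x y ^+ 2 =
  (L * (1 + mdist x0 x) + L * mdist x y) * mdist x y)%R); last by ring.
rewrite ler_wpM2r ?mdist_ge0//.
have : (L * mdist x y <= L * 1)%R.
  by rewrite ler_wpM2l// (le_trans (ltW yn))// invf_le1// ler1n.
by move=> h; lra.
Qed.

Lemma quotient_sup_density_fin n x :
  quotient_sup (fun y => ln (rho y)) n.+1%:R^-1 x =
  (fine (quotient_sup (fun y => ln (rho y)) n.+1%:R^-1 x))%:E.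
Proof.
rewrite fineK// ge0_fin_numE ?quotient_sup_ge0//.
exact: le_lt_trans (quotient_sup_density_le n x) (ltry _).
Qed.

Lemma scale_slope_ge0 n x : (0 <= scale_slope n x)%R.
Proof.
rewrite addr_ge0//; first by apply: fine_ge0; exact: quotient_sup_ge0.
by rewrite !mulr_ge0// addr_ge0 ?mdist_ge0.
Qed.

Lemma scale_slope_le n x : (scale_slope n x <= L * (2 + mdist x0 x) * 2)%R.
Proof.
rewrite mulr_natr mulr2n; apply: lerD.
  by rewrite -lee_fin -quotient_sup_density_fin; exact: quotient_sup_density_le.
have d0 := mdist_ge0 x0 x.
apply: (@le_trans _ _ (L * (1 + mdist x0 x) * 1)%R).
  apply: ler_wpM2l; first by rewrite mulr_ge0// addr_ge0.
  by rewrite indicE lern1 leq_b1.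
by rewrite mulr1 ler_wpM2l// lerD2r ler1n.
Qed.

(** For a far increment the factor [n.+1 * mdist x y] is at least one and pays
for the linear term near [x0]; far out that term is part of [scale_slope]. *)
Lemma scale_slope_bound n x y : (`|ln (rho x) - ln (rho y)| <=
  scale_slope n x * mdist x y + (L * (1 + n%:R) * n.+1%:R + L) * mdist x y ^+ 2)%R.
Proof.
have d0 := mdist_ge0 x0 x; have e0 := mdist_ge0 x y.
have C0 : (0 <= L * (1 + n%:R) * n.+1%:R + L)%R.
  by rewrite addr_ge0// !mulr_ge0// addr_ge0.
have F0 : (0 <= fine (quotient_sup (fun y => ln (rho y)) n.+1%:R^-1 x))%R.
  by apply: fine_ge0; exact: quotient_sup_ge0.
have [yn|ny] := ltP (mdist x y) (n.+1%:R^-1)%R.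
  have := quotient_supP (fun y => ln (rho y)) yn.
  rewrite quotient_sup_density_fin -EFinM lee_fin distrC => h.
  apply: (le_trans h); rewrite /scale_slope mulrDl -addrA lerDl addr_ge0//.
    by rewrite !mulr_ge0// addr_ge0.
  by rewrite mulr_ge0// sqr_ge0.
apply: (le_trans (rhoL x y)); rewrite /scale_slope indicE.
have [nd|dn] := ltP (n%:R)%R (mdist x0 x).
  rewrite mem_set//= mulr1 mulrDl -addrA.
  rewrite (_ : (_ * mdist x y + L * mdist x y ^+ 2)%R =
    (0 + (L * (1 + mdist x0 x) * mdist x y + L * mdist x y ^+ 2))%R); last by rewrite add0r.
  apply: lerD; first exact: mulr_ge0.
  by rewrite lerD2l ler_wpM2r ?sqr_ge0// lerDr !mulr_ge0// addr_ge0.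
rewrite memNset/=; last by apply/negP; rewrite -leNgt.
rewrite mulr0 addr0 mulrDl addrA lerD2r.
apply: (@le_trans _ _ (L * (1 + n%:R) * n.+1%:R * mdist x y ^+ 2)%R); last first.
  by rewrite lerDr mulr_ge0.
rewrite -[X in (_ <= X)%R]mulrA; apply: ler_pM => //.
- by rewrite mulr_ge0// addr_ge0.
- by rewrite ler_wpM2l// lerD2l.
- by rewrite expr2 mulrA ler_peMl// -ler_pdivrMl// mulr1.
Qed.

Lemma scale_slope_measurable n : measurable_fun setT (scale_slope n).
Proof.
have borelX := mms_borel mmX.
have cd : continuous (fun x : X => mdist x0 x).
  have -> : (fun x : X => mdist x0 x) = (fun x : X => mdist x x0).
    by apply/funext => x; rewrite metric_sym.
  exact: mdist_continuous.
apply: measurable_funD.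
  have := quotient_sup_measurable borelX n.+1%:R^-1 ln_density_continuous.
  exact: measurableT_comp (fine_measurable measurableT).
apply: measurable_funM; last first.
  apply: measurable_indic; apply: (superlevel_measurable mmX _ cd).
by apply: measurable_funM => //; apply: measurable_funD => //;
  exact: (mdist_measurable1 mmX).
Qed.

Lemma cvg_scale_slope x : (scale_slope n x)%:E @[n --> \oo] -->
  slope (fun y => ln (rho y)) x.
Proof.
have E n : (scale_slope n x)%:E =
    quotient_sup (fun y => ln (rho y)) n.+1%:R^-1 x +
    (L * (1 + mdist x0 x) * \1_[set x | (n%:R < mdist x0 x)%R] x)%:E.
  by rewrite quotient_sup_density_fin -EFinD.
under eq_fun do rewrite E.
rewrite -(adde0 (slope _ x)); apply: cvgeD.
- by rewrite fin_num_adde_defl.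
- exact: cvg_quotient_sup.
apply: cvg_near_cst; have [n dn] : exists n, (mdist x0 x <= n%:R)%R.
  by exists (Num.bound (mdist x0 x)); rewrite ltW// archi_boundP// mdist_ge0.
exists n => // k /= nk; rewrite indicE memNset ?mulr0//=.
by apply/negP; rewrite -leNgt (le_trans dn)// ler_nat.
Qed.

End hwi.

Section hwi_inequality.
Context {d : measure_display} {R : realType}
  {X : completeMetricMeasurableType d R}
  (m : {sigma_finite_measure set X -> \bar R})
  (mmX : is_metric_measure_space m).
Local Open Scope ereal_scope.
Context (rho : X -> R) (x0 : X) (L : R).
Context (mrho : measurable_fun setT rho) (rho0 : forall x, (0 < rho x)%R)
  (rho1 : \int[m]_x (rho x)%:E = 1)
  (rhoL : forall x y, (`|ln (rho x) - ln (rho y)| <=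
     L * (1 + mdist x0 x) * mdist x y + L * mdist x y ^+ 2)%R) (L0 : (0 <= L)%R).
Context (mu : probability X R)
  (muE : forall A, measurable A -> mu A = \int[m]_(x in A) (rho x)%:E)
  (mu2 : P2 mu).

Let sl x := fine (slope (fun y => ln (rho y)) x).
Let H n x := scale_slope rho x0 L n x.

(** Dominated convergence: the majorant is quadratic in the distance, and the
measure has finite second moment. *)
Lemma cvg_integral_scale_slope :
  \int[mu]_x (H n x ^+ 2)%:E @[n --> \oo] --> \int[mu]_x (sl x ^+ 2)%:E.
Proof.
have slE x : slope (fun y => ln (rho y)) x = (sl x)%:E.
  exact: slope_real (slope_ln_density_le rhoL L0 x).
have md := mdist_measurable1 mmX x0.
have mH n : measurable_fun setT (fun x => H n x ^+ 2)%R.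
  by apply: measurable_funX; exact: (scale_slope_measurable mmX rhoL L0).
have [] // := @dominated_convergence _ _ _ mu setT measurableT
  (fun n x => (H n x ^+ 2)%:E) (fun x => (sl x ^+ 2)%:E)
  (fun x => ((L * (2 + mdist x0 x) * 2) ^+ 2)%:E) _ _ _ _ _.
- by move=> n; apply/measurable_EFinP; exact: mH.
- apply/measurable_EFinP; apply: (measurable_funX 2).
  have := slope_measurable (mms_borel mmX) (ln_density_continuous rhoL L0).
  exact: measurableT_comp (fine_measurable measurableT).
- apply: nearW => x _; rewrite EFin_expe; under eq_fun do rewrite EFin_expe.
  rewrite !expe2; under eq_fun do rewrite expe2.
  have c : (H n x)%:E @[n --> \oo] --> (sl x)%:E.
    by rewrite -slE; exact: cvg_scale_slope.
  by apply: cvgeM => //.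
- apply: ge0_integrable.
  + by apply: measurable_funX; apply: measurable_funM => //; apply: measurable_funM => //;
      exact: measurable_funD.
  + by move=> x; exact: sqr_ge0.
  have e1 := integral_eq_fine (fun x => sqr_ge0 (mdist x0 x)) (lexx _)
    (P2_integrable mmX x0 mu2).
  apply: le_lt_trans (ltry (8 * L ^+ 2 * fine (\int[mu]_x (mdist x0 x ^+ 2)%:E) +
    32 * L ^+ 2 * 1)%R).
  apply: (integral_le_lin (f := fun x => (mdist x0 x ^+ 2)%R) (g := cst 1%R)) => //.
  + by rewrite mulr_ge0// sqr_ge0.
  + by rewrite mulr_ge0// sqr_ge0.
  + by move=> x; exact: sqr_ge0.
  + by move=> x; exact: sqr_ge0.
  + by apply: measurable_funX; apply: measurable_funM => //; apply: measurable_funM => //;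
      exact: measurable_funD.
  + exact: measurable_funX.
  + apply: nearW => x /=.
    have : (0 <= L ^+ 2 * (2 - mdist x0 x) ^+ 2)%R by rewrite mulr_ge0// sqr_ge0.
    by nra.
  + by rewrite -e1.
  + by rewrite -[leLHS]/(\int[mu]_x (1 : R)%:E) probability_integral1.
- apply: nearW => x n _; rewrite abse_EFin lee_fin ger0_norm ?sqr_ge0//.
  rewrite ler_pXn2r ?nnegrE ?scale_slope_ge0//; first exact: scale_slope_le.
  by rewrite !mulr_ge0// addr_ge0// mdist_ge0.
Qed.

(** Integrating the increment bound along the coupling and splitting its product
term by Young's inequality with weight [t], which is of the order of the
transport distance when [sigma] is at time [t] of a geodesic. *)
Lemma transport_increment (sigma : probability X R) (p : probability (X * X)%type R)
    (n : nat) (t A e cost : R) : P2 sigma -> coupling mu sigma p -> (0 < t)%R ->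
  \int[mu]_x (H n x ^+ 2)%:E = A%:E ->
  \int[p]_z ((mdist z.1 z.2) ^+ 2)%:E <= cost%:E ->
  \int[mu]_x (ln (rho x))%:E = e%:E ->
  e%:E <= \int[sigma]_x (ln (rho x))%:E +
    (t / 2 * A + ((2 * t)^-1 + (L * (1 + n%:R) * n.+1%:R + L)) * cost)%:E.
Proof.
move=> s2 cp t0 AE pc eE; pose C := (L * (1 + n%:R) * n.+1%:R + L)%R.
have C0 : (0 <= C)%R by rewrite addr_ge0// !mulr_ge0// addr_ge0.
have rhoC := ln_density_growth rhoL L0.
have mphi := ln_density_measurable mrho.
have mf1 := @measurable_fst _ _ X X; have mf2 := @measurable_snd _ _ X X.
have p1 B : measurable B -> p (fst @^-1` B) = mu B.
  move=> mB; have [<- _] := cp _ mB; congr (p _).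
  by apply/seteqP; split => z /= => [|[]].
have p2 B : measurable B -> p (snd @^-1` B) = sigma B.
  move=> mB; have [_ <-] := cp _ mB; congr (p _).
  by apply/seteqP; split => z /= => [|[]].
have i2 := integrable_transfer mf2 p2 mphi (ln_density_integrable mmX mrho rhoC s2).
have I1 := integral_transfer mf1 p1 mphi; have I2 := integral_transfer mf2 p2 mphi.
have mH : measurable_fun setT (fun x => H n x ^+ 2)%R.
  by apply: measurable_funX; exact: (scale_slope_measurable mmX rhoL L0).
have mHp : measurable_fun setT (fun z : X * X => H n z.1 ^+ 2)%R.
  exact: measurableT_comp mH mf1.
have IH := integral_transfer mf1 p1 mH.
have mdp : measurable_fun setT (fun z : X * X => mdist z.1 z.2 ^+ 2)%R.
  by apply: measurable_funX; exact: mdist_measurable (mms_borel mmX) (mms_separable mmX).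
pose g (z : X * X) := (t / 2 * H n z.1 ^+ 2 + ((2 * t)^-1 + C) * mdist z.1 z.2 ^+ 2)%R.
have K0 : (0 <= (2 * t)^-1 + C)%R by rewrite addr_ge0// invr_ge0 mulr_ge0// ltW.
have t20 : (0 <= t / 2)%R by rewrite divr_ge0// ltW.
have g0 z : (0 <= g z)%R by rewrite addr_ge0// mulr_ge0// sqr_ge0.
have mg : measurable_fun setT g.
  by apply: measurable_funD; exact: measurable_funM.
have gle : \int[p]_z (g z)%:E <= (t / 2 * A + ((2 * t)^-1 + C) * cost)%:E.
  apply: (integral_le_lin (f := fun z : X * X => (H n z.1 ^+ 2)%R)
    (g := fun z : X * X => (mdist z.1 z.2 ^+ 2)%R)) => //.
  - by move=> z; exact: sqr_ge0.
  - by move=> z; exact: sqr_ge0.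
  - exact: nearW.
  - by rewrite IH AE.
have ig : p.-integrable setT (EFin \o g).
  by apply: ge0_integrable => //; apply: le_lt_trans gle (ltry _).
rewrite -eE -I1 -I2; apply: le_trans (leeD2l _ gle).
rewrite -integralD//; under [leRHS]eq_integral do rewrite -EFinD.
apply: integral_mono.
- exact: measurableT_comp mphi mf1.
- by apply: measurable_funD => //; exact: measurableT_comp mphi mf2.
move=> z; rewrite -lerBlDl.
apply: (le_trans (ler_norm _)); apply: (le_trans (scale_slope_bound rhoL L0 n z.1 z.2)).
rewrite -/(H n z.1) -/C /g [X in (_ <= _ + X)%R]mulrDl addrA lerD2r.
have h0 : (0 <= (t * H n z.1 - mdist z.1 z.2) ^+ 2 / (2 * t))%R.
  by rewrite divr_ge0 ?sqr_ge0// mulr_ge0// ltW.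
rewrite -subr_ge0; move: h0.
by rewrite (_ : ((t * H n z.1 - mdist z.1 z.2) ^+ 2 / (2 * t) =
  t / 2 * H n z.1 ^+ 2 + (2 * t)^-1 * mdist z.1 z.2 ^+ 2 -
  H n z.1 * mdist z.1 z.2)%R)//; field; rewrite gt_eqF.
Qed.

(** The HWI inequality, with the product of distance and slope split by Young's
inequality.  Along the geodesic, convexity bounds the entropy at time [t] from
above, and Gibbs' inequality bounds it from below by the integral of [ln rho],
whose increment from time [0] is controlled by the slope; divide by [t] and let
it tend to [0]. *)
Lemma hwi (nu : probability X R) (K om emu enu I : R) : CD m K ->
  entropy_domain m nu -> (0 <= om)%R -> W2 mu nu = om%:E ->
  \int[mu]_x (ln (rho x))%:E = emu%:E -> entropy m nu = enu%:E ->
  \int[mu]_x (sl x ^+ 2)%:E <= I%:E ->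
  (emu - enu + K / 2 * om ^+ 2 <= I / 2 + om ^+ 2 / 2)%R.
Proof.
move=> cd nuD om0 W emuE enuE slI.
have rhoC := ln_density_growth rhoL L0.
have Emu : entropy m mu = emu%:E.
  by rewrite (entropy_density mmX mrho rho0 rho1 rhoC muE mu2).
have muD : entropy_domain m mu by split => //; rewrite Emu.
have [mt [mt0 mt1 [mtP mtW] mtE]] := cd _ _ muD nuD.
have W01 : W2 (mt 0%R) (mt 1%R) = om%:E by rewrite (W2_eq_measures mt0 mt1).
have I0 : (0 <= I)%R.
  by rewrite -lee_fin; apply: le_trans slI; apply: integral_real_ge0 => x; exact: sqr_ge0.
(* the scale n is fixed here, before the time t tends to 0 *)
have scale e : (0 < e)%R -> exists n (A : R), (A <= I + e)%R /\
    \int[mu]_x (H n x ^+ 2)%:E = A%:E.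
  move=> e0; have [n nE] : exists n, \int[mu]_x (H n x ^+ 2)%:E <= (I + e)%:E.
    have lt : \int[mu]_x (sl x ^+ 2)%:E < (I + e)%:E.
      by apply: (le_lt_trans slI); rewrite lte_fin ltrDl.
    have [n _ h] : \forall n \near \oo, \int[mu]_x (H n x ^+ 2)%:E < (I + e)%:E.
      apply: (cvg_integral_scale_slope (_ : nbhs _ [set y | y < (I + e)%:E])).
      by apply: open_nbhs_nbhs; split; [exact: open_ereal_lt_ereal|].
    by exists n; apply/ltW/h => /=.
  exists n; have [A [AE _ AI]] := integral_real (fun x => sqr_ge0 (H n x)) nE.
  by exists A.
apply/ler_addgt0Pr => e e0; have [n [A [AI AE]]] := scale e e0.
pose C := (L * (1 + n%:R) * n.+1%:R + L)%R.
have C0 : (0 <= C)%R by rewrite addr_ge0// !mulr_ge0// addr_ge0.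
pose Z := (emu - enu + K / 2 * om ^+ 2 - (A / 2 + om ^+ 2 / 2))%R.
suff : (Z <= 0)%R by rewrite /Z; move: (om ^+ 2)%R => o h; lra.
apply: (@le0_small_slope _ _ (K / 2 * om ^+ 2 + C * om ^+ 2)%R) => t t_gt0 t1.
have t0 := ltW t_gt0.
have t01 : (0 <= t <= 1)%R by rewrite t0.
have Wt : W2 mu (mt t) = (t * om)%:E.
  have h1 : measure_eq mu (mt 0%R) by move=> B mB; rewrite mt0.
  have h2 : measure_eq (mt t) (mt t) by [].
  rewrite (W2_eq_measures h1 h2) mtW ?lexx ?ler01// W01 subr0 ger0_norm//.
have key eta : (0 < eta)%R -> (emu - ((1 - t) * emu + t * enu -
    K / 2 * t * (1 - t) * om ^+ 2) <=
    t / 2 * A + ((2 * t)^-1 + C) * ((t * om) ^+ 2 + eta))%R.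
  move=> eta0; have [p cp pc] := W2_coupling eta0 Wt.
  have := transport_increment (mtP _ t01) cp t_gt0 AE pc emuE.
  have := le_trans (gibbs mmX mrho rho0 rho1 rhoC (mtP _ t01)) (mtE t t01).
  rewrite Emu enuE W -EFin_expe -!EFinM => h0 h2.
  have h1 : \int[mt t]_x (ln (rho x))%:E <= ((1 - t) * emu + t * enu -
      K / 2 * t * (1 - t) * om ^+ 2)%:E by exact: h0.
  rewrite -lee_fin EFinB leeBlDr//.
  apply: (le_trans h2); rewrite addeC.
  by rewrite -/C leeD2l.
have {}key : (emu - ((1 - t) * emu + t * enu - K / 2 * t * (1 - t) * om ^+ 2) <=
    t / 2 * A + ((2 * t)^-1 + C) * (t * om) ^+ 2)%R.
  apply/ler_addgt0Pr => s s0.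
  have D0 : (0 < (2 * t)^-1 + C)%R by rewrite ltr_pwDl// invr_gt0 mulr_gt0.
  have := key (s / ((2 * t)^-1 + C))%R; rewrite divr_gt0// => /(_ isT).
  have E (D a : R) : (0 < D -> D * (a + s / D) = D * a + s)%R.
    by move=> D_gt0; field; rewrite gt_eqF.
  by rewrite (E _ _ D0) addrA.
rewrite -(ler_pM2l t_gt0); move: key; rewrite /Z.
rewrite (_ : (((2 * t)^-1 + C) * (t * om) ^+ 2 = t * om ^+ 2 / 2 + C * t ^+ 2 * om ^+ 2)%R).
  by move=> key; lra.
by field; rewrite gt_eqF.
Qed.

End hwi_inequality.

(** * Displacing a small amount of mass *)

Section displacement.
Context {d : measure_display} {R : realType}
  {X : completeMetricMeasurableType d R}
  (m : {sigma_finite_measure set X -> \bar R})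
  (mmX : is_metric_measure_space m).
Local Open Scope ereal_scope.
Context (rho : X -> R) (C B : set X) (dlt a b D : R).
Context (mrho : measurable_fun setT rho) (rho0 : forall x, (0 <= rho x)%R)
  (mC : measurable C) (mB : measurable B)
  (dlt0 : (0 <= dlt)%R) (dlt1 : (dlt <= 1)%R) (a0 : (0 <= a)%R) (b0 : (0 < b)%R)
  (D0 : (0 <= D)%R)
  (rhoC : \int[m]_x (rho x * \1_C x)%:E = a%:E) (mBb : m B = b%:E)
  (CBD : forall x y, C x -> B y -> (mdist x y <= D)%R).

Definition displaced_density (x : X) : R :=
  (rho x * (1 - dlt * \1_C x) + dlt * a / b * \1_B x)%R.

Lemma remaining_factor_ge0 x : (0 <= 1 - dlt * \1_C x)%R.
Proof.
rewrite subr_ge0 indicE; case: (x \in C); rewrite ?mulr1 ?mulr0//.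
Qed.

Lemma displaced_density_ge0 x : (0 <= displaced_density x)%R.
Proof.
by rewrite addr_ge0// mulr_ge0// ?remaining_factor_ge0// divr_ge0 ?mulr_ge0// ltW.
Qed.

Lemma measurable_remaining : measurable_fun setT (fun x => rho x * (1 - dlt * \1_C x))%R.
Proof.
apply: measurable_funM => //; apply: measurable_funB => //.
by apply: measurable_funM => //; exact: measurable_indic.
Qed.

Lemma displaced_density_measurable : measurable_fun setT displaced_density.
Proof.
apply: measurable_funD; first exact: measurable_remaining.
by apply: measurable_funM => //; exact: measurable_indic.
Qed.

Let mrhoC : measurable_fun setT (fun x => rho x * \1_C x)%R.
Proof. by apply: measurable_funM => //; exact: measurable_indic. Qed.

Let fac0 : (0 <= dlt * a / b)%R.
Proof. by rewrite divr_ge0 ?mulr_ge0// ltW. Qed.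

Lemma integral_remaining (A : set X) : measurable A ->
  \int[m]_x (rho x * (1 - dlt * \1_C x) * \1_A x)%:E +
  dlt%:E * \int[m]_x (rho x * \1_C x * \1_A x)%:E = \int[m]_x (rho x * \1_A x)%:E.
Proof.
move=> mA; have mA' : measurable_fun setT (\1_A : X -> R) by exact: measurable_indic.
rewrite -integralZ_ge0//; last 2 first.
- by move=> x; rewrite !mulr_ge0.
- exact: measurable_funM.
rewrite -integralD_ge0.
- by apply: eq_integral => x _; congr (_%:E); ring.
- by move=> x; rewrite !mulr_ge0 ?remaining_factor_ge0.
- by move=> x; rewrite !mulr_ge0.
- by apply: measurable_funM => //; exact: measurable_remaining.
- by apply: measurable_funM => //; exact: measurable_funM.
Qed.

Context (rho1 : \int[m]_x (rho x)%:E = 1).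

Lemma integral_displaced_density (A : set X) : measurable A ->
  \int[m]_x (displaced_density x * \1_A x)%:E =
  \int[m]_x (rho x * (1 - dlt * \1_C x) * \1_A x)%:E +
  (dlt * a / b)%:E * m (A `&` B).
Proof.
move=> mA; have mA' : measurable_fun setT (\1_A : X -> R) by exact: measurable_indic.
have mAB : measurable (A `&` B) by exact: measurableI.
rewrite -(setIT (A `&` B)) -integral_indic// -integralZ_ge0//.
rewrite -integralD_ge0//.
- apply: eq_integral => x _; congr (_%:E).
  by rewrite /displaced_density indicI /=; ring.
- by move=> x; rewrite !mulr_ge0 ?remaining_factor_ge0.
- by move=> x; rewrite mulr_ge0.
- by apply: measurable_funM => //; exact: measurable_remaining.
- by apply: measurable_funM => //; exact: measurable_indic.
Qed.

Lemma integral_displaced_density1 : \int[m]_x (displaced_density x)%:E = 1.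
Proof.
have := integral_displaced_density measurableT.
have := integral_remaining measurableT.
have T1 (f : X -> R) : \int[m]_x (f x * \1_[set: X] x)%:E = \int[m]_x (f x)%:E.
  by apply: eq_integral => x _; rewrite indicT mulr1.
rewrite !T1 rhoC rho1 setTI mBb -!EFinM divfK ?gt_eqF// => E ->.
by rewrite -E.
Qed.

(** The mass outside the displaced part stays put, and the displaced part is
spread independently over the target set. *)
Lemma displacement_coupling (mu nu : probability X R) :
  (forall A, measurable A -> mu A = \int[m]_(x in A) (rho x)%:E) ->
  (forall A, measurable A -> nu A = \int[m]_(x in A) (displaced_density x)%:E) ->
  exists2 p, coupling mu nu p &
    \int[p]_z ((mdist z.1 z.2) ^+ 2)%:E <= (dlt * a * D ^+ 2)%:E.
Proof.
move=> muE nuE.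
pose diag (x : X) := (x, x).
have mdiag : measurable_fun setT diag by apply: measurable_fun_pair; exact: measurable_id.
have rem0 x : (0 <= rho x * (1 - dlt * \1_C x))%R.
  by rewrite mulr_ge0// remaining_factor_ge0.
have [P1 P1E] := density_ex_measure m measurable_remaining rem0.
pose k (z : X * X) : R := (dlt / b * (rho z.1 * \1_C z.1 * \1_B z.2))%R.
have k0 z : (0 <= k z)%R by rewrite !mulr_ge0// invr_ge0 ltW.
have mB' : measurable_fun setT (\1_B : X -> R) by exact: measurable_indic.
have mk : measurable_fun setT k.
  apply: measurable_funM => //; apply: measurable_funM.
    exact: measurableT_comp mrhoC measurable_fst.
  exact: measurableT_comp mB' measurable_snd.
have [P2 P2E] := density_ex_measure (m \x m) mk k0.
have P2X A1 A2 : measurable A1 -> measurable A2 -> P2 (A1 `*` A2) =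
    (dlt / b)%:E * \int[m]_x (rho x * \1_C x * \1_A1 x)%:E * m (A2 `&` B).
  move=> mA1 mA2; rewrite P2E integral_indicM.
  have mA1' : measurable_fun setT (\1_A1 : X -> R) by exact: measurable_indic.
  have mA2B : measurable (A2 `&` B) by exact: measurableI.
  have mrA : measurable_fun setT (fun x => rho x * \1_C x * \1_A1 x)%R.
    exact: measurable_funM.
  transitivity (\int[m \x m]_z (dlt / b * (rho z.1 * \1_C z.1 * \1_A1 z.1) *
     \1_(A2 `&` B) z.2)%:E).
    apply: eq_integral => -[x y] _; congr (_%:E); rewrite /k /=.
    rewrite (_ : \1_(A1 `*` A2) (x, y) = \1_A1 x * \1_A2 y)%R; last first.
      by rewrite !indicE in_setX /= -natrM mulnb.
    by rewrite indicI /=; ring.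
  rewrite (fubini_tonelli1 (m1 := m) (m2 := m) (fun z : X * X =>
    (dlt / b * (rho z.1 * \1_C z.1 * \1_A1 z.1) * \1_(A2 `&` B) z.2)%:E)); last 2 first.
  - apply/measurable_EFinP; apply: measurable_funM.
      apply: measurable_funM => //; exact: measurableT_comp mrA measurable_fst.
    have mi : measurable_fun setT (\1_(A2 `&` B) : X -> R) by exact: measurable_indic.
    exact: measurableT_comp mi measurable_snd.
  - by move=> z; rewrite lee_fin !mulr_ge0// invr_ge0 ltW.
  rewrite /fubini_F /=.
  under eq_integral => x _.
    rewrite integralZ_ge0//; last by rewrite !mulr_ge0// invr_ge0 ltW.
    rewrite integral_indic// setIT muleC.
    over.
  rewrite ge0_integralZl//; last 2 first.
  - by apply/measurable_EFinP; exact: measurable_funM.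
  - by move=> x _; rewrite lee_fin !mulr_ge0// invr_ge0 ltW.
  rewrite muleC integralZ_ge0//; first by rewrite divr_ge0// ltW.
  by move=> x; rewrite !mulr_ge0.
pose image : {measure set (X * X) -> \bar R} := pushforward P1 diag.
pose q1 := image mdiag.
pose q : {measure set (X * X) -> \bar R} := measure_add q1 P2.
have q1E S : measurable S -> q1 S = P1 (diag @^-1` S) by [].
have qE S : q S = q1 S + P2 S by exact: measure_addE.
have qX A1 A2 : measurable A1 -> measurable A2 -> q (A1 `*` A2) =
    \int[m]_x (rho x * (1 - dlt * \1_C x) * \1_(A1 `&` A2) x)%:E +
    (dlt / b)%:E * \int[m]_x (rho x * \1_C x * \1_A1 x)%:E * m (A2 `&` B).
  move=> mA1 mA2; rewrite qE P2X// q1E; last exact: measurableX.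
  congr (_ + _); rewrite P1E (_ : diag @^-1` _ = A1 `&` A2)//.
  by rewrite integral_indicM.
have rhoC1 : \int[m]_x (rho x * \1_C x * \1_[set: X] x)%:E = a%:E.
  by rewrite -rhoC; apply: eq_integral => x _; rewrite indicT mulr1.
have q_fst A : measurable A -> q (A `*` setT) = mu A.
  move=> mA; rewrite qX// setIT setTI mBb muE// [RHS]integral_indicM.
  rewrite -(integral_remaining mA); congr (_ + _).
  by rewrite muleC muleA -EFinM mulrCA mulfV ?gt_eqF// mulr1.
have q_snd A : measurable A -> q (setT `*` A) = nu A.
  move=> mA; rewrite qX// setTI nuE// [RHS]integral_indicM integral_displaced_density//.
  by congr (_ + _); rewrite rhoC1 -EFinM mulrAC.
have q1T : \int[q]_z (cst 1%R z)%:E = 1.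
  rewrite -[LHS]/(\int[q]_z (1%R : R)%:E) integral_cst// mul1e.
  rewrite -[X in q X]setXTT q_fst//.
  exact: probability_setT.
have mcst : measurable_fun [set: X * X] (cst (1%R : R)) by exact: measurable_cst.
have [p pE] := density_probability mcst (fun=> @ler01 R) q1T.
have pq A : measurable A -> p A = q A.
  by move=> mA; rewrite pE -[LHS]/(\int[q]_(z in A) (1%R : R)%:E) integral_cst// mul1e.
exists p.
  by move=> A mA; split; rewrite pq ?q_fst ?q_snd//; exact: measurableX.
have mdp : measurable_fun setT (fun z : X * X => mdist z.1 z.2 ^+ 2)%R.
  by apply: measurable_funX; exact: mdist_measurable (mms_borel mmX) (mms_separable mmX).
rewrite (eq_measure_integral q); last by move=> A mA _; exact: pq.
rewrite (_ : \int[q]_z _ = \int[q1]_z (mdist z.1 z.2 ^+ 2)%:E +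
    \int[P2]_z (mdist z.1 z.2 ^+ 2)%:E); last first.
  apply: ge0_integral_measure_add => //; last exact/measurable_EFinP.
  by move=> z _; rewrite lee_fin sqr_ge0.
rewrite (_ : \int[q1]_z _ = 0) ?add0e; last first.
  rewrite ge0_integral_pushforward//; last 2 first.
  - exact/measurable_EFinP.
  - by move=> z _; rewrite lee_fin sqr_ge0.
  apply: integral0_eq => x _ /=; by rewrite mdistxx expr0n.
rewrite (integral_density mk k0 (fun A _ => P2E A) mdp); last first.
  by move=> z; exact: sqr_ge0.
apply: (@le_trans _ _ (\int[m \x m]_z (D ^+ 2 * k z)%:E)).
  apply: integral_le_ge0.
  - by move=> z; rewrite mulr_ge0// sqr_ge0.
  - move=> [x y]; rewrite /k /= !indicE.
    case: (boolP (x \in C)) => xC; case: (boolP (y \in B)) => yB;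
      rewrite ?mulr0 ?mul0r ?mulr0// !mulr1.
    rewrite ler_wpM2r ?mulr_ge0 ?invr_ge0 ?(ltW b0)//.
    rewrite ler_pXn2r ?nnegrE ?mdist_ge0//.
    by apply: CBD; exact: set_mem.
  - exact: measurable_funM.
  - exact: measurable_funM.
rewrite integralZ_ge0// ?sqr_ge0//.
have -> : \int[m \x m]_z (k z)%:E = P2 (setT `*` setT).
  by rewrite P2E setXTT.
rewrite P2X// rhoC1 setTI mBb -!EFinM lee_fin le_eqVlt; apply/orP; left; apply/eqP.
by field; rewrite gt_eqF.
Qed.

End displacement.

Section displacement_entropy.
Context {d : measure_display} {R : realType}
  {X : completeMetricMeasurableType d R}
  (m : {sigma_finite_measure set X -> \bar R})
  (mmX : is_metric_measure_space m).
Local Open Scope ereal_scope.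
Context (rho : X -> R) (x0 : X) (L : R).
Context (mrho : measurable_fun setT rho) (rho0 : forall x, (0 < rho x)%R)
  (rho1 : \int[m]_x (rho x)%:E = 1)
  (rhoL : forall x y, (`|ln (rho x) - ln (rho y)| <=
     L * (1 + mdist x0 x) * mdist x y + L * mdist x y ^+ 2)%R) (L0 : (0 <= L)%R).
Context (mu : probability X R)
  (muE : forall A, measurable A -> mu A = \int[m]_(x in A) (rho x)%:E)
  (mu2 : P2 mu).
Context (C B : set X) (dlt a b c1 b1 r0 : R).
Context (mC : measurable C) (mB : measurable B)
  (dlt0 : (0 < dlt)%R) (dlt1 : (dlt <= 1)%R) (a0 : (0 < a)%R) (b0 : (0 < b)%R)
  (rhoC : \int[m]_x (rho x * \1_C x)%:E = a%:E) (mBb : m B = b%:E)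
  (mCc : m C = c1%:E) (rhoB : \int[m]_x (rho x * \1_B x)%:E = b1%:E)
  (CB : C `&` B = set0)
  (Cr : forall x, C x -> (mdist x0 x <= r0)%R)
  (Br : forall x, B x -> (mdist x0 x <= r0)%R).

Let r := displaced_density rho C B dlt a b.
Let beta := (dlt * a / b)%R.

Lemma integrable_density (g : X -> R) : measurable_fun setT g ->
  forall (sigma : probability X R) (s : X -> R), measurable_fun setT s ->
  (forall x, 0 <= s x)%R ->
  (forall A, measurable A -> sigma A = \int[m]_(x in A) (s x)%:E) ->
  sigma.-integrable setT (EFin \o g) ->
  m.-integrable setT (fun x => (g x * s x)%:E).
Proof.
move=> mg sigma s ms s0 sE /integrableP[_ gi]; apply/integrableP; split.
  by apply/measurable_EFinP; exact: measurable_funM.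
move: gi; under eq_integral do rewrite abse_EFin.
rewrite (integral_density ms s0 sE); last 2 first.
- exact: measurableT_comp.
- by move=> x; exact: normr_ge0.
apply: le_lt_trans; rewrite le_eqVlt; apply/orP; left; apply/eqP.
by apply: eq_integral => x _ /=; rewrite normrM (ger0_norm (s0 x)).
Qed.

Let rho0' x : (0 <= rho x)%R. Proof. exact: ltW. Qed.
Let beta0 : (0 < beta)%R. Proof. by rewrite divr_gt0// mulr_gt0. Qed.
Let r_ge0 x : (0 <= r x)%R.
Proof.
exact: (displaced_density_ge0 C B rho0' (ltW dlt0) dlt1 (ltW a0) b0 x).
Qed.
Let mr : measurable_fun setT r.
Proof. exact: (displaced_density_measurable dlt a b mrho mC mB). Qed.
Let mphi : measurable_fun setT (fun x => ln (rho x)).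
Proof. exact: ln_density_measurable. Qed.
Let rhoG := ln_density_growth rhoL L0.

Lemma mulr_ln_ge (s : R) : (0 <= s)%R -> (-1 <= s * ln s)%R.
Proof. by move=> s0; have := mulr_ln_tangent s0 ltr01; rewrite ln1; lra. Qed.

(** On the target set the logarithm of the added density is what makes the
entropy drop superlinearly in the displaced mass. *)
Lemma mulr_ln_displaced_le x : (r x * ln (r x) <= ln (rho x) * rho x +
  (dlt * \1_C x + (beta * (1 + ln beta) * \1_B x + rho x * \1_B x)))%R.
Proof.
have rx0 := rho0 x; have g := mulr_ln_ge (rho0' x); have d0 := dlt0.
rewrite /r /displaced_density -/beta !indicE.
case: (boolP (x \in B)) => xB.
  have -> : (x \in C) = false.
    apply/negP => /set_mem xC; have : (C `&` B) x by split => //; exact: set_mem.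
    by rewrite CB.
  rewrite /= !mulr0 subr0 !mulr1 add0r.
  have s0 : (0 < rho x + beta)%R by rewrite addr_gt0.
  have h1 := mulr_ln_tangent (rho0' x) s0.
  have E : (rho x + beta = beta * (1 + rho x / beta))%R by field; rewrite gt_eqF.
  have q0 : (0 < rho x / beta)%R by rewrite divr_gt0.
  have h2 : (ln (rho x + beta) <= ln beta + rho x / beta)%R.
    rewrite E lnM ?posrE ?ltr_pwDl// ?lerD2l; last exact: ltW.
    by apply: le_ln1Dx; rewrite (lt_trans _ q0).
  have h3 : (beta * ln (rho x + beta) <= beta * ln beta + rho x)%R.
    have -> : (beta * ln beta + rho x = beta * (ln beta + rho x / beta))%R.
      by field; rewrite gt_eqF.
    by rewrite ler_wpM2l// ltW.
  by lra.
rewrite /= !mulr0 !addr0; case: (x \in C); rewrite /= ?mulr1 ?mulr0; last first.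
  by rewrite subr0 mulr1 addr0 mulrC.
have [->|d1] := eqVneq dlt 1%R.
  by rewrite subrr mulr0 mul0r; lra.
have d1' : (0 < 1 - dlt)%R by rewrite subr_gt0 lt_neqAle d1.
rewrite lnM ?posrE//; have l0 : (ln (1 - dlt) <= 0)%R by apply: ln_le0; lra.
have : (rho x * (1 - dlt) * ln (1 - dlt) <= 0)%R.
  by rewrite mulr_ge0_le0// mulr_ge0// ltW.
have : (0 <= dlt * (1 + rho x * ln (rho x)))%R by rewrite mulr_ge0 ?(ltW dlt0)//; lra.
by move=> h1 h2; lra.
Qed.

Lemma integral_indicB : \int[m]_x (\1_B x)%:E = b%:E.
Proof. by rewrite integral_indic// setIT; exact: mBb. Qed.

Lemma integral_indicC : \int[m]_x (\1_C x)%:E = c1%:E.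
Proof. by rewrite integral_indic// setIT; exact: mCc. Qed.

Context (emu : R) (emuE : \int[mu]_x (ln (rho x))%:E = emu%:E).
Context (nu : probability X R)
  (nuE : forall A, measurable A -> nu A = \int[m]_(x in A) (r x)%:E).

Lemma P2_displaced : P2 nu.
Proof.
have md := mdist_measurable1 mmX x0.
have md2 : measurable_fun setT (fun x => mdist x0 x ^+ 2)%R by exact: measurable_funX.
have mB' : measurable_fun setT (\1_B : X -> R) by exact: measurable_indic.
have sq0 x : (0 <= mdist x0 x ^+ 2)%R by exact: sqr_ge0.
exists x0; rewrite (integral_density mr r_ge0 nuE md2 sq0).
have h := P2_integrable mmX x0 mu2; have e1 := integral_eq_fine sq0 (lexx _) h.
rewrite (integral_density mrho rho0' muE md2 sq0) in e1.
apply: le_lt_trans (ltry (1 * fine (\int[mu]_x (mdist x0 x ^+ 2)%:E) +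
   (beta * r0 ^+ 2) * b)%R).
apply: (integral_le_lin (f := fun x => (mdist x0 x ^+ 2 * rho x)%R)
  (g := \1_B : X -> R)) => //.
- by rewrite mulr_ge0 ?sqr_ge0// ltW.
- by move=> x; rewrite mulr_ge0.
- by move=> x; rewrite mulr_ge0.
- exact: measurable_funM.
- exact: measurable_funM.
- apply: nearW => x; rewrite mul1r /r /displaced_density -/beta mulrDr.
  apply: lerD.
    rewrite ler_wpM2l//; rewrite ler_piMr// gerBl mulr_ge0 ?(ltW dlt0)//.
  rewrite mulrCA -mulrA ler_wpM2l ?(ltW beta0)//.
  rewrite indicE; case: (boolP (x \in B)) => xB; rewrite ?mulr0// !mulr1.
  have xr := Br (set_mem xB); have rr := le_trans (mdist_ge0 x0 x) xr.
  by rewrite ler_pXn2r ?nnegrE ?mdist_ge0.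
- by rewrite -(integral_density mrho rho0' muE md2 sq0) in e1 *; rewrite -e1.
- by rewrite integral_indicB.
Qed.

(** The displaced part carries mass [dlt * a], so its logarithm [ln beta]
contributes [dlt * a * ln (dlt * a / b)], the dominant term for small [dlt]. *)
Lemma displaced_entropy_le : entropy_domain m nu /\
  entropy m nu <= (emu + (dlt * c1 + (beta * (1 + ln beta) * b + b1)))%:E.
Proof.
have nu2 := P2_displaced.
have mC' : measurable_fun setT (\1_C : X -> R) by exact: measurable_indic.
have mB' : measurable_fun setT (\1_B : X -> R) by exact: measurable_indic.
have irho : m.-integrable setT (EFin \o rho).
  by apply: ge0_integrable => //; rewrite rho1 ltry.
have ir : m.-integrable setT (EFin \o r).
  have sr1 : \int[m]_x (r x)%:E = 1 by rewrite -nuE//; exact: probability_setT.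
  by apply: ge0_integrable; rewrite // sr1 ltry.
have i1 := integrable_density mphi mrho rho0' muE
  (ln_density_integrable mmX mrho rhoG mu2).
have i2 := integrable_density mphi mr r_ge0 nuE
  (ln_density_integrable mmX mrho rhoG nu2).
have iC : m.-integrable setT (fun x => (dlt * \1_C x)%:E).
  apply: ge0_integrable; [exact: measurable_funM| |].
    by move=> x; rewrite mulr_ge0// ltW.
  by rewrite integralZ_ge0 ?(ltW dlt0)// integral_indicC -EFinM ltry.
have iB : m.-integrable setT (fun x => (beta * (1 + ln beta) * \1_B x)%:E).
  under eq_fun do rewrite EFinM; apply: integrableZl => //.
  apply: ge0_integrable => //.
  by rewrite integral_indicB ltry.
have irB : m.-integrable setT (fun x => (rho x * \1_B x)%:E).
  apply: ge0_integrable; [exact: measurable_funM| |].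
    by move=> x; rewrite mulr_ge0.
  by rewrite rhoB ltry.
pose U1 x := (beta * (1 + ln beta) * \1_B x + rho x * \1_B x)%R.
have iU1 : m.-integrable setT (EFin \o U1).
  have -> : EFin \o U1 = (fun x => (beta * (1 + ln beta) * \1_B x)%:E) \+
      (fun x => (rho x * \1_B x)%:E) by apply/funext => x; rewrite /= EFinD.
  exact: integrableD.
pose U2 x := (dlt * \1_C x + U1 x)%R.
have iU2 : m.-integrable setT (EFin \o U2).
  have -> : EFin \o U2 = (fun x => (dlt * \1_C x)%:E) \+ (EFin \o U1).
    by apply/funext => x; rewrite /= EFinD.
  exact: integrableD.
pose U x := (ln (rho x) * rho x + U2 x)%R.
have iU : m.-integrable setT (EFin \o U).
  have -> : EFin \o U = (fun x => (ln (rho x) * rho x)%:E) \+ (EFin \o U2).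
    by apply/funext => x; rewrite /= EFinD.
  exact: integrableD.
have UE : \int[m]_x (U x)%:E = (emu + (dlt * c1 + (beta * (1 + ln beta) * b + b1)))%:E.
  rewrite /U; under eq_integral do rewrite EFinD.
  rewrite integralD// -(integral_density_real mrho rho0' muE mphi) emuE EFinD.
  congr (_ + _); rewrite /U2; under eq_integral do rewrite EFinD.
  rewrite integralD// integralZ_ge0 ?(ltW dlt0)// integral_indicC EFinD -EFinM.
  congr (_ + _); rewrite /U1; under eq_integral do rewrite EFinD.
  rewrite integralD// rhoB EFinD; congr (_ + _).
  under eq_integral do rewrite EFinM.
  rewrite integralZl//; last first.
    by apply: ge0_integrable => //; rewrite integral_indicB ltry.
  by rewrite integral_indicB -EFinM.
pose lo x := (ln (rho x) * r x + (r x - rho x))%R.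
have ilo : m.-integrable setT (EFin \o lo).
  have -> : EFin \o lo = (fun x => (ln (rho x) * r x)%:E) \+
      ((EFin \o r) \- (EFin \o rho)).
    by apply/funext => x; rewrite /= EFinD EFinB.
  by apply: integrableD => //; exact: integrableB.
have mrln : measurable_fun setT (fun x => r x * ln (r x))%R.
  by apply: measurable_funM => //; exact: measurableT_comp (@measurable_ln R) mr.
have irln : m.-integrable setT (fun x => (r x * ln (r x))%:E).
  have i3 : m.-integrable setT (fun x => (`|lo x| + `|U x|)%:E).
    have -> : (fun x => (`|lo x| + `|U x|)%:E) =
        (abse \o (EFin \o lo)) \+ (abse \o (EFin \o U)) by [].
    by apply: integrableD => //; exact: integrable_abse.
  apply: le_integrable i3 => //; first exact/measurable_EFinP.
  move=> x _; rewrite !abse_EFin lee_fin [leRHS]ger0_norm ?addr_ge0//.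
  have h1 : (lo x <= r x * ln (r x))%R.
    by rewrite /lo [X in (X + _)%R]mulrC; exact: mulr_ln_tangent.
  have h2 : (r x * ln (r x) <= U x)%R by exact: mulr_ln_displaced_le.
  have h3 := ler_norm (U x); have h4 := ler_norm (- lo x)%R; rewrite normrN in h4.
  have h5 := normr_ge0 (U x); have h6 := normr_ge0 (lo x).
  by rewrite ler_norml; apply/andP; split; lra.
have le : entropy m nu <= \int[m]_x (U x)%:E.
  apply: (@le_trans _ _ (\int[m]_x (r x * ln (r x))%:E)).
    apply: ereal_inf_lbound; exists r => //; split => //.
    exact: integrable_funeneg.
  apply: integral_mono => //; last by move=> x; exact: mulr_ln_displaced_le.
  by apply/measurable_EFinP; have /integrableP[] := iU.
rewrite UE in le; split => //; split => //.
have ge := gibbs mmX mrho rho0 rho1 rhoG nu2.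
have fi : \int[nu]_x (ln (rho x))%:E \is a fin_num.
  by apply: integrable_fin_num => //; exact: (ln_density_integrable mmX mrho rhoG nu2).
rewrite fin_numElt (lt_le_trans _ ge) ?(le_lt_trans le) ?ltry//.
by move: fi; rewrite fin_numElt => /andP[].
Qed.

End displacement_entropy.

Section displacement_inequality.
Context {d : measure_display} {R : realType}
  {X : completeMetricMeasurableType d R}
  (m : {sigma_finite_measure set X -> \bar R})
  (mmX : is_metric_measure_space m).
Local Open Scope ereal_scope.
Context (rho : X -> R) (x0 : X) (L : R).
Context (mrho : measurable_fun setT rho) (rho0 : forall x, (0 < rho x)%R)
  (rho1 : \int[m]_x (rho x)%:E = 1)
  (rhoL : forall x y, (`|ln (rho x) - ln (rho y)| <=
     L * (1 + mdist x0 x) * mdist x y + L * mdist x y ^+ 2)%R) (L0 : (0 <= L)%R).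
Context (mu : probability X R)
  (muE : forall A, measurable A -> mu A = \int[m]_(x in A) (rho x)%:E)
  (mu2 : P2 mu).
Context (C B : set X) (dlt a b c1 b1 r0 : R).
Context (mC : measurable C) (mB : measurable B)
  (dlt0 : (0 < dlt)%R) (dlt1 : (dlt <= 1)%R) (a0 : (0 < a)%R) (b0 : (0 < b)%R)
  (rhoC : \int[m]_x (rho x * \1_C x)%:E = a%:E) (mBb : m B = b%:E)
  (mCc : m C = c1%:E) (rhoB : \int[m]_x (rho x * \1_B x)%:E = b1%:E)
  (CB : C `&` B = set0)
  (Cr : forall x, C x -> (mdist x0 x <= r0)%R)
  (Br : forall x, B x -> (mdist x0 x <= r0)%R).

(** The entropy gained by displacing a small mass is superlinear in that mass,
while the transport cost is linear in it and the slope term independent of it. *)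
Lemma displacement_inequality (K I : R) : CD m K -> (0 <= r0)%R ->
  \int[mu]_x (fine (slope (fun y => ln (rho y)) x) ^+ 2)%:E <= I%:E ->
  (dlt * a * (ln (b / dlt) - 1 - (1 + `|K|) * (2 * r0) ^+ 2 / 2) <=
    dlt * c1 + b1 + I / 2)%R.
Proof.
move=> cd r00 slI.
have rho0' x : (0 <= rho x)%R by exact: ltW.
have mr := displaced_density_measurable dlt a b mrho mC mB.
have r_ge0 := displaced_density_ge0 C B rho0' (ltW dlt0) dlt1 (ltW a0) b0.
have r1 := integral_displaced_density1 mrho rho0' mC mB (ltW dlt0) dlt1 (ltW a0)
  b0 rhoC mBb rho1.
have [nu nuE] := density_probability mr r_ge0 r1.
have D0 : (0 <= 2 * r0)%R by rewrite mulr_ge0.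
have CBD x y : C x -> B y -> (mdist x y <= 2 * r0)%R.
  move=> /Cr h1 /Br h2; have := metric_triangle x x0 y.
  by rewrite (metric_sym x x0); lra.
have [p cp pD] := displacement_coupling mmX mrho rho0' mC mB (ltW dlt0) dlt1 (ltW a0)
  b0 D0 rhoC mBb CBD muE (fun A _ => nuE A).
have rhoG := ln_density_growth rhoL L0.
have [emu emuE] : exists e : R, \int[mu]_x (ln (rho x))%:E = e%:E.
  exists (fine (\int[mu]_x (ln (rho x))%:E)); rewrite fineK//.
  by apply: integrable_fin_num => //; exact: (ln_density_integrable mmX mrho rhoG mu2).
have [nuD enu_le] := displaced_entropy_le mmX mrho rho0 rho1 rhoL L0 muE mu2 mC mB
  dlt0 dlt1 a0 b0 mBb mCc rhoB CB Br emuE (fun A _ => nuE A).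
have [enu enuE] : exists e : R, entropy m nu = e%:E.
  by exists (fine (entropy m nu)); rewrite fineK//; case: nuD.
rewrite enuE lee_fin in enu_le.
have [q [qE q0 qD]] : exists q : R, [/\ ereal_inf [set \int[p]_z ((mdist z.1 z.2) ^+ 2)%:E
    | p in coupling mu nu] = q%:E, (0 <= q)%R & (q <= dlt * a * (2 * r0) ^+ 2)%R].
  set S := ereal_inf _.
  have S0 : 0 <= S.
    by apply: le_ereal_inf_tmp => _ [p' _ <-]; apply: integral_real_ge0 => z; exact: sqr_ge0.
  have SD : S <= (dlt * a * (2 * r0) ^+ 2)%:E.
    by apply: le_trans pD; apply: ereal_inf_lbound; exists p.
  have SE : S = (fine S)%:E by rewrite fineK// ge0_fin_numE// (le_lt_trans SD) ?ltry.
  by exists (fine S); split => //; rewrite -lee_fin -SE.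
have W : W2 mu nu = (Num.sqrt q)%:E by rewrite /W2 qE poweR_EFin powR12_sqrt.
have := hwi mmX mrho rho0 rho1 rhoL L0 muE mu2 cd nuD (sqrtr_ge0 q) W emuE enuE slI.
rewrite sqr_sqrtr// => key.
have a1 : (a <= 1)%R.
  rewrite -lee_fin -rhoC -rho1; apply: integral_le_ge0 => //.
  - by move=> x; rewrite mulr_ge0.
  - by move=> x; rewrite ler_piMr// indicE lern1 leq_b1.
  - by apply: measurable_funM => //; exact: measurable_indic.
have da0 : (0 < dlt * a)%R by rewrite mulr_gt0.
have lnb : (ln (dlt * a / b) <= - ln (b / dlt))%R.
  rewrite -lnV ?posrE ?divr_gt0// ler_ln ?posrE ?invr_gt0 ?divr_gt0//.
  by rewrite invf_div ler_wpM2r ?invr_ge0 ?(ltW b0)// ler_piMr// ltW.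
have E : (dlt * a / b * (1 + ln (dlt * a / b)) * b = dlt * a * (1 + ln (dlt * a / b)))%R.
  by field; rewrite gt_eqF.
have h1 : (dlt * a * (1 + ln (dlt * a / b)) <= dlt * a * (1 - ln (b / dlt)))%R.
  by rewrite ler_wpM2l ?(ltW da0)//; lra.
have Kq : ((1 - K) * q <= (1 + `|K|) * (dlt * a * (2 * r0) ^+ 2))%R.
  apply: (@le_trans _ _ ((1 + `|K|) * q)%R).
    by rewrite ler_wpM2r// lerD2l -normrN ler_norm.
  by rewrite ler_wpM2l// addr_ge0.
rewrite E in enu_le.
move: (ln (dlt * a / b))%R (ln (b / dlt))%R enu_le h1 => lb lbd enu_le h1 {E lnb}.
set W0 := ((2 * r0) ^+ 2)%R in Kq *; clearbody W0.
by nra.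
Qed.

End displacement_inequality.

(** * Gaussian regularisation *)

Section gaussian.
Context {d : measure_display} {R : realType}
  {X : completeMetricMeasurableType d R}
  (m : {sigma_finite_measure set X -> \bar R})
  (mmX : is_metric_measure_space m).
Local Open Scope ereal_scope.

Lemma open_ball_measurable (x : X) (r : R) : measurable [set y | (mdist x y < r)%R].
Proof.
apply: (open_set_measurable (mms_borel mmX)).
rewrite (_ : [set y | _] = [set y | (0 < r - mdist y x)%R]).
  apply: open_gt0_preimage => y; apply: cvgB; first exact: cvg_cst.
  exact: mdist_continuous.
by apply/seteqP; split => y /=; rewrite subr_gt0 metric_sym.
Qed.

Lemma gaussian_sum_le (a : R) (n : nat) : (0 <= a)%R ->
  (\sum_(0 <= k < n) a * expR (- k%:R) <= a / (1 - expR (-1)))%R.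
Proof.
move=> a0; have e1 : (expR (-1) < 1 :> R)%R by rewrite expR_lt1 oppr_lt0.
have e0 : (0 < 1 - expR (-1) :> R)%R by rewrite subr_gt0.
under eq_bigr => k _ do rewrite -[k%:R]mulr1 -mulrN expRM_natl.
have -> : (\sum_(0 <= k < n) a * expR (-1) ^+ k = a * (1 - expR (-1) ^+ n) / (1 - expR (-1)))%R.
  have := congr1 (fun f => f n) (geometric_seriesE a (negbT (lt_eqF e1))).
  by rewrite /series /geometric /= => ->.
rewrite ler_wpM2r ?invr_ge0 ?(ltW e0)// ler_piMr// gerBl exprn_ge0//.
Qed.

(** The growth bound on balls is exactly what makes a Gaussian integrable. *)
Lemma gaussian_integrable : exists (x0 : X) (c G : R), [/\ (0 < c)%R, (0 <= G)%R &
  \int[m]_x (expR (- (c * mdist x0 x ^+ 2)))%:E <= G%:E].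
Proof.
have [x0 [M [c0 [M0 c00 H]]]] := mms_growth mmX.
pose c := (2 * c0 + 1)%R; pose a := (M * expR (2 * c0))%R.
have c_gt0 : (0 < c)%R by rewrite ltr_wpDl// mulr_ge0.
have a0 : (0 <= a)%R by rewrite mulr_ge0 ?expR_ge0// ltW.
have e0 : (0 < 1 - expR (-1) :> R)%R by rewrite subr_gt0 expR_lt1 oppr_lt0.
exists x0, c, (a / (1 - expR (-1)))%R; split => //; first by rewrite divr_ge0// ltW.
pose f (k : nat) x : R :=
  (expR (- (c * k%:R ^+ 2)) * \1_[set y | (mdist x0 y < k.+1%:R)%R] x)%R.
have f0 k x : (0 <= f k x)%R by rewrite mulr_ge0// expR_ge0.
have mf k : measurable_fun setT (f k).
  by apply: measurable_funM => //; apply: measurable_indic; exact: open_ball_measurable.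
have md := mdist_measurable1 mmX x0.
apply: (@le_trans _ _ (\int[m]_x (\sum_(0 <= k <oo) (f k x)%:E))).
  apply: ge0_le_integral => //.
  - apply/measurable_EFinP; apply: measurableT_comp => //.
    by apply: measurable_funN; apply: measurable_funM => //; exact: measurable_funX.
  - apply: (emeasurable_fun_cvg (fun n x => \sum_(0 <= k < n) (f k x)%:E)).
      by move=> n; apply: emeasurable_sum => k; exact/measurable_EFinP.
    by move=> x _; apply: is_cvg_nneseries => k _ _; rewrite lee_fin.
  - move=> x _; pose k := Num.truncn (mdist x0 x).
    have /andP[k1 k2] := Num.Theory.truncn_itv (mdist_ge0 x0 x).
    apply: (@le_trans _ _ (f k x)%:E).
      rewrite lee_fin /f indicE mem_set//= mulr1 ler_expR lerN2 ler_wpM2l ?(ltW c_gt0)//.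
      by rewrite ler_pXn2r ?nnegrE ?mdist_ge0.
    have fx i : true -> 0 <= (f i x)%:E by rewrite lee_fin.
    rewrite (nneseriesD1 (n := k) fx)// leeDl//.
    by apply: nneseries_ge0 => i _ _; rewrite lee_fin.
rewrite integral_nneseries//; last 2 first.
- by move=> k; apply/measurable_EFinP.
- by move=> k x _; rewrite lee_fin.
have term k : \int[m]_x (f k x)%:E <= (a * expR (- k%:R))%:E.
  rewrite integralZ_ge0 ?expR_ge0//; last first.
    by apply: measurable_indic; exact: open_ball_measurable.
  rewrite integral_indic//; last exact: open_ball_measurable.
  have := H k.+1%:R; rewrite ler0n => /(_ isT); rewrite setIT ballEmdist => h.
  apply: (@le_trans _ _ ((expR (- (c * k%:R ^+ 2)))%:E *
      (M * expR (c0 * k.+1%:R ^+ 2))%:E)).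
    by apply: lee_wpmul2l h; rewrite lee_fin expR_ge0.
  rewrite -EFinM lee_fin /a mulrCA -!mulrA -!expRD ler_wpM2l ?(ltW M0)// ler_expR.
  rewrite /c -natr1; have k0 : (0 <= k%:R :> R)%R by [].
  have kk : (k%:R <= k%:R ^+ 2 :> R)%R by rewrite -natrX ler_nat expnS expn1; case: (k) => // i; rewrite leq_pmulr.
  have : (0 <= c0 * (k%:R - 1) ^+ 2)%R by rewrite mulr_ge0// sqr_ge0.
  by move=> h2; lra.
apply: lime_le.
  by apply: is_cvg_nneseries => k _ _; apply: integral_real_ge0.
apply: nearW => n; apply: (@le_trans _ _ (\sum_(0 <= k < n) (a * expR (- k%:R))%:E)).
  by apply: lee_sum => k _; exact: term.
by rewrite sumEFin lee_fin gaussian_sum_le.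
Qed.

End gaussian.

Section regularisation.
Context {d : measure_display} {R : realType}
  {X : completeMetricMeasurableType d R}
  (m : {sigma_finite_measure set X -> \bar R})
  (mmX : is_metric_measure_space m).
Local Open Scope ereal_scope.

Lemma expR_lipschitz_below (A s t : R) : (s <= A -> t <= A ->
  `|expR s - expR t| <= expR A * `|s - t|)%R.
Proof.
wlog st : s t / (t <= s)%R.
  move=> H sA tA; have [ts|st] := leP t s; first exact: H.
  by rewrite distrC [X in (_ * X)%R]distrC; apply: H => //; exact: ltW.
move=> sA tA; rewrite !ger0_norm ?subr_ge0 ?ler_expR//.
apply: (@le_trans _ _ (expR s * (s - t))%R); last first.
  by rewrite ler_wpM2r ?subr_ge0 ?ler_expR.
have := @expR_ge1Dx R (t - s); rewrite expRD expRN => h.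
have e0 : (0 < expR s :> R)%R by exact: expR_gt0.
have : (expR s * (1 + (t - s)) <= expR s * (expR t / expR s))%R by rewrite ler_wpM2l// ltW.
rewrite mulrCA mulfV ?gt_eqF// mulr1 => h2; lra.
Qed.

Lemma ln_shift_lipschitz (e s t : R) : (0 < e -> 0 <= s -> 0 <= t ->
  `|ln (s + e) - ln (t + e)| <= e^-1 * `|s - t|)%R.
Proof.
move=> e0; wlog st : s t / (t <= s)%R.
  move=> H s0 t0; have [ts|st] := leP t s; first exact: H.
  by rewrite distrC [X in (_ * X)%R]distrC; apply: H => //; exact: ltW.
move=> s0 t0; have te : (0 < t + e)%R by rewrite ltr_wpDl.
have se : (0 < s + e)%R by rewrite ltr_wpDl.
rewrite !ger0_norm ?subr_ge0 ?ler_ln ?posrE ?lerD2r//.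
rewrite -ln_div ?posrE//.
have -> : ((s + e) / (t + e) = 1 + (s - t) / (t + e))%R by field; rewrite gt_eqF.
have q0 : (0 <= (s - t) / (t + e))%R by rewrite divr_ge0 ?subr_ge0// ltW.
apply: (le_trans (le_ln1Dx _)); first by rewrite (lt_le_trans _ q0)// oppr_lt0.
by rewrite mulrC ler_wpM2r ?subr_ge0// lef_pV2 ?posrE// lerDr.
Qed.

Context (x0 : X) (c : R) (c0 : (0 < c)%R).

Definition gaussian_weight (x : X) : R := expR (- (c * mdist x0 x ^+ 2)).

Let w := gaussian_weight.

Lemma gaussian_weight_gt0 x : (0 < w x)%R. Proof. exact: expR_gt0. Qed.

Lemma gaussian_weight_le1 x : (w x <= 1)%R.
Proof.
by rewrite /w /gaussian_weight expR_le1 oppr_le0 mulr_ge0 ?sqr_ge0// ltW.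
Qed.

Lemma gaussian_weight_measurable : measurable_fun setT w.
Proof.
apply: measurableT_comp => //; apply: measurable_funN; apply: measurable_funM => //.
by apply: measurable_funX; exact: (mdist_measurable1 mmX).
Qed.

(** From [t <= exp t]: a factor of the weight absorbs the squared distance. *)
Lemma gaussian_weight_moment x : (mdist x0 x ^+ 2 * w x ^+ 2 <= c^-1 * w x)%R.
Proof.
rewrite [X in (X <= _)%R](_ : _ = (mdist x0 x ^+ 2 * w x) * w x)%R; last by ring.
rewrite ler_wpM2r ?(ltW (gaussian_weight_gt0 x))//.
rewrite -[X in (_ <= X)%R]mulr1 ler_pdivlMl// mulrA.
rewrite -ler_pdivlMr ?gaussian_weight_gt0// mul1r /w /gaussian_weight -expRN opprK.
by apply: le_trans (expR_ge1Dx _); rewrite lerDr.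
Qed.

Lemma mdist_sqr_diff x y : (`|mdist x0 x ^+ 2 - mdist x0 y ^+ 2| <=
  2 * mdist x0 x * mdist x y + mdist x y ^+ 2)%R.
Proof.
have h := mdist_lipschitz x0 x y; rewrite !(metric_sym _ x0) in h.
have d0 := mdist_ge0 x0 x; have e0 := mdist_ge0 x0 y; have f0 := mdist_ge0 x y.
have t := metric_triangle x0 x y.
rewrite subr_sqr normrM [X in (_ * X)%R]ger0_norm ?addr_ge0//.
apply: (@le_trans _ _ (mdist x y * (2 * mdist x0 x + mdist x y))%R); last lra.
by apply: ler_pM; rewrite ?addr_ge0//; lra.
Qed.

Lemma slope_weight_le x : slope w x <= (2 * c * mdist x0 x * w x)%:E.
Proof.
have d0 := mdist_ge0 x0 x.
have s1 : slope (fun z => mdist x0 z) x <= 1%:E.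
  rewrite (_ : (fun z => mdist x0 z) = (fun z => mdist z x0)); last first.
    by apply/funext => z; rewrite metric_sym.
  exact: slope_mdist_le.
have s2 := @slope_comp_derive _ _ _ (fun t : R => - (c * t ^+ 2))%R _ x 1%R
  (- (c * (2 * mdist x0 x)))%R ler01 s1.
have {}s2 : slope (fun z => - (c * mdist x0 z ^+ 2))%R x <=
    (2 * c * mdist x0 x)%:E.
  have E : (2 * c * mdist x0 x = `|- (c * (2 * mdist x0 x))| * 1)%R.
    by rewrite mulr1 normrN ger0_norm ?mulr_ge0// ?(ltW c0)//; ring.
  rewrite E; apply: s2; apply: is_derive_eq.
  by rewrite /GRing.scale /= mulr1; ring.
have k0 : (0 <= 2 * c * mdist x0 x)%R by rewrite !mulr_ge0// ltW.
have := @slope_comp_derive _ _ _ expR _ x _ (w x) k0 s2 (is_derive_expR _).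
rewrite ger0_norm ?(ltW (gaussian_weight_gt0 x))// => h.
by rewrite mulrC; exact: h.
Qed.

Context (u : X -> R) (ub : Lip_bs u) (u0 : forall x, (0 <= u x)%R)
  (eps : R) (eps0 : (0 < eps)%R) (Z : R) (Z0 : (0 < Z)%R).

(** Adding a multiple of the weight makes the function positive with controlled
logarithm, at the price of a small Fisher information. *)
Definition regularised x : R := (u x + eps * w x)%R.
Let v := regularised.
Definition regularised_density x : R := (v x ^+ 2 / Z)%R.
Let rho := regularised_density.

Lemma regularised_gt0 x : (0 < v x)%R.
Proof. by rewrite ltr_wpDl// mulr_gt0// gaussian_weight_gt0. Qed.

Lemma regularised_density_gt0 x : (0 < rho x)%R.
Proof. by rewrite divr_gt0// exprn_gt0// regularised_gt0. Qed.

Lemma regularised_measurable : measurable_fun setT v.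
Proof.
apply: measurable_funD; first exact: (lipschitz_in_measurable mmX ub.1).
by apply: measurable_funM => //; exact: gaussian_weight_measurable.
Qed.

Lemma regularised_density_measurable : measurable_fun setT rho.
Proof.
by apply: measurable_funM => //; apply: measurable_funX; exact: regularised_measurable.
Qed.

Lemma ln_regularised_density x : (ln (rho x) = 2 * ln (v x) - ln Z)%R.
Proof.
rewrite /rho /regularised_density ln_div ?posrE ?exprn_gt0 ?regularised_gt0//.
by rewrite lnXn ?regularised_gt0// mulr2n mulrDl mul1r.
Qed.

Lemma slope_ln_regularised x : slope (fun y => ln (rho y)) x <=
  (2 / v x * (fine (slope u x) + 2 * c * eps * mdist x0 x * w x))%:E.
Proof.
have v0 := regularised_gt0 x; have d0 := mdist_ge0 x0 x.
have w0 := gaussian_weight_gt0 x.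
have s1 : slope u x <= (fine (slope u x))%:E by rewrite {1}(lipschitz_slope_fine x ub.1).
have k0 : (0 <= 2 * c * mdist x0 x * w x)%R by rewrite !mulr_ge0// ltW.
have s2 : slope (fun y => eps * w y)%R x <= (2 * c * eps * mdist x0 x * w x)%:E.
  have E : (2 * c * eps * mdist x0 x * w x = `|eps| * (2 * c * mdist x0 x * w x))%R.
    by rewrite gtr0_norm//; ring.
  rewrite E; apply: (@slope_comp_derive _ _ _ (fun t : R => eps * t)%R w x _ eps k0).
    exact: slope_weight_le.
  by apply: is_derive_eq; rewrite /GRing.scale /= mulr1.
have k1 : (0 <= 2 * c * eps * mdist x0 x * w x)%R.
  by rewrite !mulr_ge0// ltW.
have s3 := slope_add_le (fine_slope_ge0 u x) k1 s1 s2.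
have -> : (fun y => ln (rho y)) = (fun t : R => 2 * ln t - ln Z)%R \o v.
  by apply/funext => y; rewrite ln_regularised_density.
have -> : (2 / v x = `|2 / v x|)%R by rewrite ger0_norm// divr_ge0// ltW.
apply: slope_comp_derive => //; first by rewrite addr_ge0 ?fine_slope_ge0.
have := is_derive1_ln v0 => dl; apply: is_derive_eq.
by rewrite /GRing.scale /= subr0.
Qed.

(** The function has bounded support, on which the reciprocal weight is
Lipschitz.  Factoring out the weight, the logarithm of the regularised function
is [- c * d ^ 2 + ln (u / w + eps)], whence its quadratic growth. *)
Lemma quotient_lipschitz : exists2 K : R, (0 <= K)%R &
  forall x y, (`|u x / w x - u y / w y| <= K * mdist x y)%R.
Proof.
have [L L0 uL] := lipschitz_inP ub.1; have [M M0 uM] := Lip_bs_bounded ub.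
have [S S0 uS] : exists2 S : R, (0 <= S)%R & forall x, u x != 0%R -> (mdist x0 x <= S)%R.
  have [x1 [r ur]] := Lip_bs_support_bounded ub.
  exists (mdist x0 x1 + `|r|)%R; first by rewrite addr_ge0 ?mdist_ge0.
  move=> x /ur; rewrite ballEmdist /= => xr; apply: (le_trans (metric_triangle x0 x1 x)).
  by rewrite lerD2l (le_trans (ltW xr))// ler_norm.
pose E x : R := expR (c * mdist x0 x ^+ 2).
have wE x : ((w x)^-1 = E x)%R by rewrite /w /gaussian_weight -expRN opprK.
pose A := (c * (S + 1) ^+ 2)%R.
have SA t : (0 <= t -> t <= S + 1 -> c * t ^+ 2 <= A)%R.
  move=> t0 tS; rewrite ler_wpM2l ?(ltW c0)// ler_pXn2r ?nnegrE//.
  by rewrite addr_ge0.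
pose B := expR A; have B0 : (0 < B)%R by exact: expR_gt0.
have EB t : (mdist x0 t <= S + 1 -> E t <= B)%R.
  by move=> tS; rewrite ler_expR SA ?mdist_ge0.
have E0 t : (0 < E t)%R by exact: expR_gt0.
have uE t : (`|u t * E t| <= M * B)%R.
  have [->|ut] := eqVneq (u t) 0%R; first by rewrite mul0r normr0 mulr_ge0// ltW.
  rewrite normrM; apply: ler_pM => //; rewrite gtr0_norm ?E0// EB//.
  by rewrite (le_trans (uS _ ut))// lerDl.
pose K := (M * (B * (c * (2 * S + 1))) + B * L + 2 * (M * B))%R.
have K10 : (0 <= M * (B * (c * (2 * S + 1))))%R.
  by rewrite !mulr_ge0 ?addr_ge0 ?mulr_ge0// ltW.
have K20 : (0 <= B * L)%R by rewrite mulr_ge0// ltW.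
have K30 : (0 <= 2 * (M * B))%R by rewrite !mulr_ge0// ltW.
exists K; first by rewrite !addr_ge0.
have main x y : u x != 0%R -> (`|u x * E x - u y * E y| <= K * mdist x y)%R.
  move=> ux; have xS := uS _ ux; have d0 := mdist_ge0 x y; have dx0 := mdist_ge0 x0 x.
  have [d1|d1] := leP (mdist x y) 1%R; last first.
    apply: (le_trans (ler_normB _ _)); apply: (@le_trans _ _ (2 * (M * B) * 1)%R).
      by have := uE x; have := uE y; lra.
    apply: ler_pM => //; last exact: ltW.
    by rewrite /K lerDr addr_ge0.
  have yS : (mdist x0 y <= S + 1)%R.
    by have := metric_triangle x0 x y; lra.
  have -> : (u x * E x - u y * E y = u x * (E x - E y) + E y * (u x - u y))%R by ring.
  apply: (le_trans (ler_normD _ _)); rewrite !normrM.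
  have h1 : (`|E x - E y| <= B * (c * (2 * S + 1)) * mdist x y)%R.
    apply: (le_trans (@expR_lipschitz_below A _ _ _ _)).
    - by apply: SA => //; lra.
    - by apply: SA => //; exact: mdist_ge0.
    rewrite -/B -mulrA ler_wpM2l ?(ltW B0)//.
    rewrite -mulrBr normrM gtr0_norm// -mulrA ler_wpM2l ?(ltW c0)//.
    apply: (le_trans (mdist_sqr_diff x y)).
    have : (mdist x y * mdist x y <= 1 * mdist x y)%R by rewrite ler_wpM2r.
    have : (mdist x0 x * mdist x y <= S * mdist x y)%R by rewrite ler_wpM2r.
    by rewrite expr2; lra.
  have h2 : (`|E y| * `|u x - u y| <= B * (L * mdist x y))%R.
    by apply: ler_pM => //; rewrite gtr0_norm ?E0// EB.
  have h3 : (`|u x| * `|E x - E y| <= M * (B * (c * (2 * S + 1)) * mdist x y))%R.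
    by apply: ler_pM.
  have h4 : (0 <= 2 * (M * B) * mdist x y)%R by rewrite mulr_ge0.
  by rewrite /K !mulrDl; lra.
move=> x y; rewrite !wE; have [ux|ux] := eqVneq (u x) 0%R; last exact: main.
have [uy|uy] := eqVneq (u y) 0%R; last by rewrite distrC metric_sym; exact: main.
by rewrite ux uy !mul0r subrr normr0 mulr_ge0 ?mdist_ge0// !addr_ge0.
Qed.

Lemma ln_regularised_density_growth : exists2 L : R, (0 <= L)%R &
  forall x y, (`|ln (rho x) - ln (rho y)| <=
    L * (1 + mdist x0 x) * mdist x y + L * mdist x y ^+ 2)%R.
Proof.
have [K K0 uK] := quotient_lipschitz.
have ei0 : (0 <= eps^-1)%R by rewrite invr_ge0 ltW.
exists (4 * c + 2 * (eps^-1 * K))%R.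
  by rewrite addr_ge0// !mulr_ge0// ltW.
move=> x y; rewrite !ln_regularised_density.
have q0 t : (0 <= u t / w t)%R by rewrite divr_ge0// ltW// gaussian_weight_gt0.
have lv t : (ln (v t) = - (c * mdist x0 t ^+ 2) + ln (u t / w t + eps))%R.
  have w0 := gaussian_weight_gt0 t.
  have -> : (v t = w t * (u t / w t + eps))%R.
    by rewrite /v /regularised; field; rewrite gt_eqF.
  by rewrite lnM ?posrE ?ltr_wpDl// /w /gaussian_weight expRK.
rewrite !lv.
have h1 := @ln_shift_lipschitz eps _ _ eps0 (q0 x) (q0 y).
have h2 : (eps^-1 * `|u x / w x - u y / w y| <= eps^-1 * (K * mdist x y))%R.
  by rewrite ler_wpM2l.
have h3 : (c * `|mdist x0 x ^+ 2 - mdist x0 y ^+ 2| <=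
    c * (2 * mdist x0 x * mdist x y + mdist x y ^+ 2))%R.
  by rewrite ler_wpM2l ?(ltW c0)// mdist_sqr_diff.
set lx := ln (u x / w x + eps) in h1 *; set ly := ln (u y / w y + eps) in h1 *.
have -> : (2 * (- (c * mdist x0 x ^+ 2) + lx) - ln Z -
  (2 * (- (c * mdist x0 y ^+ 2) + ly) - ln Z) =
  2 * (- (c * (mdist x0 x ^+ 2 - mdist x0 y ^+ 2)) + (lx - ly)))%R by ring.
rewrite normrM ger0_norm//.
have h4 : (`|- (c * (mdist x0 x ^+ 2 - mdist x0 y ^+ 2)) + (lx - ly)| <=
    c * `|mdist x0 x ^+ 2 - mdist x0 y ^+ 2| + `|lx - ly|)%R.
  by rewrite (le_trans (ler_normD _ _))// normrN normrM gtr0_norm.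
have d0 := mdist_ge0 x0 x; have e0 := mdist_ge0 x y.
have p1 : (0 <= c * mdist x y)%R by rewrite mulr_ge0// ltW.
have p2 : (0 <= c * mdist x y ^+ 2)%R by rewrite mulr_ge0 ?sqr_ge0// ltW.
have p3 : (0 <= eps^-1 * K * mdist x0 x * mdist x y)%R by rewrite !mulr_ge0.
have p4 : (0 <= eps^-1 * K * mdist x y ^+ 2)%R by rewrite !mulr_ge0 ?sqr_ge0.
have {h4 h3 h2 h1} := le_trans h4 (lerD h3 (le_trans h1 h2)).
by move=> h; lra.
Qed.

End regularisation.

(** * Functions of zero energy under the curvature condition *)

Section irreducibility.
Context {d : measure_display} {R : realType}
  {X : completeMetricMeasurableType d R}
  (m : {sigma_finite_measure set X -> \bar R})
  (mmX : is_metric_measure_space m).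
Local Open Scope ereal_scope.

Lemma metric_bounded_radius (x0 : X) (A : set X) : metric_bounded A ->
  exists2 r : R, (0 <= r)%R & forall x, A x -> (mdist x0 x <= r)%R.
Proof.
move=> [x1 [r Ar]]; exists (mdist x0 x1 + `|r|)%R; first by rewrite addr_ge0 ?mdist_ge0.
move=> x /Ar; rewrite ballEmdist /= => xr; apply: (le_trans (metric_triangle x0 x1 x)).
by rewrite lerD2l (le_trans (ltW xr))// ler_norm.
Qed.

Lemma regularised_P2 (x0 : X) (c G : R) (u : X -> R) (eps Z : R) (mu : probability X R) :
  (0 < c)%R -> (0 < eps)%R -> (0 < Z)%R -> Lip_bs u -> (forall x, 0 <= u x)%R ->
  \int[m]_x (gaussian_weight x0 c x)%:E <= G%:E ->
  \int[m]_x (u x ^+ 2)%:E < +oo ->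
  (forall A, measurable A ->
     mu A = \int[m]_(x in A) (regularised_density x0 c u eps Z x)%:E) ->
  P2 mu.
Proof.
move=> c0 eps0 Z0 ub u0 wG u2 muE.
have [S S0 uS] := metric_bounded_radius x0 (Lip_bs_support_bounded ub).
have md := mdist_measurable1 mmX x0; have mu' := lipschitz_in_measurable mmX ub.1.
have mr := regularised_density_measurable mmX x0 c ub eps Z.
have r0 x := ltW (regularised_density_gt0 x0 c u0 eps0 Z0 x).
have mw := gaussian_weight_measurable mmX x0 c.
exists x0; rewrite (integral_density mr r0 muE); last 2 first.
- exact: measurable_funX.
- by move=> x; exact: sqr_ge0.
have e1 := integral_eq_fine (fun x => sqr_ge0 (u x)) (lexx _) u2.
apply: le_lt_trans (ltry (2 * S ^+ 2 / Z * fine (\int[m]_x (u x ^+ 2)%:E) +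
   2 * eps ^+ 2 * c^-1 / Z * G)%R).
apply: (integral_le_lin (f := fun x => (u x ^+ 2)%R) (g := gaussian_weight x0 c)) => //.
- by rewrite divr_ge0 ?(ltW Z0)// mulr_ge0// sqr_ge0.
- by rewrite divr_ge0 ?(ltW Z0)// mulr_ge0 ?invr_ge0 ?(ltW c0)// mulr_ge0// sqr_ge0.
- by move=> x; rewrite mulr_ge0// sqr_ge0.
- by move=> x; exact: sqr_ge0.
- by move=> x; exact/ltW/gaussian_weight_gt0.
- by apply: measurable_funM => //; exact: measurable_funX.
- exact: measurable_funX.
- apply: nearW => x; have h := gaussian_weight_moment x0 c0 x.
  have h2 : (mdist x0 x ^+ 2 * u x ^+ 2 <= S ^+ 2 * u x ^+ 2)%R.
    have [->|ux] := eqVneq (u x) 0%R; first by rewrite expr0n !mulr0.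
    by rewrite ler_wpM2r ?sqr_ge0// ler_pXn2r ?nnegrE ?mdist_ge0// uS.
  rewrite /regularised_density /regularised.
  set w := gaussian_weight x0 c x in h *; set dx := mdist x0 x in h h2 *.
  have -> : (2 * S ^+ 2 / Z * u x ^+ 2 + 2 * eps ^+ 2 / c / Z * w =
    (2 * (S ^+ 2 * u x ^+ 2) + 2 * (eps ^+ 2 * (c^-1 * w))) / Z)%R.
    by field; rewrite !gt_eqF.
  rewrite mulrA ler_wpM2r ?invr_ge0 ?(ltW Z0)//.
  apply: (@le_trans _ _ (2 * (dx ^+ 2 * u x ^+ 2) + 2 * (eps ^+ 2 * (dx ^+ 2 * w ^+ 2)))%R).
    have : (0 <= dx ^+ 2 * (u x - eps * w) ^+ 2)%R by rewrite mulr_ge0// sqr_ge0.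
    by move=> hh; lra.
  apply: lerD; first by rewrite ler_wpM2l.
  by rewrite ler_wpM2l// ler_wpM2l// sqr_ge0.
- by rewrite -e1.
Qed.

(** For a density [v ^ 2 / Z] the Fisher information is [4 / Z] times the
Dirichlet integral of [v]. *)
Lemma regularised_fisher_le (x0 : X) (c G e : R) (u : X -> R) (eps Z : R)
    (mu : probability X R) :
  (0 < c)%R -> (0 < eps)%R -> (0 < Z)%R -> Lip_bs u -> (forall x, 0 <= u x)%R ->
  \int[m]_x (gaussian_weight x0 c x)%:E <= G%:E ->
  \int[m]_x (fine (slope u x) ^+ 2)%:E <= e%:E ->
  (forall A, measurable A ->
     mu A = \int[m]_(x in A) (regularised_density x0 c u eps Z x)%:E) ->
  \int[mu]_x (fine (slope (fun y => ln (regularised_density x0 c u eps Z y)) x) ^+ 2)%:E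
    <= (8 / Z * e + 32 * c * eps ^+ 2 / Z * G)%:E.
Proof.
move=> c0 eps0 Z0 ub u0 wG uS muE.
have mr := regularised_density_measurable mmX x0 c ub eps Z.
have r0 x := ltW (regularised_density_gt0 x0 c u0 eps0 Z0 x).
have mw := gaussian_weight_measurable mmX x0 c.
have [L L0 rhoL] := ln_regularised_density_growth x0 c0 ub u0 eps0 Z0.
have msl : measurable_fun setT (fun x =>
    fine (slope (fun y => ln (regularised_density x0 c u eps Z y)) x) ^+ 2)%R.
  apply: (measurable_funX 2).
  have := slope_measurable (mms_borel mmX) (ln_density_continuous rhoL L0).
  exact: measurableT_comp (fine_measurable measurableT).
rewrite (integral_density mr r0 muE msl); last by move=> x; exact: sqr_ge0.
apply: (integral_le_lin (f := fun x => (fine (slope u x) ^+ 2)%R)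
  (g := gaussian_weight x0 c)) => //.
- by rewrite divr_ge0// ltW.
- by rewrite divr_ge0 ?(ltW Z0)// mulr_ge0 ?sqr_ge0// mulr_ge0// ltW.
- by move=> x; rewrite mulr_ge0// sqr_ge0.
- by move=> x; exact: sqr_ge0.
- by move=> x; exact/ltW/gaussian_weight_gt0.
- exact: measurable_funM.
- exact: (measurable_funX 2 (fine_slope_measurable mmX ub.1)).
apply: nearW => x; have h := gaussian_weight_moment x0 c0 x.
have sle := slope_ln_regularised x0 c0 ub u0 eps0 Z0 x.
have v0 := regularised_gt0 x0 c u0 eps0 x.
have w0 := gaussian_weight_gt0 x0 c x; have d0 := mdist_ge0 x0 x.
set v := regularised x0 c u eps x in v0 sle *.
have sE := slope_real sle; rewrite sE lee_fin in sle.
set sr := fine (slope (fun y => ln _) x) in sle *.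
have sr0 : (0 <= sr)%R by exact: fine_slope_ge0.
set s := fine (slope u x) in sle *.
set w := gaussian_weight x0 c x in h w0 sle *; set dx := mdist x0 x in h d0 sle *.
pose y := (s + 2 * c * eps * dx * w)%R.
have sq : (sr ^+ 2 <= (2 / v * y) ^+ 2)%R.
  by rewrite ler_pXn2r ?nnegrE ?sr0// (le_trans sr0 sle).
have -> : regularised_density x0 c u eps Z x = (v ^+ 2 / Z)%R by [].
apply: (@le_trans _ _ ((2 / v * y) ^+ 2 * (v ^+ 2 / Z))%R).
  by rewrite ler_wpM2r// divr_ge0 ?sqr_ge0// ltW.
have -> : ((2 / v * y) ^+ 2 * (v ^+ 2 / Z) = 4 * y ^+ 2 / Z)%R.
  by field; rewrite !gt_eqF.
have -> : (8 / Z * s ^+ 2 + 32 * c * eps ^+ 2 / Z * w =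
   4 * (2 * s ^+ 2 + 8 * c ^+ 2 * (eps ^+ 2 * (c^-1 * w))) / Z)%R.
  by field; rewrite !gt_eqF.
rewrite ler_wpM2r ?invr_ge0 ?(ltW Z0)// ler_wpM2l//.
apply: (@le_trans _ _ (2 * s ^+ 2 + 8 * c ^+ 2 * (eps ^+ 2 * (dx ^+ 2 * w ^+ 2)))%R).
  by have := sqr_ge0 (s - 2 * c * eps * dx * w)%R; rewrite /y => hh; lra.
rewrite lerD2l; apply: ler_wpM2l; first by rewrite mulr_ge0// sqr_ge0.
by apply: ler_wpM2l => //; exact: sqr_ge0.
Qed.

Lemma regularised_mass (x0 : X) (c G e N P : R) (u g : X -> R) (C B : set X) :
  (0 < c)%R -> (0 < e)%R -> Lip_bs u -> (forall x, 0 <= u x)%R ->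
  \int[m]_x (gaussian_weight x0 c x)%:E <= G%:E ->
  measurable_fun setT g -> measurable C -> measurable B ->
  \int[m]_x (g x ^+ 2)%:E = N%:E -> \int[m]_x (g x ^+ 2 * \1_C x)%:E = P%:E ->
  (forall x, B x -> g x = 0%R) -> \int[m]_x ((u x - g x) ^+ 2)%:E <= e%:E ->
  exists Z q s : R, [/\
    [/\ \int[m]_x (regularised x0 c u e x ^+ 2)%:E = Z%:E,
        \int[m]_x (regularised x0 c u e x ^+ 2 * \1_C x)%:E = q%:E &
        \int[m]_x (regularised x0 c u e x ^+ 2 * \1_B x)%:E = s%:E],
    (Z <= 4 * N + 4 * e + 2 * e ^+ 2 * G)%R, (P <= 2 * e + 2 * q)%R,
    (q <= Z)%R & (s <= 2 * e + 2 * e ^+ 2 * G)%R].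
Proof.
move=> c0 e0 ub u0 wG mg mC mB gN gP gB ug.
have mu' := lipschitz_in_measurable mmX ub.1.
have mw := gaussian_weight_measurable mmX x0 c.
have mv := regularised_measurable mmX x0 c ub e.
have v_gt0 x := regularised_gt0 x0 c u0 e0 x.
have v_ge x : (u x <= regularised x0 c u e x)%R.
  by rewrite lerDl mulr_ge0 ?(ltW e0)// ltW// gaussian_weight_gt0.
have w0 x := gaussian_weight_gt0 x0 c x.
have w2 x : (gaussian_weight x0 c x ^+ 2 <= gaussian_weight x0 c x)%R.
  by rewrite expr2 ler_piMl ?(ltW (w0 _))// gaussian_weight_le1.
have mv2 : measurable_fun setT (fun x => regularised x0 c u e x ^+ 2)%R.
  exact: measurable_funX.
have mug : measurable_fun setT (fun x => (u x - g x) ^+ 2)%R.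
  by apply: measurable_funX; exact: measurable_funB.
have mg2 : measurable_fun setT (fun x => g x ^+ 2)%R by exact: measurable_funX.
have ind01 (A : set X) x : (0 <= \1_A x :> R)%R /\ (\1_A x <= 1 :> R)%R.
  by rewrite indicE ler0n lern1 leq_b1.
have mi A : measurable A ->
    measurable_fun setT (fun x => regularised x0 c u e x ^+ 2 * \1_A x)%R.
  by move=> mA; apply: measurable_funM => //; exact: measurable_indic.
have vi0 A x : (0 <= regularised x0 c u e x ^+ 2 * \1_A x)%R.
  by rewrite mulr_ge0 ?sqr_ge0//; case: (ind01 A x).
have viv A x : (regularised x0 c u e x ^+ 2 * \1_A x <= regularised x0 c u e x ^+ 2)%R.
  by rewrite ler_piMr ?sqr_ge0//; case: (ind01 A x).
have uN : \int[m]_x (u x ^+ 2)%:E <= (2 * e + 2 * N)%:E.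
  apply: (integral_le_lin (f := fun x => ((u x - g x) ^+ 2)%R)
    (g := fun x => (g x ^+ 2)%R)) => //.
  - by move=> x; exact: sqr_ge0.
  - by move=> x; exact: sqr_ge0.
  - by move=> x; exact: sqr_ge0.
  - exact: measurable_funX.
  - apply: nearW => x; have := sqr_ge0 (u x - 2 * g x)%R.
    by set s := u x; set t := g x => h; lra.
  - by rewrite gN.
have vN : \int[m]_x (regularised x0 c u e x ^+ 2)%:E <=
    (2 * (2 * e + 2 * N) + 2 * e ^+ 2 * G)%:E.
  apply: (integral_le_lin (f := fun x => (u x ^+ 2)%R)
    (g := gaussian_weight x0 c)) => //.
  - by rewrite mulr_ge0// sqr_ge0.
  - by move=> x; exact: sqr_ge0.
  - by move=> x; exact: sqr_ge0.
  - by move=> x; exact: ltW.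
  - exact: measurable_funX.
  - apply: nearW => x; rewrite /regularised.
    have h1 := sqr_ge0 (u x - e * gaussian_weight x0 c x)%R.
    have h2 : (e ^+ 2 * gaussian_weight x0 c x ^+ 2 <= e ^+ 2 * gaussian_weight x0 c x)%R.
      by rewrite ler_wpM2l ?sqr_ge0.
    move: (gaussian_weight x0 c x) (u x) h1 h2 => t s h1 h2; lra.
have [Z [vZ Z0 Zle]] := integral_real (fun x => sqr_ge0 (regularised x0 c u e x)) vN.
have vA A : measurable A ->
    \int[m]_x (regularised x0 c u e x ^+ 2 * \1_A x)%:E <= Z%:E.
  by move=> mA; rewrite -vZ; apply: integral_le_ge0 => //; exact: mi.
have [q [vq q0 qZ]] := integral_real (vi0 C) (vA _ mC).
have [s [vs s0 sZ]] := integral_real (vi0 B) (vA _ mB).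
exists Z, q, s; split => //; first by lra.
- rewrite -lee_fin -gP; apply: (integral_le_lin (f := fun x => ((u x - g x) ^+ 2)%R)
    (g := (fun x => regularised x0 c u e x ^+ 2 * \1_C x)%R)) => //.
  + by move=> x; rewrite mulr_ge0 ?sqr_ge0//; case: (ind01 C x).
  + by move=> x; exact: sqr_ge0.
  + by apply: measurable_funM => //; exact: measurable_indic.
  + exact: mi.
  + apply: nearW => x; rewrite indicE; case: (boolP (x \in C)) => _ /=; last first.
      by rewrite !mulr0 addr0 mulr_ge0// sqr_ge0.
    rewrite !mulr1; have h : (u x ^+ 2 <= regularised x0 c u e x ^+ 2)%R.
      by rewrite ler_pXn2r ?nnegrE ?(ltW (v_gt0 x)).
    have h2 := sqr_ge0 (2 * u x - g x)%R.
    by move: (u x) (g x) (regularised _ _ _ _ x) h h2 => a b v h h2; lra.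
  + by rewrite vq.
- rewrite -lee_fin -vs; apply: (integral_le_lin (f := fun x => ((u x - g x) ^+ 2)%R)
    (g := gaussian_weight x0 c)) => //.
  + by rewrite mulr_ge0// sqr_ge0.
  + by move=> x; exact: sqr_ge0.
  + by move=> x; exact: ltW.
  + exact: mi.
  + apply: nearW => x; rewrite indicE; case: (boolP (x \in B)) => xB /=; last first.
      by rewrite mulr0 addr_ge0// mulr_ge0 ?sqr_ge0 ?mulr_ge0 ?sqr_ge0// ltW.
    rewrite mulr1 gB ?subr0; last by rewrite inE in xB.
    rewrite /regularised; have h1 := sqr_ge0 (u x - e * gaussian_weight x0 c x)%R.
    have h2 : (e ^+ 2 * gaussian_weight x0 c x ^+ 2 <= e ^+ 2 * gaussian_weight x0 c x)%R.
      by rewrite ler_wpM2l ?sqr_ge0.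
    by move: (gaussian_weight x0 c x) (u x) h1 h2 => t r h1 h2; lra.
Qed.

End irreducibility.

Section zero_energy.
Context {d : measure_display} {R : realType}
  {X : completeMetricMeasurableType d R}
  (m : {sigma_finite_measure set X -> \bar R})
  (mmX : is_metric_measure_space m).
Local Open Scope ereal_scope.

(** Normalising the squares of the regularised approximants gives probability
densities with vanishing Fisher information, which keep a fixed share of
their mass on [C] and leave vanishing mass on [B].  Moving a small fraction
[dlt] of the mass from [C] to [B] then gains entropy of order
[dlt * ln (1 / dlt)], more than the displacement inequality can pay for. *)
Lemma zero_energy_contradiction (K N P : R) (g : X -> R) (C B : set X) :
  CD m K -> measurable_fun setT g -> \int[m]_x (g x ^+ 2)%:E = N%:E ->
  measurable C -> measurable B -> metric_bounded C -> metric_bounded B ->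
  C `&` B = set0 -> \int[m]_x (g x ^+ 2 * \1_C x)%:E = P%:E -> (0 < P)%R ->
  (forall x, B x -> g x = 0%R) -> 0 < m B ->
  (forall e : R, (0 < e)%R -> exists u, [/\ Lip_bs u, forall x, (0 <= u x)%R,
     \int[m]_x ((u x - g x) ^+ 2)%:E <= e%:E &
     \int[m]_x (fine (slope u x) ^+ 2)%:E <= e%:E]) -> False.
Proof.
move=> cd mg gN mC mB Cb Bb CB gP P0 gB mB0 happ.
have [x0 [c [G [c0 G0 wG]]]] := gaussian_integrable mmX.
have [rC rC0 CrC] := metric_bounded_radius x0 Cb.
have [rB rB0 BrB] := metric_bounded_radius x0 Bb.
have N0 : (0 <= N)%R.
  by rewrite -lee_fin -gN; apply: integral_real_ge0 => x; exact: sqr_ge0.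
have [b mBb b0] : exists2 b : R, m B = b%:E & (0 < b)%R.
  have := bounded_measure_lty mmX mB Bb; move: mB0.
  by case: (m B) => [b| |]//; rewrite lte_fin; exists b.
have [c1 mCc] : exists c1 : R, m C = c1%:E.
  exists (fine (m C)); rewrite fineK// ge0_fin_numE//.
  have h := bounded_measure_lty mmX mC Cb. exact: h.
have c10 : (0 <= c1)%R by rewrite -lee_fin -mCc.
pose r0 := (rC + rB)%R; have r00 : (0 <= r0)%R by rewrite addr_ge0.
have Cr x : C x -> (mdist x0 x <= r0)%R by move=> /CrC h; rewrite (le_trans h)// lerDl.
have Br x : B x -> (mdist x0 x <= r0)%R by move=> /BrB h; rewrite (le_trans h)// lerDr.
(* [Zm] bounds the normalising constants, which makes [kap] a lower bound for
   the mass on [C]; once [ln (b / dlt)] exceeds [Lam], the entropy gain outweighs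
   every term linear in [dlt] *)
pose Zm := (4 * N + 4 + 2 * G)%R; have Zm0 : (0 < Zm)%R by rewrite /Zm; lra.
pose kap := (P / 4 / Zm)%R; have kap0 : (0 < kap)%R by rewrite !divr_gt0.
pose Lam := (1 + (1 + `|K|) * (2 * r0) ^+ 2 / 2 + (c1 + 1) / kap)%R.
pose dlt := Num.min 1%R (b * expR (- Lam))%R.
have dlt0 : (0 < dlt)%R by rewrite lt_min ltr01 mulr_gt0 ?expR_gt0.
have dlt1 : (dlt <= 1)%R by rewrite ge_min lexx.
have dltb : (dlt <= b * expR (- Lam))%R by rewrite ge_min lexx orbT.
have lnb : (Lam <= ln (b / dlt))%R.
  rewrite -[leLHS]expRK ler_ln ?posrE ?expR_gt0 ?divr_gt0//.
  rewrite ler_pdivlMr// mulrC; apply: (@le_trans _ _ (b * expR (- Lam) * expR Lam)%R).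
    by rewrite ler_wpM2r// expR_ge0.
  by rewrite -mulrA -expRD addNr expR0 mulr1.
clearbody dlt.
(* [T * e] bounds the terms that vanish with the approximation error [e] *)
pose T := (4 / P * (6 + 2 * G + 16 * c * G))%R.
have cG0 : (0 <= 16 * c * G)%R by rewrite !mulr_ge0// ltW.
have T0 : (0 < T)%R by rewrite mulr_gt0 ?divr_gt0//; lra.
pose e := Num.min (Num.min 1%R (P / 4)%R) (dlt / (2 * T))%R.
have e0 : (0 < e)%R.
  by rewrite !lt_min ltr01 !divr_gt0// mulr_gt0.
have [e1 eP eT] : [/\ (e <= 1)%R, (e <= P / 4)%R & (T * e <= dlt / 2)%R].
  split; [by rewrite !ge_min lexx|by rewrite !ge_min lexx orbT|].
  apply: (@le_trans _ _ (T * (dlt / (2 * T)))%R).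
    by rewrite ler_wpM2l ?(ltW T0)// ge_min lexx orbT.
  by move: (T) T0 => t t0; have -> : (t * (dlt / (2 * t)) = dlt / 2)%R by field; rewrite gt_eqF.
clearbody e.
have e2 : (e ^+ 2 <= e)%R by rewrite expr2 ler_piMl// ltW.
have [u [ub u0 ug uS]] := happ _ e0.
have [Z [q [s [[vZ vq vs] Zle Pq qZ sle]]]] :=
  regularised_mass mmX c0 e0 ub u0 wG mg mC mB gN gP gB ug.
have qP : (P / 4 <= q)%R by lra.
have ZP : (P / 4 <= Z)%R by exact: le_trans qZ.
have Z0 : (0 < Z)%R by apply: lt_le_trans ZP; rewrite divr_gt0.
have e2G : (e ^+ 2 * G <= e * G)%R by rewrite ler_wpM2r.
have eG : (e * G <= G)%R by rewrite ler_piMl.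
have ZZm : (Z <= Zm)%R by rewrite /Zm; lra.
pose rho := regularised_density x0 c u e Z.
have mrho : measurable_fun setT rho := regularised_density_measurable mmX x0 c ub e Z.
have rho0 x : (0 < rho x)%R := regularised_density_gt0 x0 c u0 e0 Z0 x.
have rho0' x : (0 <= rho x)%R by exact: ltW.
have [L L0 rhoL] := ln_regularised_density_growth x0 c0 ub u0 e0 Z0.
have mv := regularised_measurable mmX x0 c ub e.
have iZ0 : (0 <= Z^-1)%R by rewrite invr_ge0 ltW.
have rho1 : \int[m]_x (rho x)%:E = 1.
  under eq_integral => x _ do rewrite /rho /regularised_density mulrC.
  rewrite integralZ_ge0//; last 2 first.
  - by move=> x; exact: sqr_ge0.
  - exact: measurable_funX.
  by rewrite vZ -EFinM mulVf// gt_eqF.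
have rhoA A t : measurable A ->
    \int[m]_x (regularised x0 c u e x ^+ 2 * \1_A x)%:E = t%:E ->
    \int[m]_x (rho x * \1_A x)%:E = (t / Z)%:E.
  move=> mA At; have E x : (rho x * \1_A x =
      Z^-1 * (regularised x0 c u e x ^+ 2 * \1_A x))%R.
    by rewrite /rho /regularised_density; ring.
  under eq_integral => x _ do rewrite E.
  rewrite integralZ_ge0//; last 2 first.
  - by move=> x; rewrite mulr_ge0 ?sqr_ge0// indicE ler0n.
  - by apply: measurable_funM; [exact: measurable_funX|exact: measurable_indic].
  by rewrite At -EFinM mulrC.
have [mu muE] := density_probability mrho rho0' rho1.
have muE' A : measurable A -> mu A = \int[m]_(x in A) (rho x)%:E by [].
have u2 : \int[m]_x (u x ^+ 2)%:E < +oo.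
  apply: le_lt_trans (ltry Z); rewrite -vZ; apply: integral_le_ge0.
  - by move=> x; exact: sqr_ge0.
  - move=> x; rewrite ler_pXn2r ?nnegrE ?(ltW (regularised_gt0 x0 c u0 e0 x))//.
    by rewrite lerDl mulr_ge0 ?(ltW e0)// ltW// gaussian_weight_gt0.
  - by apply: measurable_funX; exact: (lipschitz_in_measurable mmX ub.1).
  - exact: measurable_funX.
have mu2 := regularised_P2 mmX c0 e0 Z0 ub u0 wG u2 muE'.
have fisher := regularised_fisher_le mmX c0 e0 Z0 ub u0 wG uS muE'.
have a0 : (0 < q / Z)%R by rewrite divr_gt0//; apply: lt_le_trans qP; rewrite divr_gt0.
have := displacement_inequality mmX mrho rho0 rho1 rhoL L0 muE' mu2 mC mB dlt0 dlt1
  a0 b0 (rhoA _ _ mC vq) mBb mCc (rhoA _ _ mB vs) CB Cr Br cd r00 fisher.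
have kq : (kap <= q / Z)%R.
  apply: ler_pM => //; [by rewrite divr_ge0// ltW|by rewrite invr_ge0 ltW|].
  by rewrite lef_pV2 ?posrE.
have lo : (dlt * (c1 + 1) <= dlt * (q / Z) * (ln (b / dlt) - 1 -
    (1 + `|K|) * (2 * r0) ^+ 2 / 2))%R.
  have h : ((c1 + 1) / kap <= ln (b / dlt) - 1 - (1 + `|K|) * (2 * r0) ^+ 2 / 2)%R.
    by move: lnb; rewrite /Lam; lra.
  rewrite -mulrA ler_wpM2l ?(ltW dlt0)//.
  have ck : (0 <= (c1 + 1) / kap)%R by rewrite divr_ge0 ?addr_ge0// ltW.
  apply: (@le_trans _ _ (kap * ((c1 + 1) / kap))%R).
    by rewrite mulrCA mulfV ?mulr1// gt_eqF.
  by apply: ler_pM => //; exact: ltW.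
have iZP : (Z^-1 <= 4 / P)%R.
  have -> : (4 / P = (P / 4)^-1)%R by rewrite invf_div.
  by rewrite lef_pV2 ?posrE ?divr_gt0.
have hi : (s / Z + (8 / Z * e + 32 * c * e ^+ 2 / Z * G) / 2 <= T * e)%R.
  have -> : (s / Z + (8 / Z * e + 32 * c * e ^+ 2 / Z * G) / 2 =
    Z^-1 * (s + 4 * e + 16 * c * (e ^+ 2 * G)))%R by field; rewrite gt_eqF.
  have ceG : (16 * c * (e ^+ 2 * G) <= 16 * c * (e * G))%R.
    by rewrite ler_wpM2l// mulr_ge0// ltW.
  apply: (@le_trans _ _ (Z^-1 * ((6 + 2 * G + 16 * c * G) * e))%R).
    by rewrite ler_wpM2l//; lra.
  rewrite /T -[leRHS]mulrA ler_wpM2r// mulr_ge0 ?(ltW e0)//; lra.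
by move: lo hi eT dlt0; lra.
Qed.

End zero_energy.

Section ground_state.
Context {d : measure_display} {R : realType}
  {X : completeMetricMeasurableType d R}
  (m : {sigma_finite_measure set X -> \bar R})
  (mmX : is_metric_measure_space m).
Local Open Scope ereal_scope.

Lemma measure_bigcup_gt0 (A : (set X)^nat) : (forall n, measurable (A n)) ->
  m (\bigcup_n A n) <> 0 -> exists n, 0 < m (A n).
Proof.
move=> mA mA0; apply: contrapT => noA; apply: mA0.
apply: measure_negligible; first exact: bigcupT_measurable.
apply: negligible_bigcup => n; apply/negligibleP => //; apply/eqP.
rewrite eq_le measure_ge0 andbT leNgt; apply/negP => An; apply: noA; by exists n.
Qed.

(** Zero energy survives the contraction [s |-> max 0 (|s| - t)], which also makes
the approximants nonnegative. *)
Lemma cheeger_energy_truncation (f : L2 m) (t e : R) : (0 <= t)%R -> (0 < e)%R ->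
  cheeger_energy f = 0 ->
  exists u, [/\ Lip_bs u, forall x, (0 <= u x)%R,
    \int[m]_x ((u x - Num.max 0 (`|f x| - t)) ^+ 2)%:E <= e%:E &
    \int[m]_x (fine (slope u x) ^+ 2)%:E <= e%:E].
Proof.
move=> t0 e0 f0; have fe : cheeger_energy f < (e / 2)%:E by rewrite f0 lte_fin divr_gt0.
have [u [ub uf uE]] := cheeger_energy_approx fe e0.
have [K _ uK] := Lip_bs_bounded ub.
have mf := L2_measurable f; have mu := lipschitz_in_measurable mmX ub.1.
pose phi (s : R) : R := Num.max 0%R (`|s| - t)%R.
have phic a b : (`|phi a - phi b| <= `|a - b|)%R.
  apply: (le_trans (maxr_contraction _ _ _)).
  by rewrite (_ : (`|a| - t - (`|b| - t) = `|a| - `|b|)%R) ?ler_dist_dist//; ring.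
have phi0 : phi 0%R = 0%R.
  by rewrite /phi normr0 sub0r; apply/max_idPl; rewrite oppr_le0.
have mphi (g : X -> R) : measurable_fun setT g -> measurable_fun setT (phi \o g).
  move=> mg; apply: measurable_maxr => //.
  by apply: measurable_funB => //; exact: measurableT_comp.
have cb : Lip_bs (phi \o u).
  by apply: (Lip_bs_comp ub uK ler01 phi0) => a b _ _; rewrite mul1r.
exists (phi \o u); split => //; [by move=> x; rewrite le_max lexx| |].
- apply: le_trans uf; apply: integral_le_ge0.
  + by move=> x; exact: sqr_ge0.
  + move=> x; rewrite -[X in (X <= _)%R]real_normK ?num_real//.
    rewrite -[X in (_ <= X)%R]real_normK ?num_real//.
    by rewrite ler_pXn2r ?nnegrE//; exact: phic.
  + by apply: measurable_funX; apply: measurable_funB; exact: mphi.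
  + by apply: measurable_funX; exact: measurable_funB.
- have -> : e%:E = (2 * (e / 2))%:E by congr EFin; field.
  apply: le_trans uE; apply: integral_le_ge0.
  + by move=> x; exact: sqr_ge0.
  + move=> x; rewrite ler_pXn2r ?nnegrE ?fine_slope_ge0//.
    rewrite -lee_fin -(lipschitz_slope_fine x cb.1).
    apply: slope_contraction; first exact: fine_slope_ge0.
      exact: phic.
    by rewrite {1}(lipschitz_slope_fine x ub.1).
  + exact: (measurable_funX 2 (fine_slope_measurable mmX cb.1)).
  + exact: (measurable_funX 2 (fine_slope_measurable mmX ub.1)).
Qed.

(** Constants are not square integrable when the measure is infinite, so a
function of zero energy has a truncation that vanishes on a set of positive
measure without vanishing almost everywhere. *)
Lemma energy_neq0 (K : R) (f : L2 m) : CD m K -> m [set: X] = +oo ->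
  ~ ((f : X -> R) = cst 0%R %[ae m]) -> cheeger_energy f <> 0.
Proof.
move=> cd moo fn0 f0; have mf := L2_measurable f.
have [x0 _] := mms_growth mmX.
have maf : measurable_fun setT (fun x => `|f x|)%R by exact: measurableT_comp.
have mball (r : R) := open_ball_measurable mmX x0 r.
have mlt (t : R) : measurable [set x | (t < `|f x|)%R].
  rewrite -[X in measurable X]setTI.
  have := maf measurableT `]t, +oo[%classic (measurable_itv _).
  by congr (measurable (_ `&` _)); apply/seteqP; split => x /=; rewrite in_itv/= andbT.
have iS (S : set X) : measurable S -> m S = \int[m]_x (\1_S x)%:E.
  by move=> mS; rewrite integral_indic// setIT.
have inball x : exists n0 : nat, forall n, (n0 <= n)%N -> (mdist x0 x < n%:R)%R.
  exists (Num.truncn (mdist x0 x)).+1 => n h.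
  have /andP[_ k2] := Num.Theory.truncn_itv (mdist_ge0 x0 x).
  by apply: lt_le_trans k2 _; rewrite ler_nat.
have bdd (n : nat) (S : set X) : metric_bounded ([set x | (mdist x0 x < n%:R)%R] `&` S).
  by exists x0, n%:R%R => x [h _]; rewrite ballEmdist.
pose A (n : nat) := [set x | (mdist x0 x < n%:R)%R] `&` [set x | (n.+1%:R^-1 < `|f x|)%R].
have mA n : measurable (A n) by exact: measurableI.
have [n An] : exists n, 0 < m (A n).
  apply: measure_bigcup_gt0 => // mA0; apply: fn0.
  have : m.-negligible (\bigcup_n A n).
    by apply/negligibleP => //; exact: bigcupT_measurable.
  apply: negligibleS => x /=; rewrite not_implyE => -[_ /eqP fx].
  have [n0 hn0] := inball x.
  pose k := Num.truncn (`|f x|^-1)%R.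
  have fx0 : (0 < `|f x|)%R by rewrite normr_gt0.
  have ifx0 : (0 <= `|f x|^-1)%R by rewrite invr_ge0.
  have /andP[_ k2] := Num.Theory.truncn_itv ifx0.
  exists (maxn n0 k) => //; split => /=; first by apply: hn0; rewrite leq_maxl.
  rewrite invf_plt ?posrE//; apply: lt_le_trans k2 _.
  by rewrite ler_nat ltnS leq_maxr.
(* half the level, so that the truncation is at least [t] on [A n] *)
pose t : R := (2 * n.+1%:R)^-1%R.
have n0 : (0 < n.+1%:R :> R)%R by rewrite ltr0n.
have t0 : (0 < t)%R by rewrite invr_gt0 mulr_gt0.
have tn : (n.+1%:R^-1 = 2 * t)%R by rewrite /t; field; rewrite nat1r gt_eqF.
clearbody t.
pose g x : R := Num.max 0%R (`|f x| - t)%R.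
have mg : measurable_fun setT g by apply: measurable_maxr => //; exact: measurable_funB.
have g0 x : (0 <= g x)%R by rewrite le_max lexx.
have gf x : (g x ^+ 2 <= f x ^+ 2)%R.
  rewrite -[X in (_ <= X)%R]real_normK ?num_real// ler_pXn2r ?nnegrE//.
  by rewrite ge_max normr_ge0 lerBlDr lerDl ltW.
have mf2 : measurable_fun setT (fun x => f x ^+ 2)%R by exact: measurable_funX.
have mg2 : measurable_fun setT (fun x => g x ^+ 2)%R by exact: measurable_funX.
have gfle := integral_le_ge0 m (fun x => sqr_ge0 (g x)) gf mg2 mf2.
have gN := integral_eq_fine (fun x => sqr_ge0 (g x)) gfle (L2_lty f).
set N := fine _ in gN.
have gA0 x : (0 <= g x ^+ 2 * \1_(A n) x)%R.
  by rewrite mulr_ge0 ?sqr_ge0// indicE ler0n.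
have gAle : \int[m]_x (g x ^+ 2 * \1_(A n) x)%:E <= N%:E.
  rewrite -gN; apply: integral_le_ge0 => //.
  - by move=> x; rewrite ler_piMr ?sqr_ge0// indicE lern1 leq_b1.
  - by apply: measurable_funM => //; exact: measurable_indic.
have [P [gP P_ge0 _]] := integral_real gA0 gAle.
have P0 : (0 < P)%R.
  rewrite -lte_fin -gP; apply: (@lt_le_trans _ _ ((t ^+ 2)%:E * m (A n))).
    by rewrite mule_gt0// lte_fin exprn_gt0.
  rewrite (iS _ (mA n)).
  rewrite -integralZ_ge0 ?sqr_ge0//.
  apply: integral_le_ge0 => //.
  - by move=> x; rewrite mulr_ge0 ?sqr_ge0.
  - move=> x; rewrite indicE; case: (boolP (x \in A n)) => [|_]; last by rewrite !mulr0.
    rewrite inE => -[_ /=]; rewrite tn !mulr1 => h.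
    by rewrite ler_pXn2r ?nnegrE ?(ltW t0)// le_max; apply/orP; right; lra.
  - by apply: measurable_funM => //; exact: measurable_indic.
  - by apply: measurable_funM => //; exact: measurable_indic.
pose B (k : nat) := [set x | (mdist x0 x < k%:R)%R] `&` ~` [set x | (t < `|f x|)%R].
have mB k : measurable (B k) by apply: measurableI => //; exact: measurableC.
have [k Bk] : exists k, 0 < m (B k).
  apply: measure_bigcup_gt0 => // mB0.
  have UB : \bigcup_k B k = ~` [set x | (t < `|f x|)%R].
    apply/seteqP; split => [x [k _ []]//|x fx].
    by have [n1 h] := inball x; exists n1 => //; split => //; exact: h.
  have : (t ^+ 2)%:E * m [set x | (t < `|f x|)%R] < +oo.
    apply: le_lt_trans (L2_lty f).
    rewrite (iS _ (mlt t)).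
    rewrite -integralZ_ge0 ?sqr_ge0//.
    apply: integral_le_ge0 => //.
    - by move=> x; rewrite mulr_ge0 ?sqr_ge0.
    - move=> x; rewrite indicE; case: (boolP (x \in _)) => [|_]; last first.
        by rewrite mulr0 sqr_ge0.
      rewrite inE /= mulr1 => h; rewrite -[X in (_ <= X)%R]real_normK ?num_real//.
      by rewrite ler_pXn2r ?nnegrE ?(ltW t0)// ltW.
    - by apply: measurable_funM => //; exact: measurable_indic.
  rewrite -[m [set x | _]]adde0 -[X in _ + X]mB0 UB -measureU//; last 2 first.
  - exact: measurableC.
  - exact: setICr.
  rewrite setUv [X in _ * X](_ : _ = +oo); last exact: moo.
  by rewrite gt0_muley ?ltxx// lte_fin exprn_gt0.
apply: (zero_energy_contradiction mmX cd mg gN (mA n) (mB k) (bdd _ _) (bdd _ _) _ gP P0 _ Bk).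
- apply/seteqP; split => // x [[_ /=]] + [_ /=]; rewrite tn => h1 /negP; rewrite -leNgt; lra.
- move=> x [_ /= /negP]; rewrite -leNgt => h; apply/max_idPl; lra.
- by move=> e e0; exact: cheeger_energy_truncation (ltW t0) e0 f0.
Qed.

Lemma cheeger_constant_ge0 : 0 <= cheeger_constant m.
Proof.
apply: le_ereal_inf_tmp => _ [A [_ /andP[A0 _]] <-].
rewrite mule_ge0 ?inve_ge0 ?(ltW A0)//.
apply: le_ereal_inf_tmp => _ [u [_ _ ->]]; apply: limn_einf_ge => n.
apply: integral_ge0 => x _; exact: slope_ge0.
Qed.

End ground_state.

Local Open Scope ereal_scope.

Theorem theorem4p6 (R : realType) (d : measure_display)
    (X : completeMetricMeasurableType d R)
    (m : {sigma_finite_measure set X -> \bar R}) (K : R) (f : L2 m) :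
  is_metric_measure_space m ->
  RCD m K ->
  m [set: X]%classic = +oo ->
  inf_discrete_spectrum m < inf_essential_spectrum m ->
  eigenfunction (fine (inf_discrete_spectrum m)) f ->
  finite_norm m +oo f ->
  (4^-1)%:E * cheeger_constant m ^+ 2 < inf_discrete_spectrum m.
Proof.
move=> mmX [cd _] moo gap eig foo; rewrite ltNge; apply/negP => hle.
have inf0 : 0 <= inf_discrete_spectrum m.
  apply: le_ereal_inf_tmp => _ [l [/isolatedS [h lh] _] <-].
  by have [N [c [_ _ _ _ l0]]] := eigenfunction_energy mmX lh.
have [l lE] : exists l : R, inf_discrete_spectrum m = l%:E.
  exists (fine (inf_discrete_spectrum m)); rewrite fineK// ge0_fin_numE//.
  by apply: lt_le_trans gap _; rewrite leey.
rewrite lE /= in eig hle.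
have [N [c [N0 fN fc clN l0]]] := eigenfunction_energy mmX eig.
have hch : (2 * Num.sqrt l)%:E <= cheeger_constant m.
  have := cheeger_constant_ge0 m; move: hle.
  case: (cheeger_constant m) => [h| |]//; last by move=> _ _; exact: leey.
  rewrite -!EFinM !lee_fin => hl h0.
  rewrite -(@ler_pXn2r _ 2%N) ?nnegrE ?mulr_ge0 ?sqrtr_ge0// exprMn sqr_sqrtr//.
  by move: hl; lra.
have [M fM] : exists M : R, (\forall x \ae m, `|f x| <= M)%R.
  have := foo; rewrite /finite_norm unlock /= moo ltry.
  exact: ess_sup_inf.ess_supr_bounded.
have M1 : (0 < `|M| + 1)%R by rewrite ltr_wpDl.
have fM1 : (\forall x \ae m, `|f x| <= `|M| + 1)%R.
  apply: filterS fM => x h; apply: (le_trans h); apply: (le_trans (ler_norm M)).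
  by rewrite lerDl.
have lz := cheeger_equality_eigenvalue0 mmX l0 (ltW M1) N0 fM1 fN fc clN M1 hch eig.2.
apply: (energy_neq0 mmX cd moo eig.1).
by rewrite fc; congr EFin; move: clN; rewrite lz mul0r; lra.
Qed.
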